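(* Let $d,s,t$ be nonnegative integers. The Ramsey numbers $R(\mathsf{K},d,s,t)$ and $R_{\Lambda}(\mathsf{K},d,s,t)$ exist (are finite) for every field $\mathsf{K}$, and $R_{S}(\mathsf{K},d,s,t)$ exists when $\mathsf{K}$ is algebraically closed. Moreover, with constants depending only on $d$: (a) $R(\mathsf{K},d,s,t)\lesssim_d s^{d-1}t^{d^2}$ if $\mathsf{K}$ is infinite, and $R(\mathsf{K},d,s,t)\lesssim_d s^{d-1}t^{d}(\log_q s+\log_q t)$ if $|\mathsf{K}|=q$; (b) $R_{\Lambda}(\mathsf{K},d,s,t)\lesssim_d s^{d-1}t^{d^2}$ if $\mathsf{K}$ is infinite, and $R_{\Lambda}(\mathsf{K},d,s,t)\lesssim_d s^{d-1}t^{d}(\log_q s+\log_q t)$ if $|\mathsf{K}|=q$; (c) $R_{S}(\mathsf{K},d,s,t)\lesssim_d s^{d-1}t^d$ (for $\mathsf{K}$ algebraically closed).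
   Context: All vector spaces are finite-dimensional. For a multilinear $F:\mathbb{V}_1\times\cdots\times\mathbb{V}_d\to\mathbb{W}$ (also viewed as a linear map on $\mathbb{V}_1\otimes\cdots\otimes\mathbb{V}_d$): $\alpha(F)$ is the largest $s$ with subspaces $\mathbb{U}_i\subseteq\mathbb{V}_i$ all of dimension $s$ such that $F$ vanishes on $\mathbb{U}_1\times\cdots\times\mathbb{U}_d$; $\beta(F)$ is the largest $s$ with subspaces $\mathbb{U}_i\subseteq\mathbb{V}_i$ all of dimension $s$ such that $F$ is injective on $\mathbb{U}_1\otimes\cdots\otimes\mathbb{U}_d$. For $\mathbb{V}_1=\cdots=\mathbb{V}_d=\mathbb{V}$ and $F$ alternating (resp. symmetric): $\alpha_{\Lambda}(F)$ (resp. $\alpha_S(F)$) is the largest $\dim\mathbb{U}$, $\mathbb{U}\subseteq\mathbb{V}$, with $F$ vanishing on $\mathbb{U}^d$; $\beta_{\Lambda}(F)$ (resp. $\beta_S(F)$) is the largest $\dim\mathbb{U}$ such that $F$ is injective on $\mathbb{U}^{\otimes d}\cap\Lambda^d\mathbb{V}$ (resp. $\mathbb{U}^{\otimes d}\cap\mathrm{S}^d\mathbb{V}$), where $\Lambda^d\mathbb{V}$, $\mathrm{S}^d\mathbb{V}\subseteq\mathbb{V}^{\otimes d}$ are the subspaces of alternating and symmetric tensors. $R(\mathsf{K},d,s,t)$ is the minimal integer $m$ such that for all $\mathsf{K}$-vector spaces $\mathbb{V}_1,\dots,\mathbb{V}_d,\mathbb{W}$ with $\min_j\dim\mathbb{V}_j\ge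 m$ and every multilinear $F:\mathbb{V}_1\times\cdots\times\mathbb{V}_d\to\mathbb{W}$, either $\alpha(F)\ge s$ or $\beta(F)\ge t$. $R_{\Lambda}(\mathsf{K},d,s,t)$ (resp. $R_S(\mathsf{K},d,s,t)$) is the minimal $n$ such that for all $\mathbb{V},\mathbb{W}$ with $\dim\mathbb{V}\ge n$ and every alternating (resp. symmetric) $d$-multilinear $F:\mathbb{V}^d\to\mathbb{W}$, either $\alpha_\Lambda(F)\ge s$ or $\beta_\Lambda(F)\ge t$ (resp. $\alpha_S(F)\ge s$ or $\beta_S(F)\ge t$). Notation: $f\lesssim_d g$ means $f\le C_d\,g$ for a constant $C_d>0$ depending only on $d$.
   Formalization: Bounds are for d≥2; for |K|=q, log_q s+log_q t is replaced by max(1, log_q s+log_q t); β_Λ uses the map F induces on Λ^d V (equivalent if char K is 0 or >d); R_S requires char K to be 0 or >d. The literal claims fail otherwise. *)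

(* Defs.v *)
From HB Require Import structures.
From mathcomp Require Import all_boot all_order all_algebra all_fingroup.
From mathcomp Require Import all_classical all_reals all_analysis.

Set Implicit Arguments.
Unset Strict Implicit.
Unset Printing Implicit Defensive.

Import Order.TTheory GRing.Theory Num.Theory.

Local Open Scope classical_set_scope.
Local Open Scope ring_scope.

Section Multilinear.
Context {K : fieldType} {d : nat} {V : 'I_d -> vectType K} {W : vectType K}.
Implicit Types (F : (forall i, V i) -> W) (U : forall i, {vspace V i}).

Definition multilinear F : Prop :=
  forall (x : forall i, V i) (i : 'I_d) (a : K) (u v : V i),
    F (dfwith x i (a *: u + v)) = a *: F (dfwith x i u) + F (dfwith x i v).

End Multilinear.

(* The tensor product V_1 (x) ... (x) V_d is realized by arrays of coordinates
   in the basis of the pure tensors of vectors of the bases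
   vbasis {:V 1}, ..., vbasis {:V d}. *)
Section Tensor.
Context {K : fieldType} {d : nat}.
Variable V : 'I_d -> vectType K.

Definition tindex : finType := {dffun forall i : 'I_d, 'I_(\dim {:V i})}.

Definition tensor : vectType K := {ffun tindex -> K^o}.

End Tensor.

Section TensorMaps.
Context {K : fieldType} {d : nat} {V : 'I_d -> vectType K} {W : vectType K}.
Implicit Types (F : (forall i, V i) -> W) (U : forall i, {vspace V i}).

Definition tpure (v : forall i, V i) : tensor V :=
  [ffun a : tindex V => \prod_i coord (vbasis {:V i}) (a i) (v i)].

Definition tbasis (a : tindex V) : forall i, V i :=
  fun i => (vbasis {:V i})`_(a i).

(* F viewed as a linear map on V_1 (x) ... (x) V_d; see tlift_pure below. *)
Definition tlift F (T : tensor V) : W := \sum_a T a *: F (tbasis a).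

(* U_1 (x) ... (x) U_d as a subspace of V_1 (x) ... (x) V_d *)
Definition tsubspace U : {vspace tensor V} :=
  <<[seq tpure (fun i => (vbasis (U i))`_(b i))
      | b : {dffun forall i : 'I_d, 'I_(\dim (U i))}]>>%VS.

End TensorMaps.

Section Powers.
Context {K : fieldType} {d : nat} {V W : vectType K}.
Local Notation tpower := (tensor (fun _ : 'I_d => V)).
Local Notation tpindex := (tindex (fun _ : 'I_d => V)).
Implicit Types (F : ('I_d -> V) -> W) (T : tpower).

Definition alternating_multilinear F : Prop :=
  multilinear (V := fun=> V) F /\
  forall (x : 'I_d -> V) (i j : 'I_d), i != j -> x i = x j -> F x = 0.

Definition symmetric_multilinear F : Prop :=
  multilinear (V := fun=> V) F /\
  forall (x : 'I_d -> V) (s : 'S_d), F (x \o s) = F x.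

Definition index_perm (s : 'S_d) (a : tpindex) : tpindex :=
  [ffun i => a (s i)].

Definition symmetric_tensor : pred tpower := fun T =>
  [forall s : 'S_d, forall a, T (index_perm s a) == T a].

(* In characteristic 2 the vanishing condition does not follow from
   antisymmetry. *)
Definition alternating_tensor : pred tpower := fun T =>
  [forall a : tpindex, ~~ injectiveb a ==> (T a == 0)] &&
  [forall s : 'S_d, forall a, T (index_perm s a) == (-1) ^+ s * T a].

Definition increasing (a : tpindex) : bool :=
  [forall i : 'I_d, forall j : 'I_d, (i < j)%N ==> (a i < a j)%N].

Definition twedge (v : 'I_d -> V) : tpower :=
  \sum_(s : 'S_d) (-1) ^+ s *: tpure (V := fun=> V) (v \o s).

(* An alternating_multilinear F viewed as a linear map on the space of alternating tensors:
   it sends twedge v, which stands for v_1 /\ ... /\ v_d, to F v (lemma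
   altlift_wedge below).  On that space tlift F = d! * altlift F (lemma
   tlift_alternating below), so that both have the same injectivity properties
   when d! is invertible in K, whereas tlift F is identically 0 there
   when d! = 0 in K. *)
Definition altlift F (T : tpower) : W :=
  \sum_(a | increasing a) T a *: F (tbasis a).

End Powers.

Section TensorLemmas.
Context {K : fieldType} {d : nat} {V : 'I_d -> vectType K} {W : vectType K}.
Implicit Types F G : (forall i, V i) -> W.

Let dfwith_id (x : forall i, V i) i : dfwith x i (x i) = x.
Proof. by apply: functional_extensionality_dep => j; case: dfwithP. Qed.

Let multilinear_sum F (x : forall i, V i) i n (c : 'I_n -> K)
    (u : 'I_n -> V i) : multilinear F ->
  F (dfwith x i (\sum_j c j *: u j)) = \sum_j c j *: F (dfwith x i (u j)).
Proof.
move=> mF; have F0 : F (dfwith x i 0) = 0.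
  by have /eqP := mF x i 1 0 0; rewrite !scale1r addr0 -subr_eq0 opprD addNKr
    oppr_eq0 => /eqP.
by elim/big_ind2: _ => // [a b e f <- <-|j _];
  [have := mF x i 1 b f; rewrite !scale1r
  |have := mF x i (c j) (u j) 0; rewrite F0 !addr0].
Qed.

Let eq_multilinear F G : multilinear F -> multilinear G ->
  (forall a, F (tbasis a) = G (tbasis a)) -> F =1 G.
Proof.
move=> mF mG eFG.
suff H k : forall v : forall i, V i,
    (forall i : 'I_d, (k <= i)%N ->
       exists j, v i = (vbasis {:V i})`_(j : 'I_(\dim {:V i}))) -> F v = G v.
  by move=> v; apply: (H d) => i; rewrite leqNgt ltn_ord.
elim: k => [|k IH] v vP.
  pose a : tindex V := [ffun i => projT1 (cid (vP i isT))].
  suff -> : v = tbasis a by [].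
  apply: functional_extensionality_dep => i.
  by rewrite /tbasis ffunE; case: cid.
have [dk|kd] := leqP d k.
  by apply: IH => i ki; have := leq_trans dk ki; rewrite leqNgt ltn_ord.
pose i0 := Ordinal kd.
rewrite -(dfwith_id v i0) (coord_vbasis (memvf (v i0))) !multilinear_sum//.
apply: eq_bigr => j _; congr (_ *: _); apply: IH => i.
case: dfwithP => [_|i' ni ki]; first by exists j.
by apply: vP; rewrite ltn_neqAle ki andbT.
Qed.

Let multilinear_tpure_coef F : multilinear (fun v => tlift F (tpure v)).
Proof.
move=> x i c u v; rewrite /tlift scaler_sumr -big_split/=.
apply: eq_bigr => a _; rewrite !ffunE scalerA -scalerDl; congr (_ *: _).
rewrite !(bigD1 (P := xpredT) i isT)/= !dfwithin linearP mulrDl mulrA.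
by congr (_ * _ + _ * _); apply: eq_bigr => j ji;
  rewrite !dfwithout// eq_sym.
Qed.

Lemma tlift_pure F v : multilinear F -> tlift F (tpure v) = F v.
Proof.
move=> mF; apply: (eq_multilinear (multilinear_tpure_coef F) mF) => b.
have tb a : tpure (tbasis b) a = (a == b)%:R.
  rewrite ffunE; have [->|ab] := eqVneq a b.
    rewrite big1// => i _.
    by rewrite coord_free ?eqxx// (basis_free (vbasisP _)).
  have [i abi] : exists i, a i != b i.
    apply/existsP; rewrite -negb_forall; apply: contra ab => /forallP ab.
    by apply/eqP/ffunP => i; apply/eqP.
  rewrite (bigD1 i)//= coord_free ?(basis_free (vbasisP _))//.
  by rewrite eq_sym (negbTE abi) mul0r.
rewrite /tlift (bigD1 b)//= tb eqxx scale1r big1 ?addr0// => a ab.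
by rewrite tb (negbTE ab) scale0r.
Qed.

End TensorLemmas.

Section PowersLemmas.
Context {K : fieldType} {d : nat} {V W : vectType K}.
Local Notation tpower := (tensor (fun _ : 'I_d => V)).
Local Notation tpindex := (tindex (fun _ : 'I_d => V)).
Implicit Types (F : ('I_d -> V) -> W) (T : tpower).

Let alternating_tperm F (x : 'I_d -> V) i j : alternating_multilinear F -> i != j ->
  F (x \o tperm i j) = - F x.
Proof.
move=> [mF aF] ij.
pose H u v := F (dfwith (T := fun=> V) (dfwith (T := fun=> V) x i u) j v).
have Hs u u' v : H (u + u') v = H u v + H u' v.
  have sw w : dfwith (T := fun=> V) (dfwith (T := fun=> V) x i w) j v =
              dfwith (T := fun=> V) (dfwith (T := fun=> V) x j v) i w.
    apply: funext => k; have [<-|ik] := eqVneq i k.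
      by rewrite dfwithin dfwithout 1?eq_sym// dfwithin.
    have [<-|jk] := eqVneq j k; first by rewrite dfwithin dfwithout// dfwithin.
    by rewrite !dfwithout.
  by rewrite /H !sw; have := mF (dfwith (T := fun=> V) x j v) i 1 u u';
    rewrite !scale1r.
have Hs' u v v' : H u (v + v') = H u v + H u v'.
  by have := mF (dfwith (T := fun=> V) x i u) j 1 v v'; rewrite !scale1r.
have H0 u : H u u = 0.
  by apply: (aF _ i j ij); rewrite dfwithin dfwithout 1?eq_sym// dfwithin.
have := H0 (x i + x j); rewrite Hs !Hs' !H0 addr0 add0r.
have -> : H (x i) (x j) = F x.
  congr F; apply: funext => k; case: dfwithP => // k' _.
  by case: dfwithP.
have -> : H (x j) (x i) = F (x \o tperm i j).
  congr F; apply: funext => k /=; case: tpermP => [->|->|/eqP ki /eqP kj].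
  - by rewrite dfwithout 1?eq_sym// dfwithin.
  - by rewrite dfwithin.
  - by rewrite !dfwithout// eq_sym.
by move/eqP; rewrite addrC addr_eq0 => /eqP.
Qed.

Let alternating_perm F (x : 'I_d -> V) (s : 'S_d) : alternating_multilinear F ->
  F (x \o s) = (-1) ^+ s *: F x.
Proof.
move=> aF; have [ts -> /=] := prod_tpermP s.
elim: ts => [|[i j] ts IH] /= => [_|/andP[ij /IH {}IH]].
  rewrite big_nil odd_perm1 expr0 scale1r; congr F.
  by apply: funext => k /=; rewrite perm1.
rewrite big_cons odd_mul_tperm signr_addb/=.
rewrite (_ : x \o _ = (x \o (\prod_(t <- ts) tperm t.1 t.2)%g) \o tperm i j).
  by rewrite alternating_tperm// IH ij -scaleNr mulN1r.
by apply: funext => k /=; rewrite permM.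
Qed.

Let increasingP (a : tpindex) :
  reflect (forall i j : 'I_d, (i < j)%N -> (a i < a j)%N) (increasing a).
Proof.
apply: (iffP forallP) => [H i j|H i].
  by move/forallP: (H i) => /(_ j)/implyP.
by apply/forallP => j; apply/implyP/H.
Qed.

Let increasing_le (c c' : tpindex) (u : 'S_d) : increasing c ->
  increasing c' -> (forall i, c i = c' (u i)) -> forall i : 'I_d, (i <= u i)%N.
Proof.
move=> /increasingP ic /increasingP ic' cu [k].
elim: k => // k IH kd; have kd' := ltnW kd; have := IH kd'.
move/leq_ltn_trans; apply.
have := ic (Ordinal kd') (Ordinal kd) (ltnSn k); rewrite !cu.
have [//|] := ltnP (u (Ordinal kd')) (u (Ordinal kd)).
rewrite leq_eqVlt => /orP[/eqP/val_inj->|/ic' H /(ltn_trans H)].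
  by rewrite ltnn.
by rewrite ltnn.
Qed.

Let increasing_inj (c c' : tpindex) (s s' : 'S_d) : increasing c ->
  increasing c' -> index_perm s c = index_perm s' c' -> c = c' /\ s = s'.
Proof.
move=> ic ic' /ffunP css'.
have cu i : c i = c' ((s^-1 * s')%g i).
  by have := css' (s^-1%g i); rewrite !ffunE permKV permM.
have cu' i : c' i = c ((s'^-1 * s)%g i).
  by rewrite cu -permM mulgA -(mulgA _ s) mulgV mulg1 mulVg perm1.
have u1 : (s^-1 * s')%g = 1%g.
  apply/permP => i; rewrite perm1; apply/val_inj/eqP.
  rewrite eqn_leq (increasing_le ic ic' cu) andbT.
  have := increasing_le ic' ic cu' ((s^-1 * s')%g i).
  by rewrite -permM mulgA -(mulgA _ s') mulgV mulg1 mulVg perm1.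
split; first by apply/ffunP => i; rewrite cu u1 perm1.
by apply: (mulgI s^-1%g); rewrite u1 mulVg.
Qed.

Let increasing_surj (a : tpindex) : injective a ->
  exists c s, increasing c /\ a = index_perm s c.
Proof.
move=> ia; pose t := [tuple (a i : nat) | i < d].
have /tuple_permP[p tp] : perm_eq (sort leq t) t by rewrite perm_sort.
have ut : uniq t by rewrite map_inj_uniq ?enum_uniq// => i j /val_inj/ia.
have st : sorted ltn (sort leq t).
  by rewrite ltn_sorted_uniq_leq sort_uniq ut sort_sorted//; exact: leq_total.
exists (index_perm p a), p^-1%g; split; last first.
  by apply/ffunP => i; rewrite !ffunE permKV.
apply/increasingP => i j ij; rewrite !ffunE.
have nE (k : 'I_d) : nth 0%N (sort leq t) k = a (p k).
  rewrite tp (_ : nth _ _ _ = tnth [tuple tnth t (p i) | i < d] k) ?(tnth_nth 0%N)//.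
  by rewrite -(tnth_nth 0%N) !tnth_mktuple.
by rewrite -!nE; apply: (sorted_ltn_nth ltn_trans) => //;
  rewrite inE size_sort size_tuple.
Qed.

Let sum_injective (G : tpindex -> W) :
  (forall a : tpindex, ~~ injectiveb a -> G a = 0) ->
  \sum_a G a = \sum_(c | increasing c) \sum_(s : 'S_d) G (index_perm s c).
Proof.
move=> G0; pose h (cs : tpindex * 'S_d) := index_perm cs.2 cs.1.
pose D := [set cs : tpindex * 'S_d | increasing cs.1]%SET.
rewrite (pair_big increasing xpredT (fun c s => G (index_perm s c)))/=.
rewrite (eq_bigl (mem D)); last by move=> cs; rewrite /= inE andbT.
rewrite -(big_imset (h := h) G)/=; last first.
  move=> [c s] [c' s']; rewrite !inE/= => ic ic' hcs.
  by have [ec es] := increasing_inj ic ic' hcs; congr pair.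
rewrite [RHS]big_mkcond/=; apply: eq_bigr => a _; case: ifPn => // aD.
apply: G0; apply: contra aD => /injectiveP /increasing_surj[c [s [ic ->]]].
by apply/imsetP; exists (c, s); rewrite ?inE.
Qed.

Let tbasis_perm (s : 'S_d) (c : tpindex) :
  tbasis (index_perm s c) = tbasis c \o s.
Proof. by apply: funext => i; rewrite /tbasis /= ffunE. Qed.

Lemma tlift_alternating F T : alternating_multilinear F -> alternating_tensor T ->
  tlift (V := fun=> V) F T = d`!%:R *: altlift F T.
Proof.
move=> aF /andP[/forallP T0 /forallP TS].
rewrite /tlift sum_injective => [|a na]; last first.
  by have /implyP/(_ na)/eqP-> := T0 a; rewrite scale0r.
rewrite /altlift scaler_sumr; apply: eq_bigr => c _.
rewrite (eq_bigr (fun=> T c *: F (tbasis c))) => [|s _].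
  by rewrite sumr_const card_Sn scaler_nat.
have /forallP/(_ c)/eqP-> := TS s.
by rewrite tbasis_perm alternating_perm// scalerA mulrAC -expr2 sqrr_sign mul1r.
Qed.

Lemma altlift_wedge F v : alternating_multilinear F -> altlift F (twedge v) = F v.
Proof.
move=> aF; rewrite -(tlift_pure (V := fun=> V) v aF.1) /tlift sum_injective.
  apply: eq_bigr => c _; rewrite sum_ffunE scaler_suml.
  rewrite (reindex_inj invg_inj)/=; apply: eq_bigr => s _.
  rewrite tbasis_perm alternating_perm// scalerA !ffunE odd_permV mulrC.
  congr (_ * _ *: _); rewrite (reindex_inj (@perm_inj _ s))/=.
  by apply: eq_bigr => i _; rewrite permK !ffunE.
move=> a /injectivePn[i [j ij aij]].
by rewrite (aF.2 _ _ _ ij) ?scaler0// /tbasis aij.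
Qed.

End PowersLemmas.

(* The supremum of a set of natural numbers.  For the sets below it is the
   largest element, except for d = 0, where it may be +oo (no largest element)
   or -oo (empty set). *)
Definition nat_sup (R : realType) (A : set nat) : \bar R :=
  ereal_sup [set k%:R%:E | k in A].

Section AlphaBeta.
Variable R : realType.
Context {K : fieldType} {d : nat}.

Definition alpha {V : 'I_d -> vectType K} {W : vectType K}
    (F : (forall i, V i) -> W) : \bar R :=
  nat_sup R [set s | exists U : forall i, {vspace V i},
    (forall i, \dim (U i) = s) /\
    (forall x : forall i, V i, (forall i, x i \in U i) -> F x = 0)].

Definition beta {V : 'I_d -> vectType K} {W : vectType K}
    (F : (forall i, V i) -> W) : \bar R :=
  nat_sup R [set s | exists U : forall i, {vspace V i},
    (forall i, \dim (U i) = s) /\ {in tsubspace U &, injective (tlift F)}].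

Context {V W : vectType K}.
Implicit Type F : ('I_d -> V) -> W.

(* both alpha_Lambda and alpha_S *)
Definition alpha_diag F : \bar R :=
  nat_sup R [set s | exists U : {vspace V}, \dim U = s /\
    (forall x : 'I_d -> V, (forall i, x i \in U) -> F x = 0)].

Definition beta_diag (P : pred (tensor (fun _ : 'I_d => V)))
    (L : tensor (fun _ : 'I_d => V) -> W) : \bar R :=
  nat_sup R [set s | exists U : {vspace V}, \dim U = s /\
    {in [predI tsubspace (fun _ : 'I_d => U) & P] &, injective L}].

Definition beta_alt F := beta_diag alternating_tensor (altlift F).

Definition beta_sym F := beta_diag symmetric_tensor (tlift (V := fun=> V) F).

Lemma beta_alt_tlift F : alternating_multilinear F -> d`!%:R != 0 :> K ->
  beta_alt F = beta_diag alternating_tensor (tlift (V := fun=> V) F).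
Proof.
move=> aF d0; rewrite /beta_alt /beta_diag; congr nat_sup; apply/seteqP.
split => s [U [dU inj]]; exists U; split => // T1 T2 T1U T2U eT; apply: inj => //.
- have [/= /andP[_ a1] /andP[_ a2]] := (T1U, T2U).
  by move: eT; rewrite !tlift_alternating// => /(scalerI d0).
- have [/= /andP[_ a1] /andP[_ a2]] := (T1U, T2U).
  by rewrite !tlift_alternating// eT.
Qed.

End AlphaBeta.

Definition is_least (A : set nat) (m : nat) : Prop :=
  A m /\ forall n, A n -> (m <= n)%N.

Section Ramsey.
Variables (R : realType) (K : fieldType) (d s t : nat).

Definition is_ramsey : nat -> Prop := is_least [set m |
  forall (V : 'I_d -> vectType K) (W : vectType K) (F : (forall i, V i) -> W),
    (forall i, m <= \dim {:V i})%N -> multilinear F ->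
    (s%:R%:E <= alpha R F)%E \/ (t%:R%:E <= beta R F)%E].

Definition is_ramsey_alt : nat -> Prop := is_least [set n |
  forall (V W : vectType K) (F : ('I_d -> V) -> W),
    (n <= \dim {:V})%N -> alternating_multilinear F ->
    (s%:R%:E <= alpha_diag R F)%E \/ (t%:R%:E <= beta_alt R F)%E].

Definition is_ramsey_sym : nat -> Prop := is_least [set n |
  forall (V W : vectType K) (F : ('I_d -> V) -> W),
    (n <= \dim {:V})%N -> symmetric_multilinear F ->
    (s%:R%:E <= alpha_diag R F)%E \/ (t%:R%:E <= beta_sym R F)%E].

End Ramsey.

(* the logarithm of n in base q, with the convention that it is 0 at n = 0 *)
Definition logb (R : realType) (q n : nat) : R := ln n%:R / ln q%:R.

(* Main.v *)
(* A map [F] with no large [beta] satisfies a linear relation among the values [F (x o r k)] at every choice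
   of vectors [x]; there are at most [N <= t ^ d] rows [k].

   Over an infinite field, let [p] be a choice of vectors at which the matrix of these values has maximal
   rank, with a relation [c] at [p].  To first order, moving [p] in one slot keeps the rank maximal, so it
   moves [c] inside the row space, which has dimension at most [N]: the directions [v] preserving [c] are cut
   out by at most [N] linear equations.  Choosing vectors greedily preserves [c] at all points of the cubes
   [p + sum_i u_(e i)], about [s ^ (d - 1) * N] equations per vector, and taking differences along a cube
   isolates the coefficient [c k0] of one row, so [F] vanishes on the chosen vectors.  For symmetric [F] the
   vectors enter nonlinearly, each step imposes forms of degree at most [d] instead of linear equations, and
   over an algebraically closed field [N] forms in more than [N] variables have a common nontrivial zero.

   Over the field with [q] elements, a relation holding for a [q ^ - N] fraction of all [x] shows that [F] has
   at least this density of zeros.  Zero sets are subgroups in each coordinate, hence positively correlated,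
   so [m = 2 s] random vectors are isotropic with probability at least [q ^ (- N * m ^ d)]; this exceeds the
   probability that they span a space of dimension less than [s]. *)

Require Import Defs.
From HB Require Import structures.
From mathcomp Require Import all_boot all_order all_algebra all_fingroup.
From mathcomp Require Import ring zify.
From mathcomp Require mpoly.
From mathcomp Require Import boolp.

Set Implicit Arguments.
Unset Strict Implicit.
Unset Printing Implicit Defensive.

Import GRing.Theory.

Local Open Scope ring_scope.

(** * Ideals and common zeros of forms *)

(** The obstacle is that each choice of vectors [x] comes with its own relation [c], while
    differences along a cube need one [c] at all vertices; maximal rank provides it over infinite
    fields, pigeonhole over finite ones. Vectors sit in slots, and each row evaluates [F] on [d] of
    them. No row may have its slots inside those of another, so that iterated differences leave a
    single row. For general [F] the slots are pairs of a coordinate and an index; for alternating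
    [F] they are indices, and the rows are increasing multi-indices. Symmetric rows share and repeat
    slots, so no row can be isolated: there all slots move together along one direction [mu], and
    polarization, which needs d! invertible, replaces the differences. General and alternating [F]
    obey one bound of order s^(d-1) t^d over every field; the exponent d^2 and the logarithms come
    from weakening it. *)

Lemma dependent_rows (K : fieldType) (A B : finType) (G : A -> B -> K) :
  (#|B| < #|A|)%N ->
  exists c : A -> K, (exists a, c a != 0) /\ forall b, \sum_a c a * G a b = 0.
Proof.
move=> BA; pose M := \matrix_(i < #|A|, j < #|B|) G (enum_val i) (enum_val j).
have /rowV0Pn[u /sub_kermxP uM u0] : kermx M != 0.
  by rewrite -mxrank_eq0 mxrank_ker -lt0n subn_gt0 (leq_ltn_trans (rank_leq_col M)).
exists (fun a => u 0 (enum_rank a)); split.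
  have [i ui] : exists i, u 0 i != 0.
    apply/existsP; rewrite -negb_forall; apply: contra u0 => /forallP u0.
    by apply/eqP/rowP => i; rewrite mxE; exact/eqP.
  by exists (enum_val i); rewrite enum_valK.
move=> b; have /rowP/(_ (enum_rank b)) := uM; rewrite !mxE => uMb.
rewrite -[RHS]uMb [RHS](reindex_onto enum_rank enum_val) => [|i _].
  by apply: eq_big => [a|a _]; rewrite ?enum_rankK ?eqxx// mxE !enum_rankK.
by rewrite enum_valK.
Qed.

Section Ideals.
Variable R : comNzRingType.
Implicit Types (Q : R -> Prop) (a b : R).

Record ideal Q : Prop := Ideal {
  ideal0 : Q 0;
  idealD : forall a b, Q a -> Q b -> Q (a + b);
  idealM : forall a b, Q b -> Q (a * b) }.

Definition generated (I : finType) (g : I -> R) a :=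
  exists h : I -> R, a = \sum_j h j * g j.

Definition adjoin Q b a := exists q h, Q q /\ a = q + h * b.

Lemma idealB Q a b : ideal Q -> Q a -> Q b -> Q (a - b).
Proof. by move=> [_ QD QM] Qa Qb; apply: QD => //; rewrite -mulN1r; apply: QM. Qed.

Lemma ideal_sum Q (I : Type) (s : seq I) (P : pred I) (f : I -> R) :
  ideal Q -> (forall i, P i -> Q (f i)) -> Q (\sum_(i <- s | P i) f i).
Proof. by move=> [Q0 QD _] Qf; elim/big_rec: _ => // i x Pi; apply: QD; apply: Qf. Qed.

Lemma generated_ideal (I : finType) (g : I -> R) : ideal (generated g).
Proof.
split; first by exists (fun=> 0); rewrite big1// => i _; rewrite mul0r.
  move=> _ _ [h ->] [h' ->]; exists (fun i => h i + h' i).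
  by rewrite -big_split; apply: eq_bigr => i _; rewrite mulrDl.
move=> a _ [h ->]; exists (fun i => a * h i).
by rewrite mulr_sumr; apply: eq_bigr => i _; rewrite mulrA.
Qed.

Lemma generated_mem (I : finType) (g : I -> R) i : generated g (g i).
Proof.
exists (fun j => (j == i)%:R); rewrite (bigD1 i)//= eqxx mul1r big1 ?addr0// => j.
by move/negbTE->; rewrite mul0r.
Qed.

Lemma adjoin_ideal Q b : ideal Q -> ideal (adjoin Q b).
Proof.
move=> [Q0 QD QM]; split; first by exists 0, 0; rewrite mul0r addr0.
  move=> _ _ [q [h [Qq ->]]] [q' [h' [Qq' ->]]]; exists (q + q'), (h + h').
  by split; [exact: QD|rewrite mulrDl addrACA].
move=> a _ [q [h [Qq ->]]]; exists (a * q), (a * h).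
by split; [exact: QM|rewrite mulrDr mulrA].
Qed.

Lemma adjoin_sub Q b a : Q a -> adjoin Q b a.
Proof. by exists a, 0; rewrite mul0r addr0. Qed.

Lemma adjoin_mem Q b : ideal Q -> adjoin Q b b.
Proof. by exists 0, 1; split; [exact: ideal0|rewrite mul1r add0r]. Qed.

End Ideals.

(** If every [x - l] were invertible modulo [Q], the linear factors of [h] could be cancelled one at
    a time from a product lying in [Q], leaving [1] in [Q]. *)
Lemma adjoin_root (K : closedFieldType) (A : comAlgType K) (Q : A -> Prop)
    (x : A) (h : {poly K}) : ideal Q -> ~ Q 1 -> h != 0 -> Q (horner_alg x h) ->
  exists l : K, ~ adjoin Q (x - l%:A) 1.
Proof.
move=> iQ Q1 h0 Qh; apply: contrapT => /forallNP H; apply: Q1.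
have [s hs] := closed_field_poly_normal h.
have {Qh} : Q (\prod_(l <- s) (x - l%:A)).
  move: Qh; rewrite {1}hs linearZ/= rmorph_prod/= => /(idealM iQ (lead_coef h)^-1%:A).
  rewrite !mulr_algl scalerA mulVf ?lead_coef_eq0// scale1r.
  by under eq_bigr do rewrite rmorphB/= horner_algX horner_algC.
elim: s {hs} => [|l s IH]; rewrite ?big_nil// big_cons => Ql; apply: IH.
have /contrapT[q [r [Qq e]]] := H l.
set P := \prod_(l <- s) _ in Ql *.
have -> : P = P * q + r * ((x - l%:A) * P).
  by rewrite mulrA (mulrC P) -mulrDl -e mul1r.
by apply: (idealD iQ); apply: (idealM iQ).
Qed.

(** Homogeneous polynomial functions without a choice of coordinates; [form_mpoly] turns them into
    polynomials once a finite family of vectors is fixed. *)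
Inductive form (K : fieldType) (V : lmodType K) : nat -> (V -> K) -> Prop :=
| form_const c : form 0 (fun=> c)
| form_scalar f : scalar f -> form 1 f
| form_zero i : form i (fun=> 0)
| form_add i f g : form i f -> form i g -> form i (fun v => f v + g v)
| form_mul i j f g : form i f -> form j g -> form (i + j) (fun v => f v * g v).

Module Zeros.
Import mpoly.

(** Because of this, an ideal with homogeneous generators contains the components of its elements,
    and a homogeneous element has homogeneous coefficients. *)
Lemma pihomogM_homog (K : fieldType) (n i e : nat) (h f : {mpoly K[n]}) :
  f \is e.-homog ->
  pihomog mdeg i (h * f) = if (e <= i)%N then pihomog mdeg (i - e) h * f else 0.
Proof.
move=> fh; rewrite [in LHS](mpolyE h) mulr_suml linear_sum/=.
have mfh m : h@_m *: 'X_[m] * f \is (mdeg m + e).-homog.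
  by apply: dhomogM => //; rewrite dhomogZ// dhomogX.
case: ifP => [ei|/negbT]; last first.
  rewrite -ltnNge => ie; rewrite big1// => m _.
  by rewrite (pihomog_ne0 _ (mfh m)) ?gtn_eqF ?ltn_addl.
rewrite [in RHS](mpolyE h) linear_sum mulr_suml; apply: eq_bigr => m _ /=.
have [mi|mi] := eqVneq (mdeg m) (i - e)%N.
  have mh : (h@_m *: 'X_[m] : {mpoly K[n]}) \is (i - e).-homog.
    by rewrite dhomogZ// dhomogX/= mi.
  by rewrite (pihomog_dE mh) pihomog_dE// -(subnK ei) -mi.
rewrite (pihomog_ne0 _ (mfh m)); last by apply: contra mi => /eqP <-; rewrite addnK.
by rewrite (pihomog_ne0 (d := mdeg m)) ?mul0r ?dhomogZ ?dhomogX.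
Qed.

(** * Polynomials as a finite module over the subring generated by forms *)

Section Span.
Variables (K : fieldType) (n : nat) (T : finType).
Local Notation R := {mpoly K[n]}.
Variables (g : T -> R) (e : T -> nat) (M : nat).
Hypothesis e_gt0 : forall j, (0 < e j)%N.
Hypothesis g_homog : forall j, g j \is (e j).-homog.

Local Notation index D := ({ffun 'I_n -> 'I_M} * {ffun T -> 'I_D})%type.

(** When all variables are nilpotent modulo the ideal of [g], monomials with exponents below [M]
    generate all polynomials over the subring generated by [g]; [D] bounds the powers of [g]
    required in a given degree. *)
Definition span_term D (u : index D) : R :=
  (\prod_i 'X_i ^+ (u.1 i : nat)) * \prod_j g j ^+ (u.2 j : nat).

Definition spanned D (f : R) := exists c : index D -> K, f = \sum_u c u *: span_term u.

Lemma spanned_term D (u : index D) : spanned D (span_term u).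
Proof.
exists (fun v => (v == u)%:R); rewrite (bigD1 u)//= eqxx scale1r big1 ?addr0// => v.
by move/negbTE->; rewrite scale0r.
Qed.

Lemma spanned0 D : spanned D 0.
Proof. by exists (fun=> 0); rewrite big1// => u _; rewrite scale0r. Qed.

Lemma spannedD D f f' : spanned D f -> spanned D f' -> spanned D (f + f').
Proof.
move=> [c ->] [c' ->]; exists (fun u => c u + c' u).
by rewrite -big_split; apply: eq_bigr => u _; rewrite scalerDl.
Qed.

Lemma spannedZ D a f : spanned D f -> spanned D (a *: f).
Proof.
move=> [c ->]; exists (fun u => a * c u).
by rewrite scaler_sumr; apply: eq_bigr => u _; rewrite scalerA.
Qed.

Lemma spanned_sum D (I : Type) (s : seq I) (P : pred I) (f : I -> R) :
  (forall i, P i -> spanned D (f i)) -> spanned D (\sum_(i <- s | P i) f i).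
Proof.
move=> sf; elim/big_rec: _ => [|i x Pi]; first exact: spanned0.
by apply: spannedD; exact: sf.
Qed.

Lemma spanned_mul D f j : spanned D f -> spanned D.+1 (f * g j).
Proof.
move=> [c ->]; rewrite mulr_suml; apply: spanned_sum => u _.
rewrite -scalerAl; apply: spannedZ.
pose v : index D.+1 := (u.1, [ffun i => inord (u.2 i + (i == j))]).
have -> : span_term u * g j = span_term v; last exact: spanned_term.
rewrite /span_term -mulrA; congr (_ * _).
rewrite [RHS](eq_bigr (fun i => g i ^+ (u.2 i : nat) * g i ^+ (i == j))) => [|i _].
  rewrite big_split/=; congr (_ * _).
  by rewrite (bigD1 j)//= eqxx expr1 big1 ?mulr1// => i /negbTE->; rewrite expr0.
rewrite ffunE inordK ?exprD//; case: (i == j); rewrite ?addn1 ?addn0 ?ltnS//.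
by rewrite ltnW.
Qed.

Hypothesis nilX : forall i, generated g ('X_i ^+ M).

(** Only the components of degree [M - e j] of the coefficients contribute. Their homogeneity is
    what lets the degree drop in [spanned_monomial]. *)
Lemma nilX_homog i : exists a : T -> R, 'X_i ^+ M = \sum_j a j * g j /\
  forall j, if (e j <= M)%N then a j \is (M - e j).-homog
            else a j == 0.
Proof.
have [h hE] := nilX i.
exists (fun j => if (e j <= M)%N then pihomog mdeg (M - e j) (h j) else 0).
split; last by move=> j; case: (e j <= M)%N => //; apply: pihomogP.
have XM : ('X_i ^+ M : R) \is M.-homog.
  by rewrite mpolyXn dhomogX/= mdegMn mdeg1 mul1n.
rewrite -{1}(pihomog_dE XM) hE linear_sum/=; apply: eq_bigr => j _.
by rewrite (pihomogM_homog _ _ (g_homog j)); case: ifP; rewrite // mul0r.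
Qed.

(** Induction on [D]: a factor ['X_i ^+ M] is replaced by the sum of the [a j * g j], which spends
    one power of [g j] and lowers the degree of the rest by [e j > 0]. *)
Lemma spanned_monomial D (m : 'X_{1..n}) : (mdeg m < D)%N -> spanned D 'X_[m].
Proof.
elim: D m => // D IH m; rewrite ltnS => mD.
have [/forallP mM|] := boolP [forall i, m i < M]%N.
  pose u : index D.+1 := ([ffun i => Ordinal (mM i)], [ffun=> ord0]).
  have -> : 'X_[m] = span_term u; last exact: spanned_term.
  rewrite /span_term [X in _ * X]big1 ?mulr1 => [|j _]; last by rewrite ffunE expr0.
  by rewrite mpolyXE_id; apply: eq_bigr => i _; rewrite ffunE.
rewrite negb_forall => /existsP[i]; rewrite -leqNgt => Mi.
have [a [Xa ha]] := nilX_homog i.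
pose m' := (m - U_(i) *+ M)%MM.
have mE : m = (m' + U_(i) *+ M)%MM.
  apply/mnmP => k; rewrite mnmDE mnmBE mulmnE mnm1E.
  by case: eqP => [<-|_]; rewrite ?mul1n ?mul0n ?subnK ?addn0// subn0.
rewrite mE mpolyXD -mpolyXn Xa mulr_sumr; apply: spanned_sum => j _.
rewrite mulrA; apply: spanned_mul; move: (ha j).
case: ifP => [eM aj|_ /eqP->]; last by rewrite mulr0; exact: spanned0.
rewrite (mpolyE (a j)) mulr_sumr big_seq; apply: spanned_sum => k ka.
rewrite -scalerAr -mpolyXD; apply: spannedZ; apply: IH.
move: mD; rewrite mE !mdegD mdegMn mdeg1 mul1n => mD.
have -> : mdeg k = (M - e j)%N by have /dhomogP := aj; exact.
apply: leq_trans mD; rewrite -addnS leq_add2l.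
by rewrite ltn_subrL e_gt0 (leq_trans (e_gt0 j) eM).
Qed.

Lemma spanned_degree_lt D f : (forall m, m \in msupp f -> mdeg m < D)%N -> spanned D f.
Proof.
move=> fD; rewrite (mpolyE f) big_seq; apply: spanned_sum => m mf.
by apply: spannedZ; apply: spanned_monomial; exact: fD.
Qed.

End Span.

(* Counting: the [B ^ n] monomials with all exponents less than [B] have degree at most [n * B], and the
   terms spanning them number [M ^ n * (n * B + 1) ^ #|T|], which is smaller for large [B]. *)
Lemma not_all_nilpotent (K : fieldType) (n : nat) (T : finType)
    (g : T -> {mpoly K[n]}) (e : T -> nat) :
  (forall j, 0 < e j)%N -> (forall j, g j \is (e j).-homog) ->
  (#|T| < n)%N -> ~ exists M, forall i, generated g ('X_i ^+ M).
Proof.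
move=> e0 gh Tn [M nilX].
(* With this [B], [M ^ n * (n.+1 * B) ^ #|T| < B ^ #|T|.+1 <= B ^ n], the last step because
   [#|T| < n]. *)
pose B := (M ^ n * n.+1 ^ #|T|).+1; pose D := (n * B).+1.
pose X (b : {ffun 'I_n -> 'I_B}) : {mpoly K[n]} := 'X_[[multinom b i : nat | i < n]].
have Xs b : spanned g M D (X b).
  apply: (spanned_monomial e0 gh nilX); rewrite mdegE ltnS.
  rewrite -[X in (X * B)%N]card_ord -sum_nat_const; apply: leq_sum => i _.
  by rewrite mnmE ltnW.
have [c cE] := choice Xs.
have [|l [[b lb] l0]] := @dependent_rows K _ _ c.
  rewrite card_prod !card_ffun !card_ord.
  have DB : (D <= n.+1 * B)%N by rewrite /D mulSn addnC -addn1 leq_add2l.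
  apply: leq_ltn_trans (_ : M ^ n * (n.+1 * B) ^ #|T| < _)%N.
    by rewrite leq_mul2l; case: (#|T|) => [|k]; rewrite ?expn0 ?leqnn ?leq_exp2r ?DB ?orbT.
  rewrite expnMn mulnA; apply: leq_trans (_ : B * B ^ #|T| <= _)%N.
    by rewrite ltn_mul2r expn_gt0/= ltnSn.
  by rewrite -expnS leq_pexp2l.
suff : (\sum_a l a *: X a)@_[multinom b i : nat | i < n] = l b.
  rewrite (eq_bigr (fun a => \sum_u (l a * c a u) *: span_term g u)) => [|a _].
    rewrite exchange_big/= big1 ?mcoeff0 => [/esym/eqP|u _]; first exact/negP.
    by rewrite -scaler_suml l0 scale0r.
  by rewrite {1}cE scaler_sumr; apply: eq_bigr => u _; rewrite scalerA.
rewrite linear_sum (bigD1 b)//= linearZ/= mcoeffX eqxx mulr1 big1 ?addr0// => a ab.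
rewrite linearZ/= mcoeffX; case: eqP => [/mnmP ea|]; last by rewrite mulr0.
by case/eqP: ab; apply/ffunP => i; have := ea i; rewrite !mnmE => /val_inj.
Qed.

(** * Existence of a nontrivial common zero of fewer forms than variables *)

Section CommonZero.
Variables (K : closedFieldType) (n N : nat) (p : 'I_N -> {mpoly K[n]}) (d : 'I_N -> nat).
Local Notation R := {mpoly K[n]}.
Hypothesis d_gt0 : forall j, (0 < d j)%N.
Hypothesis p_homog : forall j, p j \is (d j).-homog.
Hypothesis Nn : (N < n)%N.

(** Successive sections by coordinate hyperplanes, padded with 0 to keep one index type for all [k].
    At a [k] given by [nilpotent_mod_jump] the projective zero set is nonempty, finite and off the
    hyperplane [Xk = 0], so a zero can be sought in the chart [Xk = 1]. *)
Definition cut (k : nat) (j : 'I_N + 'I_n) : R :=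
  match j with inl j => p j | inr m => if (m < k)%N then 'X_m else 0 end.

Definition cut_deg (j : 'I_N + 'I_n) : nat :=
  match j with inl j => d j | inr _ => 1 end.

Definition nilpotent_mod (k : nat) := exists M, forall i, generated (cut k) ('X_i ^+ M).

Lemma cut_deg_gt0 j : (0 < cut_deg j)%N.
Proof. by case: j => /=. Qed.

Lemma cut_homog k j : cut k j \is (cut_deg j).-homog.
Proof.
case: j => [j|m] /=; first exact: p_homog.
by case: ifP => _; rewrite ?dhomog0 ?dhomogX/= ?mdeg1.
Qed.

Lemma generated_cut_homog k i f :
  generated (cut k) f -> generated (cut k) (pihomog mdeg i f).
Proof.
move=> [h ->]; rewrite linear_sum/=; apply: ideal_sum => [|j _].
  exact: generated_ideal.
rewrite (pihomogM_homog _ _ (cut_homog k j)); case: ifP => _.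
  by apply: idealM; [exact: generated_ideal|exact: generated_mem].
by apply: ideal0; exact: generated_ideal.
Qed.

Lemma cutS k (kn : (k < n)%N) f : generated (cut k.+1) f ->
  adjoin (generated (cut k)) 'X_(Ordinal kn) f.
Proof.
have iJ := generated_ideal (cut k).
move=> [h ->]; apply: ideal_sum => [|j _]; first exact: adjoin_ideal.
apply: idealM; first exact: adjoin_ideal.
case: j => [j|m]; first by apply: adjoin_sub; exact: (generated_mem _ (inl j)).
rewrite /= ltnS leq_eqVlt; case: eqP => [mk|_] /=.
  by rewrite (_ : m = Ordinal kn); [exact: adjoin_mem|exact: val_inj].
by apply: adjoin_sub; exact: (generated_mem (cut k) (inr m)).
Qed.

Lemma nilpotent_mod0 : ~ nilpotent_mod 0.
Proof.
move=> [M nilM]; apply: (@not_all_nilpotent K n _ p d) => //.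
  by rewrite card_ord.
exists M => i; have [h ->] := nilM i; exists (h \o inl).
rewrite big_sumType/= [X in _ + X]big1 ?addr0// => m _.
by rewrite mulr0.
Qed.

Lemma nilpotent_modn : nilpotent_mod n.
Proof.
exists 1%N => i; rewrite expr1.
have := generated_mem (cut n) (inr i).
by rewrite /= ltn_ord.
Qed.

Lemma nilpotent_mod_jump : exists k, [/\ (k < n)%N, ~ nilpotent_mod k & nilpotent_mod k.+1].
Proof.
apply: contrapT => /forallNP H.
have : ~ nilpotent_mod n; last by move/(_ nilpotent_modn).
suff : forall k, (k <= n)%N -> ~ nilpotent_mod k by exact.
elim=> [_|k IH kn]; first exact: nilpotent_mod0.
by move=> nk; apply: (H k); split => //; exact/IH/ltnW.
Qed.

Variables (k : nat) (kn : (k < n)%N).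
Hypothesis nilk : ~ nilpotent_mod k.
Hypothesis nilkS : nilpotent_mod k.+1.
Local Notation Xk := ('X_(Ordinal kn) : R).
Local Notation J := (generated (cut k)).
Local Notation Q := (adjoin J (Xk - 1)).

Let idJ : ideal J := generated_ideal _.
Let idQ : ideal Q := adjoin_ideal _ idJ.

(** Modulo [J], each ['X_i ^+ M] is a multiple of [Xk]; nilpotency of [Xk] would pass to all
    variables, against the choice of [k]. *)
Lemma Xk_not_nilpotent L : ~ J (Xk ^+ L).
Proof.
move=> XL; apply: nilk; have [M nilM] := nilkS; exists (M * L)%N => i.
have [q [b [Jq XM]]] := cutS kn (nilM i).
rewrite exprM XM -[X in J X](subrK ((b * Xk) ^+ L)); apply: (idealD idJ).
  by rewrite subrXX addrK mulrC; apply: (idealM idJ).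
by rewrite exprMn; apply: (idealM idJ).
Qed.

(* If [1 = q + h (Xk - 1)] with [q] in the homogeneous ideal [J], comparing homogeneous components
   gives [h_i = - Xk ^ i] modulo [J], and [h_i = 0] for large [i]. *)
Lemma dehomogenized_proper : ~ Q 1.
Proof.
move=> [q [h [Jq e1]]].
have XE : Xk \is 1.-homog by rewrite dhomogX/= mdeg1.
have oneE : (1 : R) \is 0.-homog by exact: dhomog1.
have hE : h = q - 1 + h * Xk by rewrite {1}e1 mulrBr mulr1; ring.
suff Jh i : J (pihomog mdeg i h + Xk ^+ i).
  have := Jh (msize h); rewrite pihomogE big_seq_cond big1 ?add0r => [|m /andP[mh /eqP mE]].
    exact: Xk_not_nilpotent.
  by have := msize_mdeg_lt mh; rewrite mE ltnn.
elim: i => [|i IH].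
  rewrite hE linearD linearB/= (pihomogM_homog _ _ XE) ltnn addr0.
  rewrite expr0 (pihomog_dE oneE) subrK.
  exact: generated_cut_homog.
rewrite hE linearD linearB/= (pihomogM_homog _ _ XE) subn1/=.
rewrite (pihomog_ne0 _ oneE)// subr0 exprSr -addrA -mulrDl.
by apply: (idealD idJ); [exact: generated_cut_homog|rewrite mulrC; exact: (idealM idJ)].
Qed.

(** The quotient by [Q] is finite-dimensional, being spanned by the monomials with exponents below
    [M]; hence the powers of ['X_i] are dependent modulo [Q]. *)
Lemma algebraic_mod (i : 'I_n) : exists2 h : {poly K}, h != 0 & Q (horner_alg ('X_i : R) h).
Proof.
have [M nilM] := nilkS.
pose mon (m : {ffun 'I_n -> 'I_M}) : R := \prod_i 'X_i ^+ (m i : nat).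
(* Modulo [Q] the generators from [cut k] are 0 and the additional generator [Xk] is 1, so products
   of generators reduce to booleans. *)
have cutQ j : exists b : bool, Q (cut k.+1 j - b%:R).
  case: j => [j|m] /=.
    by exists false; rewrite subr0; apply: adjoin_sub; exact: (generated_mem _ (inl j)).
  rewrite ltnS leq_eqVlt; case: eqP => [mk|_] /=.
    exists true; rewrite (_ : m = Ordinal kn); [exact: adjoin_mem|exact: val_inj].
  exists false; rewrite subr0; apply: adjoin_sub.
  exact: (generated_mem (cut k) (inr m)).
have [b bQ] := choice cutQ.
have prodQ (a : 'I_N + 'I_n -> nat) :
    exists c : bool, Q (\prod_j cut k.+1 j ^+ a j - c%:R).
  elim/big_rec: _ => [|j x _ [c IH]].
    by exists true; rewrite subrr; exact: ideal0.
  exists ((b j || (a j == 0)%N) && c).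
  have -> : ((b j || (a j == 0)%N) && c)%:R = (b j)%:R ^+ a j * c%:R :> R.
    by case: (b j); case: (a j) => [|a']; case: c {IH}; rewrite ?expr1n ?expr0n/= ?mulr1 ?mul0r ?mulr0.
  set y := cut _ _; have -> : y ^+ a j * x - (b j)%:R ^+ a j * c%:R =
    x * (y ^+ a j - (b j)%:R ^+ a j) + (b j)%:R ^+ a j * (x - c%:R) by ring.
  apply: (idealD idQ); apply: (idealM idQ) => //.
  by rewrite subrXX mulrC; exact/(idealM idQ)/bQ.
have red f : exists c : {ffun 'I_n -> 'I_M} -> K, Q (f - \sum_m c m *: mon m).
  have [|c ->] := spanned_degree_lt (D := msize f) cut_deg_gt0 (cut_homog k.+1) nilM (f := f).
    by move=> m; exact: msize_mdeg_lt.
  elim/big_rec: _ => [|u x _ [c' IH]].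
    exists (fun=> 0); rewrite big1 => [|m _]; last by rewrite scale0r.
    by rewrite subrr; exact: ideal0.
  have [e eQ] := prodQ (fun j => u.2 j).
  exists (fun m => c u * e%:R * (m == u.1)%:R + c' m).
  under eq_bigr do rewrite scalerDl.
  rewrite big_split/= opprD addrACA; apply: (idealD idQ) => //.
  rewrite (bigD1 u.1)//= eqxx mulr1 big1 ?addr0 => [|m /negbTE->]; last first.
    by rewrite mulr0 scale0r.
  rewrite -scalerA -scalerBr -mul_mpolyC; apply: (idealM idQ).
  by rewrite /span_term -/(mon u.1) scaler_nat -mulr_natr -mulrBr; exact: (idealM idQ).
(* One more power of ['X_i] than there are reduced monomials. *)
have [c cQ] := choice (fun a : 'I_(#|{ffun 'I_n -> 'I_M}|.+1) => red ('X_i ^+ a)).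
have [|l [[a0 la0] l0]] := @dependent_rows K _ _ c; first by rewrite card_ord.
exists (\sum_a l a *: 'X^a).
  apply/eqP => /polyP/(_ a0)/eqP; rewrite coef0 coef_sum (bigD1 a0)//= big1.
    by rewrite coefZ coefXn eqxx mulr1 addr0; exact/negP.
  by move=> a aa0; rewrite coefZ coefXn eq_sym (negbTE (_ : val a != a0)) ?mulr0.
have E : \sum_a l a *: (\sum_m c a m *: mon m) = 0.
  under eq_bigr do rewrite scaler_sumr.
  rewrite exchange_big/= big1// => m _.
  by under eq_bigr do rewrite scalerA; rewrite -scaler_suml l0 scale0r.
have -> : horner_alg ('X_i : R) (\sum_a l a *: 'X^a) =
    \sum_a l a *: ('X_i ^+ a - \sum_m c a m *: mon m).
  under [RHS]eq_bigr do rewrite scalerBr.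
  rewrite sumrB E subr0 linear_sum/=; apply: eq_bigr => a _.
  by rewrite linearZ/= rmorphXn/= horner_algX mulr_algl.
by apply: ideal_sum => // a _; rewrite -mul_mpolyC; exact/(idealM idQ)/cQ.
Qed.

End CommonZero.

(** Adjoining some ['X_i - y i] for each variable keeps the ideal proper by [adjoin_root]. Then each
    [f] is congruent to the constant [f.@[y]], which must be 0 when [f] is in the ideal. *)
Lemma proper_ideal_zero (K : closedFieldType) (n : nat) (Q : {mpoly K[n]} -> Prop) :
  ideal Q -> ~ Q 1 ->
  (forall i, exists2 h : {poly K}, h != 0 & Q (horner_alg ('X_i : {mpoly K[n]}) h)) ->
  exists y : 'I_n -> K, forall f, Q f -> f.@[y] = 0.
Proof.
move=> iQ Q1 algQ.
have [Q' [iQ' Q'1 QQ' Q'X]] : exists Q' : {mpoly K[n]} -> Prop,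
    [/\ ideal Q', ~ Q' 1, forall f, Q f -> Q' f &
       forall i, i \in enum 'I_n -> exists l, Q' ('X_i - l%:MP)].
  elim: (enum 'I_n) => [|i s [Q' [iQ' Q'1 QQ' IH]]]; first by exists Q.
  have [h h0 Qh] := algQ i.
  have [l Ql] := adjoin_root iQ' Q'1 h0 (QQ' _ Qh).
  exists (adjoin Q' ('X_i - l%:A)); split=> //; first exact: adjoin_ideal.
    by move=> f /QQ'; exact: adjoin_sub.
  move=> j; rewrite inE => /orP[/eqP->|/IH[m Q'm]]; last by exists m; exact: adjoin_sub.
  by exists l; rewrite -alg_mpolyC; exact: adjoin_mem.
have /choice[y yE] : forall i, exists l, Q' ('X_i - l%:MP).
  by move=> i; apply: Q'X; rewrite mem_enum.
exists y => f /QQ' Q'f; apply/eqP; apply: contra_notT Q'1 => fy.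
have red : Q' (f - f.@[y]%:MP).
  rewrite (mpolyE f) linear_sum/= raddf_sum -sumrB; apply: ideal_sum => // m _.
  rewrite mevalZ /= mpolyCM -mul_mpolyC -mulrBr; apply: (idealM iQ').
  rewrite mevalX mpolyXE_id rmorph_prod/=.
  elim/big_ind2: _ => [|a b c e Qa Qc|i _]; first by rewrite subrr; exact: ideal0.
    have -> : b * e - a * c = e * (b - a) + a * (e - c) by ring.
    by apply: (idealD iQ'); exact: (idealM iQ').
  by rewrite rmorphXn/= subrXX mulrC; exact: (idealM iQ').
have -> : 1 = (f.@[y])^-1%:MP * (f - (f - f.@[y]%:MP)) :> {mpoly K[n]}.
  by rewrite opprB addrC subrK -mpolyCM mulVf.
by apply: (idealM iQ'); exact: (idealB iQ').
Qed.

Theorem forms_common_zero (K : closedFieldType) (n N : nat)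
    (p : 'I_N -> {mpoly K[n]}) (d : 'I_N -> nat) :
  (N < n)%N -> (forall j, 0 < d j)%N -> (forall j, p j \is (d j).-homog) ->
  exists y : 'I_n -> K, (exists i, y i != 0) /\ forall j, (p j).@[y] = 0.
Proof.
move=> Nn d0 ph.
have [k [kn nilk nilkS]] := nilpotent_mod_jump d0 ph Nn.
have iJ := generated_ideal (cut p k).
have [y y0] := proper_ideal_zero (adjoin_ideal _ iJ)
  (dehomogenized_proper ph nilk nilkS) (algebraic_mod d0 ph kn nilkS).
exists y; split; last first.
  by move=> j; apply/y0/adjoin_sub; exact: (generated_mem (cut p k) (inl j)).
(* The zero lies in the chart [Xk = 1], hence is nontrivial. *)
exists (Ordinal kn); apply/eqP => yk.
have := y0 _ (adjoin_mem ('X_(Ordinal kn) - 1) iJ).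
by rewrite mevalB meval1 mevalXU yk sub0r => /eqP; rewrite oppr_eq0 oner_eq0.
Qed.

Lemma form_mpoly (K : fieldType) (V : vectType K) n (b : 'I_n -> V) i (f : V -> K) :
  form i f -> exists2 p : {mpoly K[n]}, p \is i.-homog &
    forall y : 'I_n -> K, p.@[y] = f (\sum_m y m *: b m).
Proof.
move=> ff; elim: i f / ff
  => [c|g lg|j|j g h _ [p ph pE] _ [q qh qE]|j k g h _ [p ph pE] _ [q qh qE]].
- exists c%:MP => [|y]; last by rewrite mevalC.
  by rewrite -[c]mulr1 rmorphM/= mul_mpolyC dhomogZ// dhomog1.
- exists (\sum_m g (b m) *: 'X_m) => [|y].
    by apply: rpred_sum => m _; rewrite dhomogZ// dhomogX/= mdeg1.
  have gD u v : g (u + v) = g u + g v by have := lg 1 u v; rewrite scale1r mul1r.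
  have g0 : g 0 = 0 by apply: (addrI (g 0)); rewrite -gD !addr0.
  rewrite linear_sum/=; elim/big_ind2: _ => [|x1 x2 y1 y2 xE yE|m _]; rewrite ?g0 ?gD ?xE ?yE//.
  by rewrite mevalZ mevalXU mulrC; have := lg (y m) (b m) 0; rewrite g0 !addr0.
- by exists 0 => [|y]; rewrite ?dhomog0 ?meval0.
- by exists (p + q) => [|y]; rewrite ?dhomogD// mevalD pE qE.
- by exists (p * q) => [|y]; [exact: dhomogM|rewrite mevalM pE qE].
Qed.

Theorem form_common_zero (K : closedFieldType) (V : vectType K) (U : {vspace V})
    (J : finType) (d : J -> nat) (f : J -> V -> K) :
  (forall j, form (d j) (f j)) -> (forall j, 0 < d j)%N -> (#|J| < \dim U)%N ->
  exists v, [/\ v \in U, v != 0 & forall j, f j v = 0].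
Proof.
move=> ff d0 JU; pose b (m : 'I_(\dim U)) := (vbasis U)`_m.
have /choice[p pP] : forall j, exists p : {mpoly K[\dim U]}, p \is (d j).-homog /\
    forall y : 'I__ -> K, p.@[y] = f j (\sum_m y m *: b m).
  by move=> j; have [p] := form_mpoly b (ff j); exists p.
have [y [[m ym] y0]] := forms_common_zero (p := fun i => p (enum_val i))
  JU (fun i => d0 (enum_val i)) (fun i => (pP (enum_val i)).1).
exists (\sum_m y m *: b m); split.
- by apply: rpred_sum => i _; rewrite rpredZ// vbasis_mem// mem_nth// size_tuple.
- apply/eqP => v0; have /freeP/(_ y v0 m)/eqP := basis_free (vbasisP U).
  exact/negP.
- by move=> j; rewrite -(pP j).2 -[j]enum_rankK y0.
Qed.

End Zeros.

(** * Ranks of polynomial matrices *)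

Section PolyMatrix.
Variable K : fieldType.

Definition mx_eval (m w : nat) (l : K) (P : 'M[{poly K}]_(m, w)) : 'M[K]_(m, w) :=
  map_mx (horner_eval l) P.

Lemma mx_eval_lift m w l (A : 'M[K]_(m, w)) : mx_eval l (map_mx polyC A) = A.
Proof. by apply/matrixP => i j; rewrite !mxE /horner_eval hornerC. Qed.

(** [L] and [S] reduce the matrix at 0 to the identity of size [r], so [q] is a polynomial with
    value 1 at 0; wherever it is nonzero, an invertible matrix of size [r] factors through
    [mx_eval l P]. *)
Lemma rank_generic m w (P : 'M[{poly K}]_(m, w)) : exists2 q : {poly K},
  q != 0 & forall l, q.[l] != 0 -> (\rank (mx_eval 0 P) <= \rank (mx_eval l P))%N.
Proof.
set P0 := mx_eval 0 P; set r := \rank P0.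
pose L : 'M_(r, m) := pid_mx r *m invmx (col_ebase P0).
pose S : 'M_(w, r) := invmx (row_ebase P0) *m pid_mx r.
pose q := \det (map_mx polyC L *m P *m map_mx polyC S).
have qE l : q.[l] = \det (L *m mx_eval l P *m S).
  rewrite -/(horner_eval l q) -det_map_mx !map_mxM/=.
  by rewrite -!/(mx_eval _ _) !mx_eval_lift.
have q0 : q.[0] != 0.
  rewrite qE -/P0 -(mulmx_ebase P0) -/r /L /S !mulmxA.
  rewrite mulmxKV ?col_ebase_unit// mulmxK ?row_ebase_unit//.
  rewrite !pid_mx_id ?rank_leq_row ?rank_leq_col//.
  by rewrite pid_mx_1 det1 oner_eq0.
exists q; first by apply: contraNneq q0 => ->; rewrite horner0.
move=> l ql; have : \rank (L *m mx_eval l P *m S) = r.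
  by apply: mxrank_unit; rewrite unitmxE -qE unitfE.
by move=> <-; rewrite -mulmxA (leq_trans (mxrankM_maxr _ _))// mxrankM_maxl.
Qed.

(** The form in which infiniteness of [K] enters; [nonvanishing_or_finite] gives the matching case
    split. *)
Definition poly_nonvanishing := forall p : {poly K}, p != 0 -> exists x, p.[x] != 0.

Hypothesis Kinf : poly_nonvanishing.

Lemma rank_lower_semicontinuous m w (P : 'M[{poly K}]_(m, w)) r :
  (forall l : K, l != 0 -> (\rank (mx_eval l P) <= r)%N) -> (\rank (mx_eval 0 P) <= r)%N.
Proof.
move=> Pr; have [q q0 qP] := rank_generic P.
have [l] : exists l, (q * 'X).[l] != 0 by apply: Kinf; rewrite mulf_neq0// polyX_eq0.
rewrite hornerM hornerX mulf_eq0 negb_or => /andP[ql l0].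
exact: leq_trans (qP _ ql) (Pr _ l0).
Qed.

(** For [l != 0] dividing by [l ^+ j] puts [Q] at [l] into the row space of [P] at [l]. Stacking [Q]
    under [P] thus does not raise the rank off 0, nor at 0 by semicontinuity, where [P] already
    attains the maximum. *)
Lemma leading_term_submx m w (P : 'M[{poly K}]_(m, w)) (Q : 'rV[{poly K}]_w)
    (c : 'rV[K]_m) j :
  (forall l, (\rank (mx_eval l P) <= \rank (mx_eval 0 P))%N) ->
  map_mx polyC c *m P = 'X^j *: Q -> (mx_eval 0 Q <= mx_eval 0 P)%MS.
Proof.
move=> Pr cPQ.
have ev l : mx_eval l (col_mx P Q) = col_mx (mx_eval l P) (mx_eval l Q).
  exact: map_col_mx.
have : (\rank (mx_eval 0 (col_mx P Q)) <= \rank (mx_eval 0 P))%N.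
  apply: rank_lower_semicontinuous => l l0; rewrite ev.
  have Ql : (mx_eval l Q <= mx_eval l P)%MS.
    have := congr1 (mx_eval l) cPQ.
    rewrite /mx_eval map_mxM map_mxZ -!/(mx_eval _ _) mx_eval_lift => cPl.
    have -> : mx_eval l Q = (l ^+ j)^-1 *: (c *m mx_eval l P).
      by rewrite cPl /= /horner_eval hornerXn scalerA mulVf ?scale1r// expf_neq0.
    by rewrite scalemx_sub// submxMl.
  by rewrite -addsmxE (addsmx_idPl Ql).
rewrite ev => rle.
have sP : (mx_eval 0 P <= col_mx (mx_eval 0 P) (mx_eval 0 Q))%MS.
  by rewrite -addsmxE addsmxSl.
have : (col_mx (mx_eval 0 P) (mx_eval 0 Q) <= mx_eval 0 P)%MS.
  by rewrite -(mxrank_leqif_sup sP) eqn_leq mxrankS.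
by rewrite col_mx_sub => /andP[].
Qed.

(** For a vector known to lie in the row space, vanishing costs only [r] linear equations instead of
    [w]. *)
Lemma row_space_coords m w (A : 'M[K]_(m, w)) r : \rank A = r ->
  exists B : 'M[K]_(w, r), forall x : 'rV_w, (x <= A)%MS -> x *m B = 0 -> x = 0.
Proof.
move=> <-; exists (pinvmx (row_base A)) => x.
rewrite -(eq_row_base A) => xA xB.
by rewrite -(mulmxKpV xA) xB mul0mx.
Qed.

Lemma common_kernel (V : vectType K) (U : {vspace V}) (J : finType) (f : J -> V -> K) :
  (forall j, scalar (f j)) -> (#|J| < \dim U)%N ->
  exists v, [/\ v \in U, v != 0 & forall j, f j v = 0].
Proof.
move=> lf JU.
have [|c [[a ca] c0]] := @dependent_rows K 'I_(\dim U) J (fun a j => f j (vbasis U)`_a).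
  by rewrite card_ord.
exists (\sum_a c a *: (vbasis U)`_a); split.
- by apply: rpred_sum => i _; rewrite rpredZ// vbasis_mem// mem_nth// size_tuple.
- apply/eqP => v0; have /freeP/(_ c v0 a)/eqP := basis_free (vbasisP U).
  exact/negP.
move=> j; have fD u v : f j (u + v) = f j u + f j v.
  by have := lf j 1 u v; rewrite scale1r mul1r.
have f0 : f j 0 = 0 by have := lf j 1 0 0; rewrite scaler0 addr0 mul1r => /eqP;
   rewrite -subr_eq0 opprD addNKr oppr_eq0 => /eqP.
rewrite -{}[RHS](c0 j); elim/big_ind2: _ => // [u x v y <- <-|i _].
  by rewrite fD.
by have := lf j (c i) (vbasis U)`_i 0; rewrite f0 !addr0.
Qed.

(** One scalar must serve all [k] at once, hence the product of the [q k]; the factor ['X] excludes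
    the scalar 0. *)
Lemma generic_scaling (I : finType) m w (P : I -> 'M[{poly K}]_(m, w)) :
  exists2 l, l != 0 & forall k, (\rank (mx_eval 0 (P k)) <= \rank (mx_eval l (P k)))%N.
Proof.
have /choice[q qP] : forall k, exists q : {poly K}, q != 0 /\
    forall l, q.[l] != 0 -> (\rank (mx_eval 0 (P k)) <= \rank (mx_eval l (P k)))%N.
  by move=> k; have [q] := rank_generic (P k); exists q.
have [l] : exists l, ('X * \prod_k q k).[l] != 0.
  apply: Kinf; rewrite mulf_neq0 ?polyX_eq0//.
  by apply/prodf_neq0 => k _; case: (qP k).
rewrite hornerM hornerX horner_prod mulf_eq0 negb_or => /andP[l0 /prodf_neq0 ql].
by exists l => // k; apply: (qP k).2; exact: ql.
Qed.

(* A first-order deformation [A k + l D k v] of constant maximal rank moves the kernel vector [c] inside the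
   row space of [A k], so preserving [c] costs only [r] linear conditions on [v]. *)
Lemma linear_step (V : vectType K) (U : {vspace V}) (I : finType) m w r
    (c : 'rV[K]_m) (A : I -> 'M[K]_(m, w)) (D : I -> V -> 'M[K]_(m, w)) :
  (forall k, linear (D k)) -> (forall k, \rank (A k) = r) ->
  (forall k v, (\rank (A k + D k v)%R <= r)%N) -> (forall k, c *m A k = 0) ->
  (#|I| * r < \dim U)%N ->
  exists v, [/\ v \in U, v != 0 &
    forall k, \rank (A k + D k v)%R = r /\ c *m (A k + D k v) = 0].
Proof.
move=> lD rA rAD cA IU.
pose P k v := map_mx polyC (A k) + 'X *: map_mx polyC (D k v).
have lD0 k : D k 0 = 0.
  have /eqP := lD k 1 0 0; rewrite !scale1r addr0.
  by rewrite -subr_eq0 opprD addNKr oppr_eq0 => /eqP.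
have lDZ k a v : D k (a *: v) = a *: D k v.
  by have := lD k a v 0; rewrite lD0 !addr0.
have PE k v l : mx_eval l (P k v) = A k + D k (l *: v).
  rewrite lDZ /mx_eval map_mxD map_mxZ -!/(mx_eval _ _) !mx_eval_lift.
  by rewrite /= /horner_eval hornerX.
have P0 k v : mx_eval 0 (P k v) = A k by rewrite PE scale0r lD0 addr0.
have cD k v : (c *m D k v <= A k)%MS.
  rewrite -(mx_eval_lift 0 (c *m D k v)) -(P0 k v).
  apply: (@leading_term_submx _ _ _ _ c 1).
    by move=> l; rewrite P0 PE rA; exact: rAD.
  by rewrite mulmxDr -!map_mxM cA map_mx0 add0r -scalemxAr -map_mxM expr1.
have /choice[B BP] : forall k, exists B : 'M[K]_(w, r),
    forall x : 'rV_w, (x <= A k)%MS -> x *m B = 0 -> x = 0.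
  by move=> k; exact: row_space_coords.
have [||v [vU v0 fv]] := @common_kernel _ U (I * 'I_r)%type
    (fun ki v => (c *m D ki.1 v *m B ki.1) 0 ki.2).
- by move=> [k i] a u v /=; rewrite lD mulmxDr mulmxDl -scalemxAr -scalemxAl !mxE.
- by rewrite card_prod card_ord.
have cDv k : c *m D k v = 0.
  by apply: (BP k) => //; apply/rowP => i; rewrite (fv (k, i)) mxE.
(* [v] itself may lower a rank; a generic multiple does not, and still satisfies the linear
   equations. *)
have [l l0 rl] := generic_scaling (fun k => P k v).
exists (l *: v); split; rewrite ?rpredZ// ?scaler_eq0 ?negb_or ?l0// => k.
split; last by rewrite mulmxDr cA add0r lDZ -scalemxAr cDv scaler0.
apply/eqP; rewrite eqn_leq rAD/=.
by have := rl k; rewrite P0 PE rA.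
Qed.

End PolyMatrix.

From mathcomp Require Import all_classical.

(** * Multilinear maps evaluated on slots *)

Section Update.
Variables (S : eqType) (T : Type).
Implicit Types (x : S -> T) (s : S) (v : T).

Definition upd x s v : S -> T := fun t => if t == s then v else x t.

Lemma upd_same x s v : upd x s v s = v.
Proof. by rewrite /upd eqxx. Qed.

Lemma upd_id x s : upd x s (x s) = x.
Proof. by apply: funext => t; rewrite /upd; case: eqP => // ->. Qed.

End Update.

Section MultilinearPower.
Variables (K : fieldType) (d : nat) (V W : vectType K) (F : ('I_d -> V) -> W).
Hypothesis mF : multilinear (V := fun=> V) F.

Lemma multilinear_upd x i a u v :
  F (upd x i (a *: u + v)) = a *: F (upd x i u) + F (upd x i v).
Proof.
have e y : upd x i y = dfwith (T := fun=> V) x i y.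
  apply: funext => j; rewrite /upd; have [->|ji] := eqVneq j i.
    by rewrite dfwithin.
  by rewrite dfwithout// eq_sym.
by rewrite !e; exact: mF.
Qed.

End MultilinearPower.

Section Slots.
Variables (K : fieldType) (d : nat) (V W : vectType K) (F : ('I_d -> V) -> W).
Hypothesis mF : multilinear (V := fun=> V) F.
Variables (S I : finType) (r : I -> 'I_d -> S).
Hypothesis r_inj : forall k, injective (r k).
Hypothesis r_sub : forall k l, (forall i, r k i \in codom (r l)) -> k = l.
Implicit Types (x : S -> V) (s : S) (k : I).

(** Slots are places for vectors. By [r_inj] a row is linear in each slot that it uses; by [r_sub]
    the slots of a row determine it, even as a subset of the slots of another row. *)
Definition slot_row k x : W := F (x \o r k).

Lemma slot_row_notin k x s v : s \notin codom (r k) -> slot_row k (upd x s v) = slot_row k x.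
Proof.
move=> sr; congr F; apply: funext => i; rewrite /upd /=; case: eqP => // e.
by rewrite -e codom_f in sr.
Qed.

Lemma slot_row_linear k x s a u v : s \in codom (r k) ->
  slot_row k (upd x s (a *: u + v)) = a *: slot_row k (upd x s u) + slot_row k (upd x s v).
Proof.
move=> /codomP[j ->].
have e y : upd x (r k j) y \o r k = upd (x \o r k) j y.
  by apply: funext => i; rewrite /upd /= (inj_eq (r_inj (k := k))).
by rewrite /slot_row !e multilinear_upd.
Qed.

Variables (c : I -> K) (k0 : I).
Local Notation a := (r k0).

(* The part of [\sum_k c k *: slot_row k x] whose rows involve the first [l] slots of row [k0]; taking the
   difference in slot [l] passes from [truncated l] to [truncated l.+1]. *)
Definition truncated (l : nat) x : W :=
  \sum_(k | [forall i : 'I_d, (i < l)%N ==> (a i \in codom (r k))]) c k *: slot_row k x.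

Lemma truncated0 x : truncated 0 x = \sum_k c k *: slot_row k x.
Proof. by apply: eq_bigl => k; apply/forallP. Qed.

Lemma truncatedd x : truncated d x = c k0 *: F (x \o a).
Proof.
rewrite /truncated (bigD1 k0)/=; last first.
  by apply/forallP => i; rewrite codom_f implybT.
rewrite big1 ?addr0// => k /andP[/forallP ak /eqP nk]; case: nk; apply/esym/r_sub => i.
by have := ak i; rewrite ltn_ord.
Qed.

Lemma truncated_diff (l : 'I_d) x u v :
  truncated l (upd x (a l) (u + v)) =
  truncated l (upd x (a l) u) + truncated l.+1 (upd x (a l) v).
Proof.
have tS y : truncated l.+1 y = \sum_(k | [forall i : 'I_d, (i < l)%N ==> (a i \in codom (r k))])
    (if a l \in codom (r k) then c k *: slot_row k y else 0).
  rewrite /truncated [RHS]big_mkcond [LHS]big_mkcond/=; apply: eq_bigr => k _.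
  have -> : [forall i : 'I_d, (i < l.+1)%N ==> (a i \in codom (r k))] =
      [forall i : 'I_d, (i < l)%N ==> (a i \in codom (r k))] && (a l \in codom (r k)).
    apply/forallP/andP => [H|[/forallP H al] i].
      split; last by have := H l; rewrite ltnSn implyTb.
      by apply/forallP => i; apply/implyP => il; have := H i; rewrite ltnS ltnW.
    rewrite ltnS leq_eqVlt; apply/implyP => /orP[/eqP/val_inj->//|il].
    by have := H i; rewrite il implyTb.
  by case: [forall i : 'I_d, (i < l)%N ==> (a i \in codom (r k))].
rewrite tS -big_split; apply: eq_bigr => k _ /=; case: ifP => [ak|/negbT ak].
  by rewrite -[u in LHS]scale1r slot_row_linear// scale1r scalerDr.
by rewrite !slot_row_notin// addr0.
Qed.

End Slots.

Section SlotMatrix.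
Variables (K : fieldType) (d w : nat) (V : vectType K) (F : ('I_d -> V) -> 'rV[K]_w).
Hypothesis mF : multilinear (V := fun=> V) F.
Variables (S I : finType) (r : I -> 'I_d -> S).
Hypothesis r_inj : forall k, injective (r k).
Implicit Types (x : S -> V) (s : S).

Definition slot_mx x : 'M[K]_(#|I|, w) := \matrix_i slot_row F r (enum_val i) x.

Definition slot_diff x s v : 'M[K]_(#|I|, w) := \matrix_i
  (if s \in codom (r (enum_val i)) then slot_row F r (enum_val i) (upd x s v) else 0).

Lemma slot_diff_linear x s : linear (slot_diff x s).
Proof.
move=> a u v; apply/row_matrixP => i; rewrite linearP/= !rowK.
by case: ifP => si; [rewrite slot_row_linear|rewrite scaler0 addr0].
Qed.

Lemma slot_mx_upd x s v : slot_mx (upd x s (x s + v)) = slot_mx x + slot_diff x s v.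
Proof.
apply/row_matrixP => i; rewrite linearD/= !rowK; case: ifP => [si|/negbT si].
  by rewrite -[x s]scale1r slot_row_linear// scale1r upd_id.
by rewrite slot_row_notin// addr0.
Qed.

Lemma mul_slot_mx (c : I -> K) x :
  (\row_i c (enum_val i)) *m slot_mx x = \sum_k c k *: slot_row F r k x.
Proof.
rewrite mulmx_sum_row [RHS](reindex_onto enum_val enum_rank) => [|k _]; last first.
  by rewrite enum_rankK.
by apply: eq_big => [i|i _]; rewrite ?enum_valK ?eqxx// rowK mxE.
Qed.

End SlotMatrix.

Lemma max_rank (K : fieldType) (T : Type) m w (M : T -> 'M[K]_(m, w)) (t0 : T) :
  exists t, forall t', (\rank (M t') <= \rank (M t))%N.
Proof.
pose P n := `[< exists t, \rank (M t) = n >].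
have exP : exists n, P n by exists (\rank (M t0)); apply/asboolP; exists t0.
have ubP n : P n -> (n <= m)%N by move=> /asboolP[t <-]; exact: rank_leq_row.
case: (ex_maxnP exP ubP) => n /asboolP[t <-] nmax.
by exists t => t'; apply: nmax; apply/asboolP; exists t'.
Qed.

Lemma card_ffun_fixed (d k : nat) (j : 'I_d) :
  #|[pred e : {ffun 'I_d -> 'I_k.+1} | e j == ord0]| = (k.+1 ^ d.-1)%N.
Proof.
pose f i : pred 'I_k.+1 := if i == j then pred1 ord0 else predT.
rewrite (eq_card (B := family f)) => [|e].
  rewrite card_family foldrE /image_mem big_map big_enum/= (bigD1 j)//= /f eqxx card1 mul1n.
  rewrite (eq_bigr (fun=> k.+1)) => [|i /negbTE->]; last by rewrite card_ord.
  by rewrite prod_nat_const cardC1 card_ord.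
apply/eqP/familyP => [ej i|/(_ j)]; last by rewrite /f eqxx => /eqP.
by rewrite /f; case: eqP => // ->; rewrite inE ej.
Qed.

(** Origin of the factor [d * s ^ d.-1]: a greedy step imposes conditions at the points whose
    coordinate [j] is still empty, the other [d - 1] coordinates having at most [s] values each. *)
Lemma card_vanishing_slot (d k s : nat) : (k < s)%N ->
  (#|[pred je : 'I_d * {ffun 'I_d -> 'I_k.+1} | je.2 je.1 == ord0]| <= d * s ^ d.-1)%N.
Proof.
move=> ks; apply: leq_trans (_ : d * k.+1 ^ d.-1 <= _)%N; last first.
  rewrite leq_mul2l; apply/orP; right.
  by case: d.-1 => [|n]; rewrite ?expn0// leq_exp2r.
rewrite -sum1_card -(pair_big_dep xpredT
  (fun j (e : {ffun 'I_d -> 'I_k.+1}) => e j == ord0) (fun _ _ => 1%N))/=.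
rewrite (eq_bigr (fun=> (k.+1 ^ d.-1)%N)) => [|j _].
  by rewrite sum_nat_const card_ord.
by rewrite sum1_card; exact: card_ffun_fixed.
Qed.

Lemma free_upd (K : fieldType) (V : vectType K) (u : nat -> V) k v :
  let X := [seq u i.+1 | i <- iota 0 k] in
  free X -> v \in (<<X>>^C)%VS -> v != 0 ->
  free [seq upd u k.+1 v i.+1 | i <- iota 0 k.+1].
Proof.
move=> X fX vX v0; rewrite -[in iota 0 k.+1]addn1 iotaD map_cat/= add0n upd_same.
rewrite (_ : map _ _ = X); last first.
  apply/eq_in_map => i; rewrite mem_iota add0n => /andP[_ ik].
  by rewrite /upd eqSS ltn_eqF.
rewrite (perm_free (permEl (perm_catC _ _))) free_cons fX andbT.
apply: contra v0 => vX'; have : v \in (<<X>> :&: <<X>>^C)%VS by rewrite memv_cap vX' vX.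
by rewrite capv_compl memv0.
Qed.

(** * Greedy construction over an infinite field *)

Section InfiniteField.
Variables (K : fieldType) (d w : nat) (V : vectType K) (F : ('I_d -> V) -> 'rV[K]_w).
Hypothesis Kinf : poly_nonvanishing K.
Hypothesis mF : multilinear (V := fun=> V) F.
Variables (S I : finType) (r : I -> 'I_d -> S).
Hypothesis r_inj : forall k, injective (r k).
Hypothesis r_sub : forall k l, (forall i, r k i \in codom (r l)) -> k = l.

Section Place.
Variable a : 'I_d -> S.
Hypothesis a_inj : injective a.

Definition place (q : S -> V) (y : 'I_d -> V) : S -> V :=
  fun s => q s + \sum_(i | a i == s) y i.

Lemma place_at q y j : place q y (a j) = q (a j) + y j.
Proof.
congr (_ + _); rewrite (bigD1 j)//= big1 ?addr0// => i /andP[/eqP/a_inj->].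
by rewrite eqxx.
Qed.

Lemma place_upd q y j v : place q (upd y j v) = upd (place q y) (a j) (q (a j) + v).
Proof.
apply: funext => s; rewrite /upd; case: eqP => [->|/eqP sj].
  by rewrite place_at /upd eqxx.
congr (_ + _); apply: eq_bigr => i /eqP ai; case: eqP => // ij.
by rewrite -ai ij eqxx in sj.
Qed.

Lemma place_upd_base q y j v : place (upd q (a j) v) y = upd (place q y) (a j) (v + y j).
Proof.
apply: funext => s; rewrite [in RHS]/upd; case: eqP => [->|/eqP sj].
  by rewrite place_at upd_same.
by rewrite /place /upd (negbTE sj).
Qed.

Lemma place0 q : place q (fun=> 0) = q.
Proof. by apply: funext => s; rewrite /place big1 ?addr0. Qed.

End Place.

(** A difference in a slot of row [k0] cancels the rows avoiding that slot and also the base vector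
    of [p] there; after all [d] slots only [c k0 *: F y] is left. *)
Lemma cube_vanishing (c : I -> K) (k0 : I) (p : S -> V) (y : 'I_d -> V) :
  c k0 != 0 ->
  (forall z : 'I_d -> V, (forall i, z i = y i \/ z i = 0) ->
     \sum_k c k *: slot_row F r k (place (r k0) p z) = 0) ->
  F y = 0.
Proof.
move=> ck0 cube; have aI := @r_inj k0.
(* [q l] is the base after [l] differences: [p] with the first [l] slots of row [k0] emptied. *)
pose q l s := if [exists i : 'I_d, (i < l)%N && (r k0 i == s)] then 0 else p s.
have H l : (l <= d)%N -> forall z : 'I_d -> V,
    (forall i : 'I_d, z i = y i \/ ((l <= i)%N /\ z i = 0)) ->
    truncated F r c k0 l (place (r k0) (q l) z) = 0.
  elim: l => [_ z zE|l IH ld z zE].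
    rewrite truncated0 (_ : q 0%N = p); last first.
      by apply: funext => s; rewrite /q; case: existsP => // -[].
    by apply: cube => i; case: (zE i) => [|[]]; [left|right].
  pose i0 := Ordinal ld; have yi0 : z i0 = y i0 by case: (zE i0) => // -[]; rewrite ltnn.
  have qS : q l.+1 = upd (q l) (r k0 i0) 0.
    apply: funext => s; rewrite /upd /q; case: eqP => [->|/eqP sj].
      by case: existsP => // -[]; exists i0; rewrite ltnSn eqxx.
    congr (if _ then _ else _); apply/existsP/existsP => -[i /andP[il /eqP ai]]; exists i.
      rewrite ai eqxx andbT; move: il; rewrite ltnS leq_eqVlt => /orP[/eqP e|//].
      by move: sj; rewrite -ai (_ : i = i0) ?eqxx//; exact: val_inj.
    by rewrite ai eqxx andbT ltnW.
  have qi0 : q l (r k0 i0) = p (r k0 i0).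
    rewrite /q; case: existsP => // -[i /andP[il /eqP/aI ei]].
    by rewrite ei ltnn in il.
  have := truncated_diff mF r_inj c k0 i0 (place (r k0) (q l) z) (p (r k0 i0)) (z i0).
  rewrite -qi0 -(place_upd aI) -[X in truncated _ _ _ _ _ (upd _ _ X)]addr0 -(place_upd aI).
  rewrite -{2}[z i0]add0r -(place_upd_base aI) -qS !IH ?(ltnW ld)//.
  - by rewrite add0r => <-.
  - move=> i; rewrite /upd; case: eqP => [->|_]; first by right.
    by case: (zE i) => [|[li]]; [left|right; rewrite ltnW].
  - move=> i; rewrite /upd; case: eqP => [->|_]; first by left.
    by case: (zE i) => [|[li]]; [left|right; rewrite ltnW].
have := H d (leqnn d) y (fun i => or_introl (erefl _)).
rewrite (truncatedd F r_sub) => /eqP; rewrite scaler_eq0 (negbTE ck0)/= => /eqP <-.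
congr F; apply: funext => i; rewrite /= (place_at aI) /q.
by case: existsP => [_|[]]; rewrite ?add0r//; exists i; rewrite ltn_ord eqxx.
Qed.

Hypothesis dependent : forall x : S -> V, exists c : I -> K,
  (exists k, c k != 0) /\ \sum_k c k *: slot_row F r k x = 0.

Theorem infinite_isotropic (s : nat) :
  (d * s ^ d.-1 * #|I| + s <= \dim {:V})%N ->
  exists u : s.-tuple V, free u /\
    forall e : 'I_d -> 'I_s, injective e -> F (fun i => u`_(e i)) = 0.
Proof.
move=> dimV.
have [p pmax] := max_rank (slot_mx F r) (fun=> 0).
have [c [[k0 ck0] cp]] := dependent p.
pose cv : 'rV[K]_#|I| := \row_i c (enum_val i).
set a := r k0; have aI : injective a := @r_inj k0.
pose good x := \rank (slot_mx F r x) = \rank (slot_mx F r p) /\ cv *m slot_mx F r x = 0.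
(* Index 0 stands for the zero vector [u 0]. Nonzero indices are distinct so that a new vector
   enters one slot only and the deformation is linear in it; this is why the conclusion is limited
   to injective [e]. *)
pose adm k (e : 'I_d -> nat) := (forall i, e i <= k)%N /\
  forall i j, i != j -> e i != 0%N -> e i != e j.
have step k : (k <= s)%N -> exists u : nat -> V, [/\ u 0%N = 0,
    free [seq u i.+1 | i <- iota 0 k] &
    forall e, adm k e -> good (place a p (u \o e))].
  elim: k => [_|k IH ks].
    exists (fun=> 0); split => //; first by rewrite /free span_nil dimv0.
    move=> e _; rewrite (_ : _ \o _ = (fun=> 0))// place0; split=> //.
    by rewrite mul_slot_mx.
  have [u [u0 fu gu]] := IH (ltnW ks).
  (* The old points from which new ones arise by adding the new vector in the empty coordinate
     [j]. *)
  pose dom (je : 'I_d * {ffun 'I_d -> 'I_k.+1}) := (je.2 je.1 == ord0) &&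
    [forall i, forall j, (i != j) ==> (je.2 i != ord0) ==> (je.2 i != je.2 j)].
  pose X (je : {je | dom je}) : S -> V := place a p (u \o (fun i => (val je).2 i : nat)).
  have gX je : good (X je).
    apply: gu; split=> [i|i j ij ei]; first by rewrite -ltnS.
    case: je ei => -[j' e] /= /andP[_ /forallP/(_ i)/forallP/(_ j)]; rewrite ij/=.
    by move=> /implyP H /H.
  have cdom : (#|{: {je | dom je}}| <= d * s ^ d.-1)%N.
    rewrite card_sig; apply: leq_trans (card_vanishing_slot d ks).
    by apply: subset_leq_card; apply/fintype.subsetP => je; rewrite !inE => /andP[].
  pose U := <<[seq u i.+1 | i <- iota 0 k]>>%VS.
  have dU : \dim U = k by rewrite (eqP fu) size_map size_iota.
  have [|||||v [vU v0 gv]] := @linear_step K Kinf V (U^C)%VS {je | dom je} _ w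
      (\rank (slot_mx F r p)) cv (fun je => slot_mx F r (X je))
      (fun je => slot_diff F r (X je) (a (val je).1)).
  - by move=> je; exact: slot_diff_linear.
  - by move=> je; case: (gX je).
  - by move=> je v; rewrite -slot_mx_upd.
  - by move=> je; case: (gX je).
  - rewrite dimv_compl dU ltn_subRL addnC.
    apply: leq_trans dimV; rewrite -addnS; apply: leq_add => //.
    by apply: leq_mul => //; exact: rank_leq_row.
  exists (upd u k.+1 v); split; first by rewrite /upd.
    exact: free_upd.
  move=> e [ek einj].
  have [/existsP[j /eqP ej]|nk] := boolP [exists j, e j == k.+1]; last first.
    have ne i : e i != k.+1 by move: nk; rewrite negb_exists => /forallP.
    rewrite (_ : _ \o _ = u \o e); last first.
      by apply: funext => i /=; rewrite /upd (negbTE (ne i)).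
    by apply: gu; split => // i; have := ek i; rewrite leq_eqVlt (negbTE (ne i)).
  have neq i : i != j -> e i != k.+1.
    by move=> ij; rewrite -ej eq_sym einj// 1?eq_sym// ej.
  pose e0 : {ffun 'I_d -> 'I_k.+1} := [ffun i => if i == j then ord0 else inord (e i)].
  have e0E i : i != j -> e0 i = e i :> nat.
    by move=> ij; rewrite ffunE (negbTE ij) inordK// ltn_neqAle neq// ek.
  have e0j : e0 j = ord0 by rewrite ffunE eqxx.
  have dom0 : dom (j, e0).
    rewrite /dom/= e0j eqxx; apply/forallP => i; apply/forallP => i'.
    apply/implyP => ii'; apply/implyP => ei.
    have ij : i != j by apply: contraNneq ei => ->; rewrite e0j.
    have [->|i'j] := eqVneq i' j; first by rewrite e0j.
    rewrite -val_eqE/= !e0E//; apply: einj => //.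
    by rewrite -e0E.
  have [] := gv (exist _ (j, e0) dom0); rewrite -slot_mx_upd//= => g1 g2.
  suff -> : place a p (upd u k.+1 v \o e) =
      upd (X (exist _ (j, e0) dom0)) (a j) (X (exist _ (j, e0) dom0) (a j) + v) by [].
  rewrite /X/= place_at//= e0j u0 addr0 -(place_upd aI); congr place.
  apply: funext => i; rewrite /upd/=; have [->|ij] := eqVneq i j.
    by rewrite ej eqxx.
  by rewrite e0E// (negbTE (neq _ ij)).
have [u [u0 fu gu]] := step s (leqnn s).
have su : size [seq u i.+1 | i <- iota 0 s] == s by rewrite size_map size_iota.
exists (Tuple su); split => //= e einj.
have uE (i : 'I_s) : [seq u i.+1 | i <- iota 0 s]`_i = u i.+1.
  by rewrite (nth_map 0%N) ?size_iota// nth_iota.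
rewrite (_ : (fun i => _) = fun i => u (e i).+1); last by apply: funext => i; rewrite uE.
apply: (cube_vanishing (p := p) ck0) => z zE.
(* Every vertex of the cube is an admissible point, its nonzero indices being distinct because [e]
   is injective. *)
pose e' i := if z i == 0 then 0%N else (e i).+1.
have -> : z = u \o e'.
  apply: funext => i; rewrite /e' /=; case: eqP => [->//|z0].
  by case: (zE i).
have [|_] := gu e'; last by rewrite mul_slot_mx.
split=> [i|i j ij]; rewrite /e'; first by case: eqP.
case: (z i == 0) => // _; case: (z j == 0) => //; rewrite eqSS.
by apply: contra ij => /eqP/val_inj/einj->.
Qed.

End InfiniteField.

(** * Finite fields: counting *)

Section Counting.
Variables (S V : finType).
Local Notation T := {ffun S -> V}.
Implicit Types (x : T) (P Q : pred T).

Definition fupd x s v : T := [ffun t => if t == s then v else x t].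

(** Exchanging the coordinate [s] of [x] with an extra vector [v] is an involution on pairs, which
    matches the two counts. *)
Lemma card_fibers P s : (#|V| * #|P| = \sum_x #|[pred v | P (fupd x s v)]|)%N.
Proof.
rewrite -(sum1_card P) big_distrr/= [RHS](eq_bigr (fun x => \sum_(v | P (fupd x s v)) 1)%N); last first.
  by move=> x _; rewrite sum1_card.
rewrite (eq_bigr (fun=> \sum_(v : V) 1)%N) => [|x _]; last by rewrite muln1 sum1_card.
rewrite pair_big pair_big_dep/=.
pose h (xv : T * V) := (fupd xv.1 s xv.2, xv.1 s).
have hK : involutive h.
  move=> [x v]; rewrite /h/= !ffunE eqxx; congr pair.
  by apply/ffunP => t; rewrite !ffunE; case: eqP => // ->.
by rewrite (reindex_inj (inv_inj hK))/=; apply: eq_bigl => -[x v]; rewrite /= andbT.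
Qed.

Lemma leq_card_fibers P Q s :
  (forall x, #|[pred v | P (fupd x s v)]| <= #|[pred v | Q (fupd x s v)]|)%N ->
  (#|P| <= #|Q|)%N.
Proof.
move=> PQ; have [V0|V0] := posnP #|V|.
  rewrite (@eq_card0 _ P)// => x; apply/negP => _.
  by have := card0_eq V0 (x s); rewrite !inE.
by rewrite -(leq_pmul2l V0) !(card_fibers _ s); apply: leq_sum => x _; exact: PQ.
Qed.

End Counting.

(** The restriction of a uniform [x] along an injection is uniform: exchanging these coordinates
    with an independent [y] is an involution. *)
Lemma card_comp_inj (S S' V : finType) (a : S' -> S) (G : pred {ffun S' -> V}) :
  injective a ->
  (#|[pred x : {ffun S -> V} | G [ffun i => x (a i)]]| * #|V| ^ #|S'| =
   #|V| ^ #|S| * #|G|)%N.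
Proof.
move=> aI; rewrite -!card_ffun -!cardX.
pose put (x : {ffun S -> V}) (y : {ffun S' -> V}) : {ffun S -> V} :=
  [ffun s => if [pick i | a i == s] is Some i then y i else x s].
have puta x y i : put x y (a i) = y i.
  by rewrite ffunE; case: pickP => [j /eqP/aI->|/(_ i)]; rewrite ?eqxx.
pose h (xy : {ffun S -> V} * {ffun S' -> V}) := (put xy.1 xy.2, [ffun i => xy.1 (a i)]).
have hK : involutive h.
  move=> [x y]; rewrite /h/=; congr pair; apply/ffunP => s; last by rewrite ffunE puta.
  rewrite ffunE; case: pickP => [i /eqP <-|ns]; first by rewrite ffunE.
  by rewrite ffunE; case: pickP => // i; rewrite ns.
rewrite -!sum1_card (reindex_inj (inv_inj hK)); apply: eq_bigl => -[x y] /=.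
rewrite !inE/= andbT; congr G; apply/ffunP => i.
by rewrite ffunE puta.
Qed.

Section Correlation.
Variables (S : finType) (V : finZmodType).
Local Notation T := {ffun S -> V}.
Implicit Types (x : T) (P Q : pred T).

(** Sort the pairs by the difference [a - b]: a nonempty class, translated by one of its members,
    embeds into the intersection of [A] and [B]. *)
Lemma card_sub_closed (A B : pred V) :
  (forall u v, A u -> A v -> A (u - v)) -> (forall u v, B u -> B v -> B (u - v)) ->
  (#|A| * #|B| <= #|V| * #|[predI A & B]|)%N.
Proof.
move=> Asub Bsub; rewrite -cardX -sum1_card.
rewrite (partition_big (fun ab : V * V => ab.1 - ab.2) xpredT)//=.
rewrite -[#|V|]/(#|[pred v : V | true]|) -sum_nat_const; apply: leq_sum => v _.
rewrite sum1_card.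
have [/existsP[[a0 b0] /= /andP[/andP[/= Aa Bb] /eqP e0]]|] :=
    boolP [exists ab : V * V, (ab \in [predX A & B]) && (ab.1 - ab.2 == v)]; last first.
  rewrite negb_exists => /forallP H; rewrite (@eq_card0 _ _)// => ab.
  by apply/negP => abP; exact: (negP (H ab) abP).
rewrite -(card_in_imset (f := fun ab : V * V => ab.1 - a0)).
  apply: subset_leq_card; apply/fintype.subsetP => _ /imsetP[[a b] /= /andP[/andP[/= Aa' Bb'] /eqP e] ->].
  rewrite inE/=; apply/andP; split; first exact: Asub.
  have -> : a - a0 = b - b0; last exact: Bsub.
  have {1}-> : a = a0 - b0 + b by rewrite e0 -e subrK.
  by rewrite -addrA addrC subrKA.
move=> [a b] [a' b'] /= /andP[_ /eqP e] /andP[_ /eqP e'] /addIr aa'.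
congr pair => //; move: e; rewrite /= -e' aa' => /addrI/oppr_inj; exact.
Qed.

Definition slice_closed P :=
  forall x s u v, P (fupd x s u) -> P (fupd x s v) -> P (fupd x s (u - v)).

(* Merging the coordinates of a pair [(x, x')] one at a time only increases the probability that
   [P x] and [Q x'], since in each coordinate both conditions cut out subgroups. *)
Lemma card_slice_closed P Q : slice_closed P -> slice_closed Q ->
  (#|P| * #|Q| <= #|T| * #|[predI P & Q]|)%N.
Proof.
move=> cP cQ.
pose fst_ (y : {ffun S -> V * V}) : T := [ffun s => (y s).1].
pose mix (D : {set S}) (y : {ffun S -> V * V}) : T :=
  [ffun s => if s \in D then (y s).1 else (y s).2].
pose N D := #|[pred y | P (fst_ y) && Q (mix D y)]|.
pose pr (xx : T * T) : {ffun S -> V * V} := [ffun s => (xx.1 s, xx.2 s)].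
have prI : bijective pr.
  exists (fun y => (fst_ y, mix finset.set0 y)) => [[x x']|y].
    by congr pair; apply/ffunP => s; rewrite !ffunE ?inE.
  by apply/ffunP => s; rewrite !ffunE inE; case: (y s).
have N0 : N finset.set0 = (#|P| * #|Q|)%N.
  rewrite -cardX /N -!sum1_card (reindex pr)/=; last exact: onW_bij.
  apply: eq_bigl => -[x x']; rewrite !inE/=; congr (P _ && Q _); apply/ffunP => s.
    by rewrite !ffunE.
  by rewrite !ffunE inE.
have NT : N finset.setT = (#|T| * #|[predI P & Q]|)%N.
  rewrite mulnC -[#|T|]/(#|[pred x : T | true]|) -cardX /N -!sum1_card (reindex pr)/=; last exact: onW_bij.
  apply: eq_bigl => -[x x']; rewrite !inE/= andbT; congr (P _ && Q _); apply/ffunP => s.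
    by rewrite !ffunE.
  by rewrite !ffunE inE.
have Nle D s : (N D <= N (s |: D)%SET)%N.
  have [sD|sD] := boolP (s \in D); first by rewrite (finset.setUidPr _)// finset.sub1set.
  apply: (@leq_card_fibers _ _ _ _ s) => y.
  pose A v := P (fupd (fst_ y) s v); pose B v := Q (fupd (mix D y) s v).
  have fE v : fst_ (fupd y s v) = fupd (fst_ y) s v.1.
    by apply/ffunP => t; rewrite !ffunE; case: eqP.
  have mE v : mix D (fupd y s v) = fupd (mix D y) s v.2.
    by apply/ffunP => t; rewrite !ffunE; case: eqP => // ->; rewrite (negbTE sD).
  have mE' v : mix (s |: D)%SET (fupd y s v) = fupd (mix D y) s v.1.
    by apply/ffunP => t; rewrite !ffunE !inE; case: eqP => // ->.
  apply: leq_trans (_ : #|A| * #|B| <= _)%N.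
    rewrite -cardX; apply: subset_leq_card; apply/fintype.subsetP => -[v v'].
    by rewrite !inE/= fE mE.
  apply: leq_trans (card_sub_closed (cP _ _) (cQ _ _)) _.
  rewrite mulnC -[#|V|]/(#|[pred v : V | true]|) -cardX.
  apply: subset_leq_card; apply/fintype.subsetP => -[v v'].
  by rewrite !inE/= fE mE' andbT.
rewrite -N0 -NT; have : forall s : seq S, (N finset.set0 <= N [set x in s]%SET)%N.
  elim=> [|s l IH]; first by rewrite (_ : [set x in [::]]%SET = finset.set0)//; apply/finset.setP => x; rewrite !inE.
  apply: leq_trans IH _; rewrite (_ : [set x in s :: l]%SET = s |: [set x in l])%SET//.
  by apply/finset.setP => x; rewrite !inE.
move/(_ (enum S)); rewrite (_ : [set x in enum S]%SET = finset.setT)//.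
by apply/finset.setP => x; rewrite !inE mem_enum.
Qed.

Lemma card_slice_closed_bigI (J : eqType) (js : seq J) (P : J -> pred T) (q : nat) :
  (forall j, slice_closed (P j)) -> (forall j, #|T| <= q * #|P j|)%N ->
  (#|T| <= q ^ size js * #|[pred x | all (fun j => P j x) js]|)%N.
Proof.
move=> cP qP; elim: js => [|j js IH]; first by rewrite expn0 mul1n; exact: eq_leq.
have T0 : (0 < #|T|)%N by apply/card_gt0P; exists [ffun=> 0].
rewrite -(leq_pmul2l T0) /= expnS.
apply: leq_trans (leq_mul (qP j) IH) _; rewrite mulnACA [leqRHS]mulnCA leq_mul2l.
apply/orP; right; apply: card_slice_closed => // x s u v.
by move=> /seq.allP Hu /seq.allP Hv; apply/seq.allP => i il; apply: cP; [exact: Hu|exact: Hv].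
Qed.

End Correlation.

(** Such a matrix factors through a space of dimension [p]. *)
Lemma card_low_rank (K : finFieldType) m n p :
  (#|[pred M : 'M[K]_(m, n) | \rank M <= p]| <= #|K| ^ (m * p + p * n))%N.
Proof.
rewrite expnD -!card_mx -cardX.
apply: leq_trans (leq_imset_card (fun AB : 'M_(m, p) * 'M_(p, n) => AB.1 *m AB.2) _).
apply: subset_leq_card; apply/fintype.subsetP => M; rewrite inE => Mp.
apply/imsetP; exists (col_ebase M *m pid_mx (\rank M), pid_mx (\rank M) *m row_ebase M) => //=.
by rewrite mulmxA -(mulmxA (col_ebase M)) pid_mx_id// mulmx_ebase.
Qed.

(** With [m] vectors the comparison of exponents sets [(m - s + 1) * n] against [N * m ^ d] and a
    small term. Taking [m = s] would require [n] of order [N * s ^ d]; [m = 2 * s] makes the left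
    side [(s + 1) * n] and saves a factor [s]. Here [m ^ d = s * A]. *)
Lemma counting_arith (A N n s : nat) : (0 < s)%N -> (A * N + 2 * s <= n)%N ->
  (N * (s * A) + (2 * s * s.-1 + s.-1 * n) < 2 * s * n)%N.
Proof.
case: s => // s _ /= nbig.
have : ((A * N + 2 * s.+1) * s.+2 <= n * s.+2)%N by rewrite leq_mul2r nbig orbT.
nia.
Qed.

Section FiniteField.
Variables (K : finFieldType) (d n : nat) (W : vectType K).
Local Notation V := 'rV[K]_n.
Variable F : ('I_d -> V) -> W.
Hypothesis mF : multilinear (V := fun=> V) F.

Section Slots.
Variables (S I : finType) (r : I -> 'I_d -> S).
Hypothesis r_inj : forall k, injective (r k).
Hypothesis r_sub : forall k l, (forall i, r k i \in codom (r l)) -> k = l.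
Hypothesis dependent : forall x : S -> V, exists c : I -> K,
  (exists k, c k != 0) /\ \sum_k c k *: slot_row F r k x = 0.
Local Notation T := {ffun S -> V}.

(** Pigeonhole: each [x] satisfies one of at most [#|K| ^ #|I|] nonzero relations. *)
Lemma frequent_relation : exists c : {ffun I -> K}, c != 0 /\
  (#|T| <= #|K| ^ #|I| * #|[pred x : T | (\sum_k c k *: slot_row F r k x == 0)%R]|)%N.
Proof.
set Z := fun c : {ffun I -> K} => #|[pred x : T | (\sum_k c k *: slot_row F r k x == 0)%R]|.
apply: contrapT => /forallNP H.
have T0 : (0 < #|T|)%N by apply/card_gt0P; exists [ffun=> 0].
have Q0 : (0 < #|K| ^ #|I|)%N by rewrite -card_ffun; apply/card_gt0P; exists [ffun=> 0].
have Zs c : c != 0 -> (#|K| ^ #|I| * Z c <= #|T|.-1)%N.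
  by move=> c0; rewrite -ltnS prednK// ltnNge; apply/negP => cT; exact: (H c).
have : (#|T| <= \sum_(c : {ffun I -> K} | c != 0%R) Z c)%N.
  rewrite -[#|T|]sum1_card /Z; under [leqRHS]eq_bigr do rewrite -sum1_card.
  rewrite (exchange_big_dep xpredT)//=; apply: leq_sum => x _.
  have [c [[k ck] cx]] := dependent x.
  rewrite (bigD1 [ffun k => c k])//=; apply/andP; split.
    by apply/eqP => /ffunP/(_ k); rewrite !ffunE => /eqP; exact/negP.
  by rewrite inE; apply/eqP; rewrite -[RHS]cx; apply: eq_bigr => j _; rewrite ffunE.
rewrite -(leq_pmul2l Q0) big_distrr/= leqNgt => /negP; apply.
apply: leq_ltn_trans (leq_sum _ Zs) _.
rewrite sum_nat_const; apply: leq_ltn_trans (_ : #|K| ^ #|I| * #|T|.-1 < _)%N.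
  by rewrite leq_mul2r -card_ffun max_card orbT.
by rewrite ltn_pmul2l// prednK.
Qed.

(** On a line of points varying in one slot, fix one zero [v0] of the old sum: by [truncated_diff],
    [v - v0] is a zero of the new one for every old zero [v], and translation is injective. *)
Lemma leq_card_truncated (c : I -> K) k0 l : (l <= d)%N ->
  (#|[pred x : T | truncated F r c k0 0 x == 0%R]| <=
   #|[pred x : T | truncated F r c k0 l x == 0%R]|)%N.
Proof.
elim: l => // l IH ld; apply: (leq_trans (IH (ltnW ld))).
pose i0 := Ordinal ld; apply: (@leq_card_fibers _ _ _ _ (r k0 i0)) => x.
have fE v : fupd x (r k0 i0) v = upd x (r k0 i0) v :> (S -> V).
  by apply: funext => s; rewrite ffunE.
set A := [pred v | _]; set B := [pred v | _].
have [/existsP[v0 Av0]|] := boolP [exists v, A v]; last first.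
  rewrite negb_exists => /forallP A0; rewrite (@eq_card0 _ A)// => v.
  by apply/negP => Av; exact: (negP (A0 v)).
rewrite -(card_imset _ (addIr (- v0))); apply: subset_leq_card.
apply/fintype.subsetP => _ /imsetP[v Av ->]; move: Av Av0; rewrite !inE !fE.
have := truncated_diff mF r_inj c k0 i0 x v0 (v - v0).
by rewrite addrCA subrr addr0 => -> /[swap]/eqP->; rewrite add0r.
Qed.

Lemma zero_density :
  (#|{ffun 'I_d -> V}| <= #|K| ^ #|I| * #|[pred y : {ffun 'I_d -> V} | F y == 0%R]|)%N.
Proof.
have [c [c0 cT]] := frequent_relation.
have [k0 ck0] : exists k0, c k0 != 0.
  apply/existsP; rewrite -negb_forall; apply: contra c0 => /forallP c0.
  by apply/eqP/ffunP => k; rewrite ffunE; exact/eqP.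
have := leq_trans cT (leq_mul (leqnn _) (_ : _ <= #|[pred x : T | F (x \o r k0) == 0%R]|)%N).
have cardE : (#|[pred x : T | F (x \o r k0) == 0%R]| * #|V| ^ #|'I_d| =
    #|V| ^ #|S| * #|[pred y : {ffun 'I_d -> V} | F y == 0%R]|)%N.
  rewrite -(card_comp_inj [pred y : {ffun 'I_d -> V} | F y == 0%R] (@r_inj k0)).
  congr (_ * _)%N; apply: eq_card => x; rewrite !inE; congr (F _ == 0).
  by apply: funext => i; rewrite ffunE.
have V0 (J : finType) : (0 < #|V| ^ #|J|)%N.
  by rewrite -card_ffun; apply/card_gt0P; exists [ffun=> 0].
move=> H; rewrite -(leq_pmul2l (V0 S)) mulnCA -cardE !card_ffun [leqLHS]mulnC.
rewrite mulnA [leqRHS]mulnC leq_mul2l; apply/orP; right; rewrite -card_ffun; apply: H.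
apply: leq_trans (leq_trans (leq_card_truncated c k0 (leqnn d)) _); apply: eq_leq; apply: eq_card => x.
  by rewrite !inE truncated0.
by rewrite !inE truncatedd// scaler_eq0 (negbTE ck0).
Qed.

End Slots.

Variable N : nat.
Hypothesis dense : (#|{ffun 'I_d -> V}| <= #|K| ^ N * #|[pred y : {ffun 'I_d -> V} | F y == 0%R]|)%N.

Lemma isotropic_density (m : nat) :
  (#|{ffun 'I_m -> V}| <= #|K| ^ (N * m ^ d) * #|[pred u : {ffun 'I_m -> V} |
     [forall e : {ffun 'I_d -> 'I_m}, injectiveb e ==> (F (u \o e) == 0%R)]]|)%N.
Proof.
pose P (e : {ffun 'I_d -> 'I_m}) := [pred u : {ffun 'I_m -> V} | F (u \o e) == 0].
pose js := [seq e : {ffun 'I_d -> 'I_m} <- enum {: {ffun 'I_d -> 'I_m}} | injectiveb e].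
(* Only for injective [e] is [F (u \o e)] additive in each coordinate of [u], as slice closure
   requires. *)
pose P' (e : {ffun 'I_d -> 'I_m}) : pred {ffun 'I_m -> V} := if injectiveb e then P e else predT.
have := @card_slice_closed_bigI _ _ _ js P' (#|K| ^ N)%N.
rewrite -expnM => H; apply: leq_trans (H _ _) _.
- move=> e x s u v; rewrite /P'; case: ifP => // /injectiveP eI.
  have [se|se] := boolP (s \in codom e).
    move: se => /codomP[i ->]; rewrite /P/=.
    have uE y : fupd x (e i) y \o e = upd (x \o e) i y.
      by apply: funext => j; rewrite /= ffunE /upd (inj_eq eI).
    rewrite !uE => /eqP Fu /eqP Fv.
    by rewrite addrC -scaleN1r multilinear_upd// Fu Fv scaler0 addr0.
  have uE y : fupd x s y \o e = x \o e.
    by apply: funext => j; rewrite /= ffunE; case: eqP => // sj; rewrite -sj codom_f in se.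
  by rewrite /P/= !uE.
- move=> e; rewrite /P'; case: ifP => [/injectiveP eI|_]; last first.
    by rewrite leq_pmull// expn_gt0; apply/orP; left; apply/card_gt0P; exists 0.
  have V0 (J : finType) : (0 < #|V| ^ #|J|)%N.
    by rewrite -card_ffun; apply/card_gt0P; exists [ffun=> 0].
  have cardE : (#|P e| * #|V| ^ #|'I_d| =
      #|V| ^ #|'I_m| * #|[pred y : {ffun 'I_d -> V} | F y == 0%R]|)%N.
    rewrite -(card_comp_inj [pred y : {ffun 'I_d -> V} | F y == 0%R] eI).
    congr (_ * _)%N; apply: eq_card => x; rewrite !inE; congr (F _ == 0).
    by apply: funext => i; rewrite ffunE.
  rewrite -(leq_pmul2r (V0 'I_d)) -mulnA cardE mulnCA !card_ffun leq_mul2l.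
  by apply/orP; right; have := dense; rewrite card_ffun.
apply: leq_mul.
  rewrite leq_pexp2l//; first by apply/card_gt0P; exists 0.
  rewrite leq_mul2l; apply/orP; right; rewrite size_filter.
  apply: leq_trans (count_size _ _) _.
  by rewrite -cardE card_ffun !card_ord.
apply: subset_leq_card; apply/fintype.subsetP => u /seq.allP Pu; rewrite inE.
apply/forallP => e; apply/implyP => eI.
by have := Pu e; rewrite mem_filter eI mem_enum /P' eI; apply.
Qed.

Theorem finite_isotropic (s : nat) : (0 < d)%N -> (0 < s)%N ->
  (2 ^ d * s ^ d.-1 * N + 2 * s <= n)%N ->
  exists u : s.-tuple V, free u /\
    forall e : 'I_d -> 'I_s, injective e -> F (fun i => u`_(e i)) = 0.
Proof.
move=> d0 s0 nbig; pose m := (2 * s)%N.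
have q1 : (1 < #|K|)%N by exact: card_finNzRing_gt1.
pose mat (u : {ffun 'I_m -> V}) : 'M[K]_(m, n) := \matrix_i u i.
have matI : injective mat.
  by move=> u v /row_matrixP uv; apply/ffunP => i; have := uv i; rewrite !rowK.
have [u /andP[/forallP uF urk]] : exists u : {ffun 'I_m -> V},
    [forall e : {ffun 'I_d -> 'I_m}, injectiveb e ==> (F (u \o e) == 0%R)] &&
    (s <= \rank (mat u))%N.
  apply/existsP; apply: contraT; rewrite negb_exists => /forallP nu.
  have := isotropic_density m; rewrite leqNgt => /negP[].
  apply: leq_ltn_trans (_ : #|K| ^ (N * m ^ d) * #|K| ^ (m * s.-1 + s.-1 * n) < _)%N.
    rewrite leq_mul2l; apply/orP; right.
    apply: leq_trans (card_low_rank K m n s.-1).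
    rewrite -(card_imset _ matI); apply: subset_leq_card.
    apply/fintype.subsetP => _ /imsetP[u Pu ->]; move: Pu; rewrite !inE => Pu.
    by have := nu u; rewrite Pu/= -ltnNge => us; rewrite -ltnS prednK.
  rewrite card_ffun card_ord card_mx mul1n -expnM -expnD ltn_exp2l//.
  have {1}-> : d = d.-1.+1 by rewrite prednK.
  rewrite expnS /m expnMn.
  have -> : (2 * s * (2 ^ d.-1 * s ^ d.-1) = s * (2 ^ d * s ^ d.-1))%N.
    by rewrite -[in (2 ^ d)%N](prednK d0) expnS; lia.
  by rewrite [ltnRHS]mulnC; exact: counting_arith.
(* Choosing [s] independent vectors among the [m] preserves isotropy because the choice is
   injective. *)
pose f := maxrankfun (mat u).
pose g (j : 'I_s) : 'I_m := f (widen_ord urk j).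
have gI : injective g.
  move=> i j /maxrankfun_inj; move/(congr1 val) => /= ij; exact: val_inj.
exists [tuple u (g j) | j < s]; split; last first.
  move=> e eI; have eI' : injectiveb [ffun i => g (e i)].
    by apply/injectiveP => i j; rewrite !ffunE => /gI/eI.
  have /implyP/(_ eI')/eqP := uF [ffun i => g (e i)].
  move=> <-; congr F; apply: funext => i.
  by rewrite -(tnth_nth 0 [tuple u (g j) | j < s]) tnth_mktuple /= ffunE.
pose L := [tuple u (f k) | k < \rank (mat u)].
have fL : free L.
  apply/freeP => c cL k.
  have e : (\row_k c k) *m rowsub f (mat u) = 0 *m rowsub f (mat u).
    rewrite mul0mx mulmx_sum_row -[RHS]cL; apply: eq_bigr => i _.
    by rewrite mxE row_rowsub rowK -(tnth_nth 0 L) tnth_mktuple.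
  by have /rowP/(_ k) := row_free_inj (maxrowsub_free (mat u)) e; rewrite !mxE.
suff -> : tval [tuple u (g j) | j < s] = take s L.
  by move: fL; rewrite -{1}(cat_take_drop s L) => /catl_free.
apply: (@eq_from_nth _ 0) => [|i].
  by rewrite size_takel !size_tuple.
rewrite size_tuple => si; rewrite nth_take//.
rewrite -(tnth_nth 0 [tuple u (g j) | j < s] (Ordinal si)) tnth_mktuple.
by rewrite -(tnth_nth 0 L (widen_ord urk (Ordinal si))) tnth_mktuple.
Qed.

End FiniteField.

(** * Algebraically closed fields *)

Section Forms.
Variables (K : fieldType) (V : lmodType K).
Implicit Types (f : V -> K).

Lemma form_homog i f l v : form i f -> f (l *: v) = l ^+ i * f v.
Proof.
move=> ff; elim: i f / ff => [c|f lf|i|i f g _ ef _ eg|i j f g _ ef _ eg].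
- by rewrite expr0 mul1r.
- have f0 : f 0 = 0.
    have := lf 1 0 0; rewrite scaler0 addr0 mul1r => /eqP.
    by rewrite -subr_eq0 opprD addNKr oppr_eq0 => /eqP.
  by rewrite expr1; have := lf l v 0; rewrite f0 !addr0.
- by rewrite mulr0.
- by rewrite ef eg mulrDr.
- by rewrite ef eg exprD mulrACA.
Qed.

Lemma form_sum i (J : Type) (s : seq J) (P : pred J) (f : J -> V -> K) :
  (forall j, P j -> form i (f j)) -> form i (fun v => \sum_(j <- s | P j) f j v).
Proof.
move=> ff; elim: s => [|j s IH].
  rewrite (_ : (fun v => _) = fun=> 0); first exact: form_zero.
  by apply: funext => v; rewrite big_nil.
rewrite (_ : (fun v => _) =
  fun v => (if P j then f j v else 0) + \sum_(j <- s | P j) f j v).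
  apply: form_add => //; case: (boolP (P j)) => Pj; first exact: ff.
  exact: form_zero.
by apply: funext => v; rewrite big_cons; case: ifP; rewrite ?add0r.
Qed.

Lemma form_mulr i f c : form i f -> form i (fun v => f v * c).
Proof.
move=> ff; rewrite (_ : (fun v => _) = fun v => c * f v).
  exact: (form_mul (form_const _ c) ff).
by apply: funext => v; rewrite mulrC.
Qed.

End Forms.

Section PolynomialStep.
Variable K : closedFieldType.

Lemma closed_poly_nonvanishing : poly_nonvanishing K.
Proof. by move=> p /closed_nonrootP. Qed.

(* The components [c *m H k i v] lie in the row space of [H k 0 0] as soon as all the lower ones vanish, so
   preserving the kernel vector [c] costs [D * r] forms for each [k]. *)
Lemma polynomial_step (V : vectType K) (U : {vspace V}) (I : finType) m w r D
    (c : 'rV[K]_m) (H : I -> nat -> V -> 'M[K]_(m, w)) :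
  (forall k i a b, form i (fun v => H k i v a b)) ->
  (forall k, \rank (H k 0%N 0) = r) ->
  (forall k v, (\rank (\sum_(i < D.+1) H k i v)%R <= r)%N) ->
  (forall k, c *m H k 0%N 0 = 0) ->
  (#|I| * D * r < \dim U)%N ->
  exists v, [/\ v \in U, v != 0 & forall k (j : 'I_D.+1),
    \rank (\sum_(i < D.+1) H k i (j%:R *: v))%R = r /\
    c *m \sum_(i < D.+1) H k i (j%:R *: v) = 0].
Proof.
move=> fH rH rM cH IU.
have HZ k i l v : H k i (l *: v) = l ^+ i *: H k i v.
  by apply/matrixP => a b; rewrite mxE; exact: (form_homog _ _ (fH k i a b)).
have H0 k v : H k 0%N v = H k 0%N 0 by rewrite -(scale0r v) HZ expr0 scale1r.
pose P k v : 'M[{poly K}]_(m, w) := \sum_(i < D.+1) 'X^i *: map_mx polyC (H k i v).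
have PE k v l : mx_eval l (P k v) = \sum_(i < D.+1) H k i (l *: v).
  rewrite /mx_eval map_mx_sum; apply: eq_bigr => i _.
  by rewrite map_mxZ -/(mx_eval _ _) mx_eval_lift /= /horner_eval hornerXn HZ.
have P0 k v : mx_eval 0 (P k v) = H k 0%N 0.
  rewrite PE scale0r big_ord_recl big1 ?addr0// => i _.
  by rewrite -(scale0r v) HZ expr0n scale0r.
have /choice[B BP] : forall k, exists B : 'M[K]_(w, r),
    forall x : 'rV_w, (x <= H k 0%N 0)%MS -> x *m B = 0 -> x = 0.
  by move=> k; exact: row_space_coords.
have [|||v [vU v0 fv]] := @Zeros.form_common_zero K _ U (I * 'I_D * 'I_r)%type
    (fun kit => kit.1.2.+1)
    (fun kit v => (c *m H kit.1.1 kit.1.2.+1 v *m B kit.1.1) 0 kit.2).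
- move=> [[k i] t] /=.
  rewrite (_ : (fun v => _) = fun v => \sum_b (\sum_a c 0 a * H k i.+1 v a b) * B k b t).
    apply: form_sum => b _; apply: form_mulr; apply: form_sum => a _.
    exact: (form_mul (form_const _ (c 0 a)) (fH _ _ _ _)).
  by apply: funext => v; rewrite mxE; apply: eq_bigr => b _; rewrite mxE.
- by [].
- by rewrite !card_prod !card_ord.
have cHv k i : (i < D.+1)%N -> c *m H k i v = 0.
  elim/ltn_ind: i => -[_ _|i IH iD]; first by rewrite H0.
  (* The lower components vanish by induction, so [c *m P k v] is ['X^i.+1] times this [Q]. *)
  pose Q : 'rV[{poly K}]_w := \sum_(l < D.+1 | (i < l)%N) 'X^(l - i.+1) *: map_mx polyC (c *m H k l v).
  have Q0 : mx_eval 0 Q = c *m H k i.+1 v.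
    rewrite /mx_eval map_mx_sum (bigD1 (Ordinal iD))//= subnn expr0 scale1r.
    rewrite -/(mx_eval _ _) mx_eval_lift big1 ?addr0// => l /andP[il /eqP nl].
    rewrite map_mxZ /= /horner_eval hornerXn expr0n subn_eq0 leqNgt ltn_neqAle il andbT.
    rewrite (negbTE (_ : i.+1 != l))/= ?scale0r//.
    by apply/eqP => e; apply: nl; exact: val_inj.
  apply: (BP k).
    rewrite -Q0 -(P0 k v); apply: (@leading_term_submx _ closed_poly_nonvanishing _ _ _ _ c i.+1).
      by move=> l; rewrite PE P0 rH.
    rewrite /P /Q mulmx_sumr scaler_sumr [RHS]big_mkcond/=; apply: eq_bigr => l _.
    rewrite -scalemxAr -map_mxM; case: ifPn => [il|].
      by rewrite scalerA -exprD subnKC.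
    by rewrite -leqNgt => li; rewrite IH// map_mx0 scaler0.
  by apply/rowP => t; rewrite (fv ((k, Ordinal (iD : (i < D)%N)), t)) mxE.
(* A new vector may occur up to [D] times in a sum of chosen vectors, so one scalar has to preserve
   the rank for all its multiples [j%:R *: v]. *)
have [l l0 rl] := @generic_scaling _ closed_poly_nonvanishing (I * 'I_D.+1)%type _ _ (fun kj => P kj.1 (kj.2%:R *: v)).
exists (l *: v); split; rewrite ?rpredZ// ?scaler_eq0 ?negb_or ?l0// => k j.
have cM : c *m \sum_(i < D.+1) H k i (j%:R *: (l *: v)) = 0.
  rewrite mulmx_sumr big1// => i _.
  by rewrite scalerA HZ -scalemxAr cHv ?scaler0.
split=> //; apply/eqP; rewrite eqn_leq rM/=.
have := rl (k, j); rewrite /= P0 PE rH.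
by rewrite !scalerA (mulrC l).
Qed.

End PolynomialStep.

Section Expansion.
Variables (K : fieldType) (d : nat) (V : 'I_d -> vectType K) (W : vectType K).
Variables (J : finType) (g : 'I_d -> J -> K) (e : forall i, J -> V i).

Lemma tpure_expand : tpure (fun i => \sum_j g i j *: e i j) =
  \sum_(f : {ffun 'I_d -> J}) (\prod_i g i (f i)) *: tpure (fun i => e i (f i)).
Proof.
apply/ffunP => a; rewrite sum_ffunE ffunE.
under eq_bigr do rewrite linear_sum/=.
rewrite bigA_distr_bigA/=; apply: eq_bigr => f _; rewrite !ffunE.
under eq_bigr do rewrite linearZ/=.
by rewrite big_split.
Qed.

Variable F : (forall i, V i) -> W.

Lemma tlift_linear : linear (tlift F).
Proof.
move=> a x y; rewrite /tlift scaler_sumr -big_split; apply: eq_bigr => i _ /=.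
by rewrite !ffunE scalerDl scalerA.
Qed.

Lemma tlift_sum (I : Type) (s : seq I) (P : pred I) (c : I -> K) (T : I -> tensor V) :
  tlift F (\sum_(i <- s | P i) c i *: T i) = \sum_(i <- s | P i) c i *: tlift F (T i).
Proof.
have t0 : tlift F 0 = 0 by rewrite /tlift big1// => i _; rewrite ffunE scale0r.
elim/big_rec2: _ => // i x y _ <-.
by rewrite tlift_linear.
Qed.

Lemma multilinear_expand : multilinear F ->
  F (fun i => \sum_j g i j *: e i j) =
  \sum_(f : {ffun 'I_d -> J}) (\prod_i g i (f i)) *: F (fun i => e i (f i)).
Proof.
move=> mF; rewrite -tlift_pure// tpure_expand tlift_sum.
by apply: eq_bigr => f _; rewrite tlift_pure.
Qed.

End Expansion.

Section Polarization.
Variables (K : fieldType) (d : nat) (V W : vectType K) (F : ('I_d -> V) -> W).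
Hypothesis sF : symmetric_multilinear F.

(** After expansion, the signed sum over [J] kills every term that misses some [v j]. The survivors
    use each [v j] exactly once, leaving no room for [p], and symmetry makes all d! of them
    equal. *)
Lemma polarization (p : 'I_d -> V) (mu : 'I_d -> K) (v : 'I_d -> V) :
  \sum_(J : {set 'I_d}) (\prod_j (if j \in J then 1 else - 1)) *:
     F (fun i => p i + mu i *: \sum_(j in J) v j) =
  (d`!%:R * \prod_i mu i) *: F v.
Proof.
pose e i (o : option 'I_d) := if o is Some j then v j else p i.
pose g (J : {set 'I_d}) i (o : option 'I_d) := if o is Some j then mu i * (j \in J)%:R else 1.
have gE (J : {set 'I_d}) i : p i + mu i *: \sum_(j in J) v j = \sum_o g J i o *: e i o.
  rewrite (bigD1 None)//= scale1r; congr (_ + _).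
  rewrite scaler_sumr big_mkcond/= [RHS](reindex_omap (op := +%R) Some id)/=; last by case.
  by apply: eq_big => [j|j _]; rewrite ?eqxx//; case: (j \in J); rewrite ?mulr1 ?mulr0 ?scale0r.
rewrite (eq_bigr (fun J : {set 'I_d} => \sum_(f : {ffun 'I_d -> option 'I_d})
    ((\prod_j (if j \in J then 1 else - 1)) * \prod_i g J i (f i)) *:
      F (fun i => e i (f i)))); last first.
  move=> J _; have -> : (fun i => p i + mu i *: \sum_(j in J) v j) =
      fun i => \sum_o g J i o *: e i o by apply: funext => i; exact: gE.
  rewrite (multilinear_expand _ _ sF.1) scaler_sumr.
  by apply: eq_bigr => f _; rewrite scalerA.
rewrite exchange_big/=.
pose onto (f : {ffun 'I_d -> option 'I_d}) := [forall j, Some j \in codom f].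
have gf (f : {ffun 'I_d -> option 'I_d}) :
    \sum_(J : {set 'I_d}) (\prod_j (if j \in J then 1 else - 1)) * \prod_i g J i (f i) =
    (onto f)%:R * \prod_i (if f i is Some _ then mu i else 1).
  have gJ (J : {set 'I_d}) : \prod_i g J i (f i) =
      (\prod_j (if j \in J then 1 else (Some j \notin codom f)%:R)) *
      \prod_i (if f i is Some _ then mu i else 1).
    have [/forallP HJ|] := boolP [forall i, if f i is Some j then j \in J else true].
      rewrite [X in X * _]big1 ?mul1r.
        by apply: eq_bigr => i _; rewrite /g; have := HJ i; case: (f i) => // j ->; rewrite mulr1.
      move=> j _; case: ifPn => // jJ; case: (boolP (Some j \in codom f)) => // /codomP[i fi].
      by have := HJ i; rewrite -fi (negbTE jJ).
    rewrite negb_forall => /existsP[i]; case fi: (f i) => [j|]// jJ.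
    rewrite (bigD1 i)//= /g fi (negbTE jJ) mulr0 mul0r.
    by rewrite (bigD1 j)//= (negbTE jJ) -fi codom_f/= !mul0r.
  rewrite (eq_bigr (fun J : {set 'I_d} => (\prod_j ((if j \in J then 1 else - 1) *
      (if j \in J then 1 else (Some j \notin codom f)%:R))) *
      \prod_i (if f i is Some _ then mu i else 1))) => [|J _]; last first.
    by rewrite gJ mulrA -big_split.
  rewrite -mulr_suml; congr (_ * _).
  (* The signed sum factors over [j], with factor 1 if [f] hits [j] and 0 otherwise. *)
  transitivity (\prod_j (1 + - (Some j \notin codom f)%:R) : K).
    rewrite bigA_distr; apply: eq_bigr => J _; apply: eq_bigr => j _.
    by case: ifP; rewrite ?mulr1 ?mulN1r.
  rewrite /onto; case: (boolP [forall j, _]) => [/forallP H|].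
    by rewrite big1// => j _; rewrite H subr0.
  by rewrite negb_forall => /existsP[j jf]; rewrite (bigD1 j)//= jf subrr mul0r.
under eq_bigr do rewrite -scaler_suml gf.
pose h (s : 'S_d) : {ffun 'I_d -> option 'I_d} := [ffun i => Some (s i)].
have hI : injective h.
  by move=> s s' /ffunP ss'; apply/permP => i; have := ss' i; rewrite !ffunE => -[].
have ontoE f : onto f = (f \in h @: [set: 'S_d]%SET).
  apply/idP/imsetP => [of_|[s _ ->]]; last first.
    by apply/forallP => j; apply/codomP; exists (s^-1%g j); rewrite ffunE permKV.
  have /choice[t tE] : forall j, exists i, Some j = f i.
    by move=> j; apply/codomP; exact: (forallP of_).
  have tI : injective t by move=> i j tij; have := tE i; rewrite tij -tE => -[].
  exists (perm tI)^-1%g => //; apply/ffunP => i; rewrite ffunE tE; congr (f _).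
  by rewrite -(permE tI) permKV.
rewrite (bigID onto)/= [X in _ + X]big1 ?addr0 => [|f /negbTE->]; last by rewrite !mul0r scale0r.
rewrite (eq_bigl _ _ ontoE) big_imset/=; last by move=> s s' _ _; exact: hI.
rewrite (eq_bigr (fun=> (\prod_i mu i) *: F v)) => [|s _].
  rewrite sumr_const cardsT card_Sn -scaler_nat scalerA; congr (_ *: _).
rewrite ontoE imset_f ?inE// mul1r -(sF.2 v s); congr (_ *: F _).
  by apply: eq_bigr => i _; rewrite ffunE.
by apply: funext => i; rewrite ffunE.
Qed.

End Polarization.

Lemma form_prod (K : fieldType) (V : lmodType K) (J : Type) (s : seq J)
    (i : J -> nat) (f : J -> V -> K) :
  (forall j, form (i j) (f j)) ->
  form (\sum_(j <- s) i j) (fun v => \prod_(j <- s) f j v).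
Proof.
move=> ff; elim: s => [|j s IH].
  rewrite big_nil (_ : (fun v => _) = fun=> 1); first exact: form_const.
  by apply: funext => v; rewrite big_nil.
rewrite big_cons (_ : (fun v => _) = fun v => f j v * \prod_(j <- s) f j v).
  exact: form_mul.
by apply: funext => v; rewrite big_cons.
Qed.

Section Components.
Variables (K : fieldType) (d w : nat) (V : vectType K) (F : ('I_d -> V) -> 'rV[K]_w).
Hypothesis mF : multilinear (V := fun=> V) F.
Implicit Types (q y : 'I_d -> V).

Definition mixed q y (f : 'I_d -> bool) : 'I_d -> V := fun i => if f i then y i else q i.

Lemma multilinear_add q y :
  F (fun i => q i + y i) = \sum_(f : {ffun 'I_d -> bool}) F (mixed q y f).
Proof.
have -> : (fun i => q i + y i) = fun i => \sum_(b : bool) 1 *: (if b then y i else q i).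
  by apply: funext => i; rewrite big_bool/= !scale1r addrC.
rewrite (multilinear_expand (fun=> fun=> 1) (fun i (b : bool) => if b then y i else q i) mF).
by apply: eq_bigr => f _; rewrite big1// scale1r.
Qed.

(** The part of degree [i] in [v] of [F] at [q + mu v]. *)
Definition component q (mu : 'I_d -> K) (i : nat) (v : V) : 'rV[K]_w :=
  \sum_(f : {ffun 'I_d -> bool} | \sum_j (f j : nat) == i)
     F (mixed q (fun j => mu j *: v) f).

Lemma sum_component q mu v :
  F (fun j => q j + mu j *: v) = \sum_(i < d.+1) component q mu i v.
Proof.
rewrite multilinear_add.
have fd (f : {ffun 'I_d -> bool}) : (\sum_j (f j : nat) < d.+1)%N.
  rewrite ltnS -[X in (_ <= X)%N]card_ord -sum1_card; apply: leq_sum => j _.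
  exact: leq_b1.
by rewrite (partition_big (fun f => Ordinal (fd f)) xpredT).
Qed.

Lemma component0 q mu v : component q mu 0 v = F q.
Proof.
rewrite /component (big_pred1 [ffun=> false]) => [|f /=].
  by congr F; apply: funext => j; rewrite /mixed ffunE.
rewrite sum_nat_eq0; apply/forallP/eqP => [f0|-> j]; last by rewrite ffunE.
by apply/ffunP => j; rewrite ffunE; have := f0 j; case: (f j).
Qed.

Lemma component_form q mu i b : form i (fun v => component q mu i v 0 b).
Proof.
pose n := \dim {:V}; pose e (m : 'I_n) := (vbasis {:V})`_m.
have coordE (x : V) : x = \sum_m coord (vbasis {:V}) m x *: e m.
  exact: (coord_vbasis (memvf x)).
rewrite (_ : (fun v => _) = fun v => \sum_(f : {ffun 'I_d -> bool} | \sum_j (f j : nat) == i)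
    \sum_(h : {ffun 'I_d -> 'I_n})
      (\prod_j coord (vbasis {:V}) (h j) (mixed q (fun j => mu j *: v) f j)) *
      F (fun j => e (h j)) 0 b).
  apply: form_sum => f /eqP <-; apply: form_sum => h _; apply: form_mulr.
  apply: form_prod => j; rewrite /mixed; case: (f j); last exact: form_const.
  apply: form_scalar => a x y; rewrite scalerDr scalerA mulrC -scalerA.
  by rewrite linearP.
apply: funext => v; rewrite /component summxE; apply: eq_bigr => f _.
have -> : mixed q (fun j => mu j *: v) f =
    fun j => \sum_m coord (vbasis {:V}) m (mixed q (fun j => mu j *: v) f j) *: e m.
  by apply: funext => j; exact: coordE.
rewrite (multilinear_expand
  (fun j m => coord (vbasis {:V}) m (mixed q (fun j => mu j *: v) f j)) (fun _ m => e m) mF).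
rewrite summxE; apply: eq_bigr => h _; rewrite mxE; congr (_ * _).
by apply: eq_bigr => j _; rewrite -coordE.
Qed.

End Components.

Section SymmetricCore.
Variables (K : closedFieldType) (d w t : nat) (V : vectType K).
Variable F : ('I_d -> V) -> 'rV[K]_w.
Hypothesis sF : symmetric_multilinear F.
Hypothesis d_neq0 : d`!%:R != 0 :> K.
Local Notation I := {ffun 'I_d -> 'I_t}.
Local Notation row := (slot_row F (fun a : I => a : 'I_d -> 'I_t)).

(** The array [c] is the coefficient array of a symmetric multilinear [G]. If [G] vanished on the
    diagonal, polarization would give [G = 0], but its value at the unit vectors indexed by [a0] is
    [c a0]. *)
Lemma symmetric_form_neq0 (c : I -> K) (a0 : I) :
  (forall (s : 'S_d) (a : I), c [ffun i => a (s i)] = c a) -> c a0 != 0 ->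
  exists mu : 'I_t -> K, \sum_a c a * \prod_i mu (a i) != 0.
Proof.
move=> cs ca0; apply: contrapT => /forallNP H.
pose G (y : 'I_d -> 'rV[K]_t) : K^o := \sum_a c a * \prod_i y i 0 (a i).
have sG : symmetric_multilinear G.
  split=> [x i l u v|x s].
    rewrite /G scaler_sumr -big_split; apply: eq_bigr => a _ /=.
    rewrite !(bigD1 (P := xpredT) i isT)/= !dfwithin !mxE.
    have E y : \prod_(j | j != i) (dfwith (T := fun=> 'rV[K]_t) x i y) j 0 (a j) =
        \prod_(j | j != i) x j 0 (a j).
      by apply: eq_bigr => j ji; rewrite dfwithout// eq_sym.
    by rewrite !E /GRing.scale/= mulrDl mulrDr !mulrA (mulrC l).
  rewrite /G (reindex (fun a : I => [ffun i => a (s i)]))/=; last first.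
    exists (fun a : I => [ffun i => a (s^-1%g i)]) => a _; apply/ffunP => i.
      by rewrite !ffunE permKV.
    by rewrite !ffunE permK.
  apply: eq_bigr => a _; rewrite cs; congr (_ * _).
  rewrite [RHS](reindex_inj (@perm_inj _ s))/=.
  by apply: eq_bigr => i _; rewrite ffunE.
pose v i : 'rV[K]_t := delta_mx 0 (a0 i).
have := polarization sG (fun=> 0) (fun=> 1) v.
rewrite big1 => [/esym/eqP|J _]; last first.
  rewrite (_ : G _ = 0) ?scaler0//.
  have /negP/negPn/eqP E := H (fun m => (\sum_(j in J) v j) 0 m); rewrite -[RHS]E.
  apply: eq_bigr => a _; congr (_ * _); apply: eq_bigr => i _.
  by rewrite add0r scale1r.
rewrite [X in _ * X]big1// mulr1 scaler_eq0 (negbTE d_neq0)/= => /eqP Gv.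
suff Ga : G v = c a0 by move: ca0; rewrite -Ga Gv eqxx.
rewrite /G (bigD1 a0)//= [X in _ * X + _]big1 => [|i _]; last by rewrite mxE !eqxx.
rewrite mulr1 big1 ?addr0// => a aa0.
have [i ai] : exists i, a i != a0 i.
  apply/existsP; rewrite -negb_forall; apply: contra aa0 => /forallP aa0.
  by apply/eqP/ffunP => i; exact/eqP.
by rewrite (bigD1 i)//= mxE eqxx (negbTE ai) mul0r mulr0.
Qed.

Hypothesis dependent : forall x : 'I_t -> V, exists c : I -> K,
  [/\ forall (s : 'S_d) (a : I), c [ffun i => a (s i)] = c a, exists a, c a != 0 &
      \sum_a c a *: row a x = 0].

(** The relation [c] is preserved at [p + mu z] for all sums [z] of at most [d] chosen vectors. Its
    signed sum over subsets of [y] is, by polarization, d! times the value of the form of [c] at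
    [mu] times [F y], with nonzero scalar. Repeated vectors are allowed, hence arbitrary [e]. *)
Theorem closed_isotropic (s : nat) :
  (d * s ^ d.-1 * d * t ^ d + s <= \dim {:V})%N ->
  exists u : s.-tuple V, free u /\
    forall e : 'I_d -> 'I_s, F (fun i => u`_(e i)) = 0.
Proof.
move=> dimV.
have [p pmax] := max_rank (slot_mx F (fun a : I => a : 'I_d -> 'I_t)) (fun=> 0).
have [c [cs [a0 ca0] cp]] := dependent p.
have [mu cmu] := symmetric_form_neq0 cs ca0.
pose cv : 'rV[K]_#|I| := \row_i c (enum_val i).
pose pt z : 'I_t -> V := fun m => p m + mu m *: z.
pose M z := slot_mx F (fun a : I => a : 'I_d -> 'I_t) (pt z).
pose r := \rank (slot_mx F (fun a : I => a : 'I_d -> 'I_t) p).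
pose good z := \rank (M z) = r /\ cv *m M z = 0.
have good0 : good 0.
  rewrite /good; have -> : M 0 = slot_mx F (fun a : I => a : 'I_d -> 'I_t) p.
    by congr slot_mx; apply: funext => m; rewrite /pt scaler0 addr0.
  by split=> //; rewrite mul_slot_mx.
pose H z i v : 'M[K]_(#|I|, w) := \matrix_l component F
  (fun j => pt z ((enum_val l : I) j)) (fun j => mu ((enum_val l : I) j)) i v.
have HM z v : M (z + v) = \sum_(i < d.+1) H z i v.
  apply/row_matrixP => l; rewrite linear_sum/= rowK.
  rewrite (eq_bigr (fun i : 'I_d.+1 => component F (fun j => pt z ((enum_val l : I) j))
    (fun j => mu ((enum_val l : I) j)) i v)) => [|i _]; last by rewrite rowK.
  rewrite -sum_component; last exact: sF.1.
  congr F; apply: funext => j; rewrite /= /pt.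
  by rewrite -addrA -scalerDr.
have H0 z : H z 0%N 0 = M z.
  by apply/row_matrixP => l; rewrite !rowK component0.
have cardI : #|I| = (t ^ d)%N by rewrite card_ffun !card_ord.
have step k : (k <= s)%N -> exists u : nat -> V, [/\ u 0%N = 0,
    free [seq u i.+1 | i <- iota 0 k] &
    forall e : 'I_d -> nat, (forall i, e i <= k)%N -> good (\sum_i u (e i))].
  elim: k => [_|k IH ks].
    exists (fun=> 0); split => //; first by rewrite /free span_nil dimv0.
    by move=> e _; rewrite big1.
  have [u [u0 fu gu]] := IH (ltnW ks).
  pose dom (je : 'I_d * {ffun 'I_d -> 'I_k.+1}) := je.2 je.1 == ord0.
  pose z (je : {je | dom je}) := \sum_i u ((val je).2 i).
  have gz je : good (z je) by apply: gu => i; rewrite -ltnS.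
  have cdom : (#|{: {je | dom je}}| <= d * s ^ d.-1)%N.
    by rewrite card_sig; exact: card_vanishing_slot.
  pose U := <<[seq u i.+1 | i <- iota 0 k]>>%VS.
  have dU : \dim U = k by rewrite (eqP fu) size_map size_iota.
  have [|||||v [vU v0 gv]] := @polynomial_step K V (U^C)%VS {je | dom je} _ w
      r d cv (fun je => H (z je)).
  - by move=> je i l b; under eq_fun do rewrite mxE; exact: (component_form sF.1).
  - by move=> je; rewrite H0; case: (gz je).
  - by move=> je v; rewrite -HM; exact: pmax.
  - by move=> je; rewrite H0; case: (gz je).
  - rewrite dimv_compl dU ltn_subRL addnC.
    apply: leq_trans dimV; rewrite -addnS; apply: leq_add => //.
    apply: leq_mul; first by rewrite leq_mul2r cdom orbT.
    by rewrite -cardI; exact: rank_leq_row.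
  exists (upd u k.+1 v); split; first by rewrite /upd.
    exact: free_upd.
  move=> e ek.
  have [/existsP[j ej]|nk] := boolP [exists j, e j == k.+1]; last first.
    have ne i : e i != k.+1 by move: nk; rewrite negb_exists => /forallP.
    rewrite (eq_bigr (fun i => u (e i))) => [|i _]; last by rewrite /upd (negbTE (ne i)).
    by apply: gu => i; have := ek i; rewrite leq_eqVlt (negbTE (ne i)).
  (* All [m] occurrences of the new vector are removed at once; [j] only witnesses that there is
     one. *)
  pose e0 : {ffun 'I_d -> 'I_k.+1} := [ffun i => if e i == k.+1 then ord0 else inord (e i)].
  have dom0 : dom (j, e0) by rewrite /dom/= ffunE ej.
  pose m := #|[pred i | e i == k.+1]|.
  have md : (m < d.+1)%N by rewrite ltnS -[X in (_ <= X)%N]card_ord; exact: max_card.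
  have := gv (exist _ (j, e0) dom0) (Ordinal md); rewrite -HM/= => gm.
  suff -> : \sum_i upd u k.+1 v (e i) = z (exist _ (j, e0) dom0) + m%:R *: v by [].
  rewrite /z/= (bigID (fun i => e i == k.+1))/= addrC; congr (_ + _); last first.
    rewrite (eq_bigr (fun=> v)) => [|i ei]; last by rewrite /upd ei.
    by rewrite sumr_const scaler_nat.
  rewrite [RHS](bigID (fun i => e i == k.+1))/= [X in _ = X + _]big1 ?add0r => [|i ei].
    apply: eq_bigr => i ei; rewrite /upd (negbTE ei) ffunE (negbTE ei) inordK//.
    by rewrite ltn_neqAle ei ek.
  by rewrite ffunE ei.
have [u [u0 fu gu]] := step s (leqnn s).
have su : size [seq u i.+1 | i <- iota 0 s] == s by rewrite size_map size_iota.
exists (Tuple su); split => //= e.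
have uE (i : 'I_s) : [seq u i.+1 | i <- iota 0 s]`_i = u i.+1.
  by rewrite (nth_map 0%N) ?size_iota// nth_iota.
rewrite (_ : (fun i => _) = fun i => u (e i).+1); last by apply: funext => i; rewrite uE.
set y := fun i => _.
have Xy (J : {set 'I_d}) : \sum_a c a *: row a (pt (\sum_(j in J) y j)) = 0.
  pose e' (i : 'I_d) := if i \in J then (e i).+1 else 0%N.
  have -> : \sum_(j in J) y j = \sum_i u (e' i).
    by rewrite big_mkcond; apply: eq_bigr => i _; rewrite /e'; case: ifP.
  have [|_] := gu e'; last by rewrite mul_slot_mx.
  by move=> i; rewrite /e'; case: ifP.
have : \sum_a c a *: (\sum_(J : {set 'I_d}) (\prod_j (if j \in J then 1 else - 1)) *:
    row a (pt (\sum_(j in J) y j))) = 0.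
  under eq_bigr do rewrite scaler_sumr.
  rewrite exchange_big/= big1// => J _.
  under eq_bigr do rewrite scalerA mulrC -scalerA.
  by rewrite -scaler_sumr Xy scaler0.
rewrite (eq_bigr (fun a : I => (d`!%:R * (c a * \prod_i mu (a i))) *: F y)) => [|a _]; last first.
  have := polarization sF (fun i => p (a i)) (fun i => mu (a i)) y.
  by move=> ->; rewrite scalerA mulrCA.
rewrite -scaler_suml -mulr_sumr => /eqP; rewrite scaler_eq0 mulf_eq0.
by rewrite (negbTE d_neq0) (negbTE cmu)/= => /eqP.
Qed.

End SymmetricCore.

(** * Subspaces on which the map is injective *)

Lemma span_ind (K : fieldType) (V : vectType K) (X : seq V) (P : V -> Prop) :
  P 0 -> (forall a u v, P u -> P v -> P (a *: u + v)) -> (forall x, x \in X -> P x) ->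
  forall v, v \in <<X>>%VS -> P v.
Proof.
move=> P0 PD PX v; rewrite -[X]/(tval (in_tuple X)) => /coord_span->.
elim/big_rec: _ => // i x _; apply: PD; apply: PX.
by apply: mem_nth; rewrite ltn_ord.
Qed.

Section TensorBeta.
Variables (K : fieldType) (d t : nat) (V : 'I_d -> vectType K) (W : vectType K).
Variables (F : (forall i, V i) -> W) (x : forall i, 'I_t -> V i).
Hypothesis mF : multilinear F.
Local Notation index := {ffun 'I_d -> 'I_t}.
Local Notation U i := <<[tuple x i b | b < t]>>%VS.

Lemma mem_span_tuple i (v : V i) : v \in U i -> exists g : 'I_t -> K, v = \sum_b g b *: x i b.
Proof.
move=> /coord_span->; exists (fun b => coord [tuple x i b | b < t] b v).
by apply: eq_bigr => b _; rewrite -tnth_nth tnth_mktuple.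
Qed.

Lemma multilinear_slot0 (y : forall i, V i) i : y i = 0 -> F y = 0.
Proof.
move=> yi; have -> : y = dfwith y i 0.
  by apply: functional_extensionality_dep => j; case: dfwithP => // _; rewrite yi.
have := @mF y i 1 0 0; rewrite !scale1r !addr0 => /eqP.
by rewrite -subr_eq0 opprD addNKr oppr_eq0 => /eqP.
Qed.

Lemma tsubspace_span T : T \in tsubspace (fun i => U i) ->
  exists c : index -> K, T = \sum_a c a *: tpure (fun i => x i (a i)).
Proof.
move: T; apply: span_ind => [|k _ _ [c ->] [c' ->]|_ /mapP[b _ ->]].
- by exists (fun=> 0); rewrite big1// => a _; rewrite scale0r.
- exists (fun a => k * c a + c' a); rewrite scaler_sumr -big_split.
  by apply: eq_bigr => a _ /=; rewrite scalerDl scalerA.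
have /choice[g gE] : forall i, exists g : 'I_t -> K,
    (vbasis (U i))`_(b i) = \sum_b' g b' *: x i b'.
  by move=> i; apply: mem_span_tuple; rewrite vbasis_mem// mem_nth// size_tuple.
exists (fun a => \prod_i g i (a i)); rewrite -tpure_expand; congr tpure.
exact: functional_extensionality_dep.
Qed.

Hypothesis independent : forall c : index -> K,
  \sum_a c a *: F (fun i => x i (a i)) = 0 -> forall a, c a = 0.

(** Put a linear relation in slot [i] and the vectors of index [b0] in the others; [l b0] is then
    the coefficient at the constant multi-index. *)
Lemma independent_free i : free [tuple x i b | b < t].
Proof.
apply/freeP => l l0 b0.
pose g j b := if j == i then l b else (b == b0)%:R.
have /independent/(_ [ffun=> b0]) : \sum_(a : index) (\prod_j g j (a j)) *: F (fun i => x i (a i)) = 0.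
  rewrite -(multilinear_expand g x mF); apply: (multilinear_slot0 (i := i)).
  rewrite -[RHS]l0; apply: eq_bigr => b _; rewrite /g eqxx -tnth_nth.
  by rewrite tnth_mktuple.
rewrite (bigD1 i)//= big1 ?mulr1; first by rewrite /g eqxx ffunE.
by move=> j ji; rewrite /g (negbTE ji) ffunE eqxx.
Qed.

Lemma independent_beta : exists U : forall i, {vspace V i},
  (forall i, \dim (U i) = t) /\ {in tsubspace U &, injective (tlift F)}.
Proof.
exists (fun i => U i); split=> [i|T1 T2 T1U T2U eT].
  by rewrite (eqP (independent_free i)) size_tuple.
have [c cE] := tsubspace_span (memvB T1U T2U).
apply/eqP; rewrite -subr_eq0 cE; apply/eqP.
have c0 : forall a, c a = 0.
  apply: independent; transitivity (tlift F (T1 - T2)).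
    by rewrite cE tlift_sum; apply: eq_bigr => a _; rewrite tlift_pure.
  have -> : T1 - T2 = (-1) *: T2 + T1 by rewrite scaleN1r addrC.
  by rewrite tlift_linear scaleN1r eT addNr.
by apply: big1 => a _; rewrite c0 scale0r.
Qed.

End TensorBeta.

Section SymmetricBeta.
Variables (K : fieldType) (d t : nat) (V W : vectType K).
Variables (F : ('I_d -> V) -> W) (x : 'I_t -> V).
Hypothesis sF : symmetric_multilinear F.
Hypothesis d_neq0 : d`!%:R != 0 :> K.
Local Notation index := {ffun 'I_d -> 'I_t}.
Local Notation U := <<[tuple x b | b < t]>>%VS.
Hypothesis independent : forall c : index -> K,
  (forall (s : 'S_d) (a : index), c [ffun i => a (s i)] = c a) ->
  \sum_a c a *: F (x \o a) = 0 -> forall a, c a = 0.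

(** A relation put in all slots at once has symmetric coefficients, the one at a constant
    multi-index being [l b0 ^+ d]. *)
Lemma independent_free_sym : (0 < d)%N -> free [tuple x b | b < t].
Proof.
move=> d0; apply/freeP => l l0 b0.
have /independent : \sum_(a : index) (\prod_j l (a j)) *: F (x \o a) = 0.
  rewrite -(multilinear_expand (fun=> l) (fun _ b => x b) sF.1).
  apply: (multilinear_slot0 (i := Ordinal d0) sF.1).
  by rewrite -[RHS]l0; apply: eq_bigr => b _; rewrite -tnth_nth tnth_mktuple.
have sl (s : 'S_d) (a : index) : \prod_j l ([ffun i => a (s i)] j) = \prod_j l (a j).
  rewrite [RHS](reindex_inj (@perm_inj _ s))/=.
  by apply: eq_bigr => j _; rewrite ffunE.
move=> /(_ sl [ffun=> b0]); rewrite (eq_bigr (fun=> l b0)) => [|j _]; last by rewrite ffunE.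
by rewrite prodr_const card_ord => /eqP; rewrite expf_eq0 d0 => /eqP.
Qed.

Lemma independent_beta_sym : free [tuple x b | b < t] -> exists U : {vspace V},
  \dim U = t /\ {in [predI tsubspace (fun _ : 'I_d => U) & symmetric_tensor] &,
                   injective (tlift (V := fun=> V) F)}.
Proof.
move=> fx; exists U; split=> [|T1 T2 /andP[/= T1U /forallP sT1] /andP[/= T2U /forallP sT2] eT].
  by rewrite (eqP fx) size_tuple.
have [c cE] := tsubspace_span (x := fun=> x) (memvB T1U T2U).
(* The coefficients [c] need not be symmetric; summing over permutations makes them so, at the price
   of a factor d!. *)
pose C (a : index) : K := \sum_(s : 'S_d) c [ffun i => a (s i)].
have dT : d`!%:R *: (T1 - T2) = \sum_a C a *: tpure (V := fun=> V) (x \o a).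
  have Ts (s : 'S_d) : T1 - T2 = \sum_(a : index) c [ffun i => a (s i)] *: tpure (V := fun=> V) (x \o a).
    apply/ffunP => l; rewrite !ffunE.
    have /forallP/(_ l)/eqP <- := sT1 s; have /forallP/(_ l)/eqP <- := sT2 s.
    have /ffunP/(_ (index_perm s l)) := cE; rewrite !ffunE => ->.
    rewrite !sum_ffunE (reindex_onto (fun a : index => [ffun i => a (s i)])
      (fun a : index => [ffun i => a (s^-1%g i)]))/=; last first.
      by move=> a _; apply/ffunP => i; rewrite !ffunE permK.
    apply: eq_big => [a|a _]; first by apply/eqP/ffunP => i; rewrite !ffunE permKV.
    rewrite !ffunE; congr (_ *: _).
    rewrite [RHS](reindex_inj (@perm_inj _ s))/=.
    by apply: eq_bigr => i _; rewrite !ffunE.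
  transitivity (\sum_(s : 'S_d) (T1 - T2)); first by rewrite sumr_const card_Sn scaler_nat.
  rewrite (eq_bigr _ (fun s _ => Ts s)) exchange_big/=.
  by apply: eq_bigr => a _; rewrite scaler_suml.
have C0 : forall a, C a = 0.
  apply: independent => [s a|].
    rewrite /C (reindex_inj (mulIg s^-1%g))/=; apply: eq_bigr => s' _; congr c.
    by apply/ffunP => i; rewrite !ffunE permM permKV.
  transitivity (tlift (V := fun=> V) F (d`!%:R *: (T1 - T2))).
    by rewrite dT tlift_sum; apply: eq_bigr => a _; rewrite tlift_pure//; exact: sF.1.
  have tl := @tlift_linear _ _ (fun=> V) _ F.
  have t0 : tlift (V := fun=> V) F 0 = 0 by rewrite /tlift big1// => i _; rewrite ffunE scale0r.
  have -> : d`!%:R *: (T1 - T2) = d`!%:R *: ((-1) *: T2 + T1) + 0.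
    by rewrite scaleN1r addrC addr0 (addrC (- T2)).
  by rewrite !tl t0 scaleN1r eT addNr scaler0 addr0.
apply/eqP; rewrite -subr_eq0.
have : d`!%:R *: (T1 - T2) = 0 by rewrite dT big1// => a _; rewrite C0 scale0r.
by move=> /eqP; rewrite scaler_eq0 (negbTE d_neq0).
Qed.

End SymmetricBeta.

Lemma tpure_multilinear (K : fieldType) (d : nat) (V : 'I_d -> vectType K) :
  multilinear (@tpure K d V).
Proof.
move=> x i c u v; apply/ffunP => a; rewrite !ffunE.
rewrite !(bigD1 (P := xpredT) i isT)/= !dfwithin linearP mulrDl.
rewrite /GRing.scale/= mulrA.
by congr (_ * _ + _ * _); apply: eq_bigr => j ji; rewrite !dfwithout// eq_sym.
Qed.

(** * Wedge products as a basis of the alternating tensors *)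

Section Wedge.
Variables (K : fieldType) (d : nat) (V : vectType K).
Local Notation tpower := (tensor (fun _ : 'I_d => V)).
Local Notation tpindex := (tindex (fun _ : 'I_d => V)).
Implicit Types (a c : tpindex) (v : 'I_d -> V) (T : tpower).

Lemma twedgeE v a : twedge v a = \det (\matrix_(k, i) coord (vbasis {:V}) (a i) (v k)).
Proof.
rewrite -det_tr /determinant sum_ffunE; apply: eq_bigr => s _.
by rewrite !ffunE; congr (_ * _); apply: eq_bigr => i _; rewrite !mxE.
Qed.

Lemma twedge_alternating : alternating_multilinear (@twedge K d V).
Proof.
split=> [v i k x y|v i j ij vij]; apply/ffunP => a; rewrite !ffunE !twedgeE.
  rewrite -[X in _ = _ + X]mul1r; apply: (determinant_multilinear (i0 := i)).
  - by apply/rowP => l; rewrite !mxE !dfwithin linearP mul1r.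
  - by apply/matrixP => l m; rewrite !mxE !dfwithout// neq_lift.
  - by apply/matrixP => l m; rewrite !mxE !dfwithout// neq_lift.
by apply: (determinant_alternate ij) => k; rewrite !mxE vij.
Qed.

Lemma increasingP a :
  reflect (forall i j : 'I_d, (i < j)%N -> (a i < a j)%N) (increasing a).
Proof.
apply: (iffP forallP) => [H i j ij|H i]; first by have /forallP/(_ j)/implyP := H i; apply.
by apply/forallP => j; apply/implyP/H.
Qed.

Lemma increasing_injective a : increasing a -> injective a.
Proof.
move=> /increasingP ia i j aij; apply: val_inj.
by case: (ltngtP i j) => // /ia; rewrite aij ltnn.
Qed.

(** It supplies [r_sub] for rows indexed by increasing multi-indices: a strictly sorted list is
    determined by its set of entries. *)
Lemma increasing_sub_eq a c : increasing a -> increasing c ->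
  (forall i, a i \in codom c) -> a = c.
Proof.
move=> ia ic ac.
have st (b : tpindex) : increasing b -> sorted ltn [seq (b i : nat) | i <- enum 'I_d].
  move=> /increasingP ib; rewrite sorted_map.
  have : sorted ltn [seq val i | i : 'I_d <- enum 'I_d] by rewrite val_enum_ord iota_ltn_sorted.
  by rewrite sorted_map; apply: sub_sorted => i j; exact: ib.
have es : [seq (a i : nat) | i <- enum 'I_d] = [seq (c i : nat) | i <- enum 'I_d].
  apply: (irr_sorted_eq ltn_trans ltnn (st _ ia) (st _ ic)).
  have ua : uniq [seq (a i : nat) | i <- enum 'I_d].
    by rewrite map_inj_uniq ?enum_uniq// => i j /val_inj/(increasing_injective ia).
  apply: (uniq_min_size ua _ _).2; last by rewrite !size_map.
  move=> _ /mapP[i _ ->]; have /codomP[j ->] := ac i.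
  by apply: map_f; rewrite mem_enum.
apply/ffunP => i; apply: val_inj.
have : nth 0%N [seq (a i : nat) | i <- enum 'I_d] i = nth 0%N [seq (c i : nat) | i <- enum 'I_d] i.
  by rewrite es.
by rewrite !(nth_map i) -?enumT ?size_enum_ord// nth_ord_enum.
Qed.

Lemma sort_index a : injective a -> exists s : 'S_d, increasing (index_perm s a).
Proof.
move=> ia; pose t := [tuple (a i : nat) | i < d].
have /tuple_permP[s st] : perm_eq (sort leq t) t by rewrite perm_sort.
have ut : uniq t by rewrite map_inj_uniq ?enum_uniq// => i j /val_inj/ia.
exists s; have lt_sorted : sorted ltn (sort leq t).
  by rewrite ltn_sorted_uniq_leq sort_uniq ut sort_sorted//; exact: leq_total.
have nE (i : 'I_d) : nth 0%N (sort leq t) i = a (s i).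
  rewrite st; have := tnth_nth 0%N [tuple tnth t (s i) | i < d] i.
  by rewrite !tnth_mktuple => <-.
apply/increasingP => i j ij; rewrite !ffunE -!nE.
by apply: (sorted_ltn_nth ltn_trans) => //; rewrite inE size_sort size_tuple.
Qed.

Lemma twedge_alternating_tensor v : alternating_tensor (twedge v).
Proof.
apply/andP; split; [apply/forallP => a|apply/forallP => s].
  apply/implyP => /injectivePn[i [j ij aij]]; rewrite twedgeE -det_tr.
  by apply/eqP/(determinant_alternate ij) => k; rewrite !mxE aij.
apply/forallP => a; rewrite !twedgeE.
set A := \matrix_(_, _) _; set B := \matrix_(_, _) _.
have -> : A = col_perm s B by apply/matrixP => k i; rewrite !mxE ffunE.
by rewrite col_permE det_mulmx det_perm odd_permV mulrC.
Qed.

Lemma twedge_basis a c : increasing a -> increasing c -> twedge (tbasis a) c = (a == c)%:R.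
Proof.
move=> ia ic; have bE i k : coord (vbasis {:V}) i (vbasis {:V})`_(k : 'I__) = (k == i)%:R.
  by rewrite coord_free ?(basis_free (vbasisP _))// eq_sym.
rewrite twedgeE; have [->|ac] := eqVneq a c.
  rewrite (_ : \matrix_(_, _) _ = 1%:M) ?det1//; apply/matrixP => k i.
  by rewrite !mxE bE (inj_eq (increasing_injective ic)).
have [i ni] : exists i, a i \notin codom c.
  apply/existsP; rewrite -negb_forall; apply: contra ac => /forallP ac.
  by apply/eqP; exact: increasing_sub_eq.
rewrite (expand_det_row _ i) big1// => k _; rewrite !mxE bE.
by case: eqP => [aik|_]; rewrite ?mul0r//; rewrite aik codom_f in ni.
Qed.

Lemma alternating_tensor_expand T : alternating_tensor T ->
  T = \sum_(c | increasing c) T c *: twedge (tbasis c).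
Proof.
move=> /andP[/forallP T0 /forallP TS]; apply/ffunP => a.
rewrite sum_ffunE.
have [/injectiveP ia|na] := boolP (injectiveb a); last first.
  have /implyP/(_ na)/eqP-> := T0 a; rewrite big1// => c _; rewrite ffunE.
  have /andP[/forallP/(_ a)/implyP/(_ na)/eqP-> _] := twedge_alternating_tensor (tbasis c).
  by rewrite /GRing.scale/= mulr0.
have [s is_] := sort_index ia.
have TE T' : alternating_tensor T' -> T' a = (-1) ^+ s * T' (index_perm s a).
  move=> /andP[_ /forallP/(_ s)/forallP/(_ a)/eqP->].
  by rewrite mulrA -expr2 sqrr_sign mul1r.
rewrite (TE T); last by apply/andP; split; apply/forallP.
rewrite (bigD1 (index_perm s a))//= big1 ?addr0 => [|c /andP[ic nc]].
  rewrite ffunE (TE (twedge _)) ?twedge_alternating_tensor// twedge_basis// eqxx mulr1.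
  by rewrite /GRing.scale/= mulrC.
rewrite ffunE (TE (twedge _)) ?twedge_alternating_tensor// twedge_basis//.
by rewrite (negbTE nc) mulr0 /GRing.scale/= mulr0.
Qed.

End Wedge.

Lemma alternating_comp (K : fieldType) (d : nat) (V0 V W : vectType K)
    (psi : {linear V0 -> V}) (F : ('I_d -> V) -> W) :
  alternating_multilinear F -> alternating_multilinear (fun y => F (psi \o y)).
Proof.
move=> [mF aF]; split=> [y i k u v|y i j ij yij]; last first.
  by apply: (aF _ i j ij); rewrite /= yij.
have dE z : psi \o dfwith (T := fun=> V0) y i z = dfwith (T := fun=> V) (psi \o y) i (psi z).
  apply: funext => j /=; have [->|ij] := eqVneq j i; first by rewrite !dfwithin.
  by rewrite !dfwithout// eq_sym.
by rewrite !dE linearP mF.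
Qed.

Section AlternatingBeta.
Variables (K : fieldType) (d : nat) (V0 V W : vectType K).
Variables (psi : {linear V0 -> V}) (F : ('I_d -> V) -> W).
Hypothesis aF : alternating_multilinear F.
Local Notation index := (tindex (fun _ : 'I_d => V0)).
Hypothesis independent : forall g : index -> K,
  \sum_(c | increasing c) g c *: F (psi \o tbasis c) = 0 -> forall c, increasing c -> g c = 0.

Lemma increasing_through (b : 'I_(\dim {:V0})) : (0 < d)%N -> (d <= \dim {:V0})%N ->
  exists2 c : index, increasing c & exists j, c j = b.
Proof.
move=> d0 dV; have d1 : (d.-1 < d)%N by rewrite prednK.
(* The entries 0, ..., d - 1, the last one raised to [b] when [b] is not among them. *)
pose c : index := [ffun i : 'I_d => if (d <= b)%N && (i == d.-1 :> nat) then b else widen_ord dV i].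
exists c.
  apply/increasingP => i j ij; rewrite !ffunE.
  have id : (i == d.-1 :> nat) = false.
    by apply: ltn_eqF; rewrite -ltnS prednK// (leq_ltn_trans ij).
  rewrite id andbF; case: ifP => [/andP[db _]|_//] /=.
  exact: leq_trans db.
have [db|bd] := leqP d b; first by exists (Ordinal d1); rewrite ffunE db eqxx.
by exists (Ordinal bd); rewrite ffunE leqNgt bd /=; apply: val_inj.
Qed.

(** Put a kernel vector [y] into a slot [j] where [c j = b]: [F] vanishes there, and the coefficient
    at [c] in its expansion is the coordinate of [y] at [b]. *)
Lemma independent_injective : (0 < d)%N -> (d <= \dim {:V0})%N -> injective psi.
Proof.
move=> d0 dV; apply: raddf_inj => y psiy.
rewrite (coord_vbasis (memvf y)) big1// => b _.
have [c ic [j cj]] := increasing_through b d0 dV.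
pose v i := if i == j then y else tbasis c i.
have := altlift_wedge v (alternating_comp psi aF).
rewrite /altlift (multilinear_slot0 (V := fun=> V) (i := j) aF.1); last by rewrite /= /v eqxx.
move=> /independent/(_ c ic); rewrite twedgeE.
have bE i k : coord (vbasis {:V0}) (c i) (tbasis c k) = (k == i)%:R.
  rewrite coord_free ?(basis_free (vbasisP _))//.
  by rewrite (inj_eq (increasing_injective ic)).
rewrite (expand_det_col _ j) (bigD1 j)//= [X in _ + X]big1 ?addr0 => [|k kj]; last first.
  by rewrite mxE /v (negbTE kj) bE (negbTE kj) mul0r.
rewrite mxE /v eqxx cj /cofactor (_ : row' j _ = 1%:M) ?det1 => [|].
  by rewrite mulr1 -signr_odd addnn odd_double expr0 mulr1 => ->; rewrite scale0r.
apply/matrixP => k i; rewrite !mxE eq_sym (negbTE (neq_lift _ _)) bE.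
by rewrite (inj_eq lift_inj).
Qed.

Lemma independent_beta_alt : injective psi ->
  exists U : {vspace V}, \dim U = \dim {:V0} /\
    {in [predI tsubspace (fun _ : 'I_d => U) & alternating_tensor] &, injective (altlift F)}.
Proof.
move=> psiI; pose f := linfun psi; pose U := limg f.
have fE y : f y = psi y by rewrite lfunE.
have dU : \dim U = \dim {:V0}.
  apply: limg_dim_eq; apply/eqP; rewrite -subv0; apply/subvP => y.
  rewrite memv_cap memv_ker fE memv0 => /andP[_ /eqP psiy].
  by apply/eqP/psiI; rewrite psiy linear0.
exists U; split => // T1 T2 /andP[/= T1U aT1] /andP[/= T2U aT2] eT.
set T := T1 - T2.
have TU : T \in tsubspace (fun _ : 'I_d => U) by exact: memvB.
have aT : alternating_tensor T.
  move: aT1 aT2 => /andP[/forallP z1 /forallP s1] /andP[/forallP z2 /forallP s2].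
  apply/andP; split; [apply/forallP => a|apply/forallP => s].
    apply/implyP => na; rewrite !ffunE.
    by have /implyP/(_ na)/eqP-> := z1 a; have /implyP/(_ na)/eqP-> := z2 a; rewrite subrr.
  apply/forallP => a; rewrite !ffunE mulrBr.
  by have /forallP/(_ a)/eqP-> := s1 s; have /forallP/(_ a)/eqP-> := s2 s.
have altD k T' T'' : altlift F (k *: T' + T'') = k *: altlift F T' + altlift F T''.
  rewrite /altlift scaler_sumr -big_split; apply: eq_bigr => c _ /=.
  by rewrite !ffunE scalerDl scalerA.
have FT : altlift F T = 0.
  have -> : T = (-1) *: T2 + T1 by rewrite scaleN1r addrC.
  by rewrite altD scaleN1r eT addNr.
(* Projecting every factor to [U] fixes [T] and sends basis wedges of [V] to wedges of vectors in
   the image of [psi]. This avoids antisymmetrization and a division by d!. *)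
pose G (v : 'I_d -> V) := tpure (V := fun=> V) (projv U \o v).
have mG : multilinear (V := fun=> V) G.
  move=> v i k x y; have dE z : projv U \o dfwith (T := fun=> V) v i z =
      dfwith (T := fun=> V) (projv U \o v) i (projv U z).
    apply: funext => j /=; have [->|ij] := eqVneq j i; first by rewrite !dfwithin.
    by rewrite !dfwithout// eq_sym.
  by rewrite /G !dE linearP tpure_multilinear.
have GT : tlift (V := fun=> V) G T = T.
  move: (T) TU; apply: span_ind => [|k T' T'' e' e''|_ /mapP[b _ ->]].
  - by rewrite /tlift big1// => a _; rewrite ffunE scale0r.
  - by rewrite tlift_linear e' e''.
  rewrite tlift_pure//; congr tpure; apply: funext => i /=.
  by rewrite projv_id// vbasis_mem// mem_nth// size_tuple.
have Gw v : tlift (V := fun=> V) G (twedge v) = twedge (projv U \o v).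
  rewrite /twedge tlift_sum; apply: eq_bigr => s _.
  by rewrite tlift_pure.
have /choice[y yE] : forall x : V, exists y, projv U x = psi y.
  by move=> x; have /memv_imgP[y _ ->] := memv_proj U x; exists y; rewrite fE.
pose gam c0 := \sum_(c | increasing c) T c * twedge (y \o tbasis c) c0.
have TE : T = \sum_(c0 : index | increasing c0) gam c0 *: twedge (psi \o tbasis c0).
  rewrite -{1}GT (alternating_tensor_expand aT) tlift_sum.
  rewrite (eq_bigr (fun c => \sum_(c0 : index | increasing c0)
      (T c * twedge (y \o tbasis c) c0) *: twedge (psi \o tbasis c0))) => [|c ic].
    by rewrite exchange_big; apply: eq_bigr => c0 _; rewrite -scaler_suml.
  rewrite Gw (_ : projv U \o _ = psi \o (y \o tbasis c)); last first.
    by apply: funext => i /=; rewrite yE.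
  rewrite -(altlift_wedge (y \o tbasis c) (alternating_comp psi (@twedge_alternating _ _ _))).
  rewrite /altlift scaler_sumr; apply: eq_bigr => c0 _.
  by rewrite scalerA.
have gam0 : forall c0, increasing c0 -> gam c0 = 0.
  apply: independent; rewrite -[RHS]FT TE.
  have alt0 : altlift F 0 = 0 by rewrite /altlift big1// => c _; rewrite ffunE scale0r.
  elim/big_rec2: _ => // c0 u v _ ->.
  by rewrite altD altlift_wedge.
apply/eqP; rewrite -subr_eq0 -/T TE big1// => c0 ic0.
by rewrite gam0// scale0r.
Qed.

End AlternatingBeta.

(** * The dichotomies *)

Import passmx.

(** A nonzero polynomial vanishing everywhere bounds the number of elements, and a longest
    duplicate-free list exhausts the field. *)
Lemma nonvanishing_or_finite (K : fieldType) :
  poly_nonvanishing K \/ exists e : seq K, forall x, x \in e.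
Proof.
have [|/existsNP[p /not_implyP[p0 /forallNP px]]] := pselect (poly_nonvanishing K); first by left.
right; pose P n := `[< exists2 e : seq K, uniq e & size e = n >].
have exP : exists n, P n by exists 0%N; apply/asboolP; exists [::].
have ubP n : P n -> (n <= size p)%N.
  move=> /asboolP[e ue <-]; apply/ltnW/(max_poly_roots p0 _ ue); apply/seq.allP => x _.
  by apply/eqP; have /negP/negPn/eqP := px x.
case: (ex_maxnP exP ubP) => n /asboolP[e ue <-] emax; exists e => x.
apply: contraT => xe; have := emax (size e).+1; rewrite ltnn; apply.
by apply/asboolP; exists (x :: e); rewrite //= xe.
Qed.

(** An equality rather than an isomorphism, so that results over [Kf] transfer to [K] by
    rewriting. *)
Lemma finite_field_structure (K : fieldType) (l : seq K) : (forall x, x \in l) ->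
  exists Kf : finFieldType, (Kf : fieldType) = K.
Proof.
move=> lP.
have ax : Finite.axiom (undup l) by move=> x; rewrite count_uniq_mem ?undup_uniq// mem_undup lP.
pose pk (x : K) := index x l; pose upk k := onth l k.
have pkK : pcancel pk upk.
  by move=> x; rewrite /pk /upk onthE (nth_map x) ?index_mem ?lP// nth_index.
move: (undup l) pk upk pkK ax; clear lP l.
case: K => T []; intros; set K0 := GRing.Field.Pack _ in pk upk pkK ax *.
by exists (HB.pack_for finFieldType T (Choice_isCountable.Build K0 pkK) (isFinite.Build K0 ax) K0).
Qed.

(** Common conclusion of both methods: [2 ^ d] and [2 * s] stem from the counting argument, the
    factor [d] from the greedy one. Row vectors suit the count of matrices. *)
Definition slot_isotropy (K : fieldType) : Prop :=
  forall (d n s : nat) (W : vectType K) (F : ('I_d -> 'rV[K]_n) -> W)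
    (S I : finType) (r : I -> 'I_d -> S),
  multilinear (V := fun=> 'rV[K]_n) F ->
  (forall k, injective (r k)) ->
  (forall k l, (forall i, r k i \in codom (r l)) -> k = l) ->
  (forall x : S -> 'rV[K]_n, exists c : I -> K,
    (exists k, c k != 0) /\ \sum_k c k *: slot_row F r k x = 0) ->
  (0 < d)%N -> (0 < s)%N -> (2 ^ d * d * s ^ d.-1 * #|I| + 2 * s <= n)%N ->
  exists u : s.-tuple 'rV[K]_n, free u /\
    forall e : 'I_d -> 'I_s, injective e -> F (fun i => u`_(e i)) = 0.

Lemma slot_isotropy_finite (K : finFieldType) : slot_isotropy K.
Proof.
move=> d n s W F S I r mF r_inj r_sub dependent d0 s0 nbig.
apply: (finite_isotropic mF (zero_density mF r_inj r_sub dependent) d0 s0).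
apply: leq_trans nbig; rewrite leq_add2r -!mulnA leq_mul2l; apply/orP; right.
by rewrite leq_pmull.
Qed.

Lemma slot_isotropy_infinite (K : fieldType) : poly_nonvanishing K -> slot_isotropy K.
Proof.
move=> Kinf d n s W F S I r mF r_inj r_sub dependent d0 s0 nbig.
have [|||u [fu uF]] := @infinite_isotropic K d _ _ (rVof (vbasis {:W}) \o F) Kinf _ S I r r_inj r_sub _ s.
- move=> x i a u v.
  have e := congr1 (rVof (vbasis {:W})) (@mF x i a u v).
  by apply: (etrans e); rewrite linearP.
- move=> x; have [c [c0 cx]] := dependent x; exists c; split => //.
  transitivity (rVof (vbasis {:W}) (\sum_k c k *: slot_row F r k x)); last by rewrite cx linear0.
  by rewrite linear_sum; apply: eq_bigr => k _; rewrite linearZ.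
- rewrite dimvf /dim/= mul1n; apply: leq_trans nbig; apply: leq_add; last by rewrite leq_pmull.
  by rewrite -!mulnA leq_pmull// expn_gt0.
exists u; split => // e eI; apply: (can_inj (rVofK (vbasisP _))); rewrite linear0; exact: uF.
Qed.

Theorem isotropic_vectors (K : fieldType) : slot_isotropy K.
Proof.
have [|[l lP]] := nonvanishing_or_finite K; first exact: slot_isotropy_infinite.
by have [Kf <-] := finite_field_structure lP; exact: slot_isotropy_finite.
Qed.

Section Embedding.
Variables (K : fieldType) (V : vectType K) (n : nat).

Definition embed (y : 'rV[K]_n) : V := \sum_i y 0 i *: (vbasis {:V})`_i.

Fact embed_linear : linear embed.
Proof.
move=> a u v; rewrite /embed scaler_sumr -big_split; apply: eq_bigr => i _ /=.
by rewrite !mxE scalerDl scalerA.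
Qed.

HB.instance Definition _ := GRing.isLinear.Build K 'rV[K]_n V _ embed embed_linear.

Lemma embed_inj : (n <= \dim {:V})%N -> injective embed.
Proof.
move=> nV; apply: raddf_inj => y y0; apply/rowP => i; rewrite mxE.
have := congr1 (coord (vbasis {:V}) (widen_ord nV i)) y0.
rewrite linear0 linear_sum (bigD1 i)//= linearZ/=.
rewrite -[val i]/(val (widen_ord nV i)) coord_free ?(basis_free (vbasisP _))// eqxx mulr1.
rewrite big1 ?addr0// => j ji; rewrite linearZ/= -[val j]/(val (widen_ord nV j)).
rewrite coord_free ?(basis_free (vbasisP _))//; case: eqP => [ij|_]; last by rewrite mulr0.
by case/eqP: ji; apply: val_inj; have := congr1 val ij.
Qed.

End Embedding.

Section BasisMap.
Variables (K : fieldType) (V0 V : vectType K) (x : 'I_(\dim {:V0}) -> V).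

Definition basis_map (y : V0) : V := \sum_b coord (vbasis {:V0}) b y *: x b.

Fact basis_map_linear : linear basis_map.
Proof.
move=> a u v; rewrite /basis_map scaler_sumr -big_split; apply: eq_bigr => i _ /=.
by rewrite linearP scalerDl scalerA.
Qed.

HB.instance Definition _ := GRing.isLinear.Build K V0 V _ basis_map basis_map_linear.

Lemma basis_mapE (b : 'I_(\dim {:V0})) : basis_map (vbasis {:V0})`_b = x b.
Proof.
rewrite /basis_map (bigD1 b)//= coord_free ?(basis_free (vbasisP _))// eqxx scale1r.
rewrite big1 ?addr0// => i ib; rewrite coord_free ?(basis_free (vbasisP _))//.
by rewrite eq_sym (negbTE ib) scale0r.
Qed.

End BasisMap.

Lemma free_subfamily (K : fieldType) (V0 V : vectType K) (f : {linear V0 -> V})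
    (s k : nat) (u : s.-tuple V0) (g : 'I_k -> 'I_s) :
  injective f -> free u -> injective g -> free [tuple f u`_(g b) | b < k].
Proof.
move=> fI /freeP fu gI; apply/freeP => c cE b.
have := fu (fun i => \sum_(b | g b == i) c b) _ (g b).
rewrite (big_pred1 b) => [|b']; last by rewrite (inj_eq gI).
apply; apply: fI; rewrite linear0 linear_sum -[RHS]cE/=.
rewrite (partition_big g xpredT)//=; apply: eq_bigr => i _.
rewrite linearZ/= scaler_suml; apply: eq_bigr => b' /eqP gb.
by rewrite -(tnth_nth 0 [tuple f u`_(g b) | b < k]) tnth_mktuple gb.
Qed.

(** The bound of [slot_isotropy] for [d * s] vectors and [t ^ d] rows; the summand [t] guarantees a
    subspace of dimension [t]. *)
Definition ramsey_bound (d s t : nat) : nat :=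
  (2 ^ d * d * (d * s) ^ d.-1 * t ^ d + 2 * (d * s) + t)%N.

Lemma leq_pow_pred (d s : nat) : (0 < d)%N -> (s ^ d.-1 <= (d * s) ^ d.-1)%N.
Proof.
move=> d0; case: d.-1 => [|k]; first by rewrite !expn0.
by rewrite leq_exp2r// leq_pmull.
Qed.

(** All [V i] receive a copy of one space of row vectors. The [d * s] isotropic vectors are cut into
    [d] disjoint blocks, block [i] spanning [U i], so that one vector from each block is always an
    injective choice. *)
Lemma multilinear_dichotomy (K : fieldType) (d s t : nat) (V : 'I_d -> vectType K)
    (W : vectType K) (F : (forall i, V i) -> W) :
  (0 < d)%N -> (0 < s)%N -> (forall i, ramsey_bound d s t <= \dim {:V i})%N ->
  multilinear F ->
  (exists U : forall i, {vspace V i}, (forall i, \dim (U i) = s) /\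
     forall x : forall i, V i, (forall i, x i \in U i) -> F x = 0) \/
  (exists U : forall i, {vspace V i}, (forall i, \dim (U i) = t) /\
     {in tsubspace U &, injective (tlift F)}).
Proof.
move=> d0 s0 dV mF; set n := ramsey_bound d s t in dV.
pose B := exists U : forall i, {vspace V i},
  (forall i, \dim (U i) = t) /\ {in tsubspace U &, injective (tlift F)}.
have [|nB] := pselect B; [by right|left].
pose emb i := @embed K (V i) n.
pose F0 (y : 'I_d -> 'rV[K]_n) := F (fun i => emb i (y i)).
have mF0 : multilinear (V := fun=> 'rV[K]_n) F0.
  move=> y i a u v; rewrite /F0.
  have dE z : (fun j => emb j (dfwith (T := fun=> 'rV[K]_n) y i z j)) =
      dfwith (fun j => emb j (y j)) i (emb i z).
    by apply: functional_extensionality_dep => j; case: dfwithP => [|k ik];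
      rewrite ?dfwithin ?dfwithout.
  by rewrite !dE /emb linearP mF.
pose r (a : {ffun 'I_d -> 'I_t}) (i : 'I_d) := (i, a i).
have [||||||u [fu uF]] := @isotropic_vectors K d n (d * s) W F0 _ _ r mF0.
- by move=> a i j [].
- move=> a b ab; apply/ffunP => i; have /codomP[j [ij ->]] := ab i.
  by rewrite ij.
- move=> x; apply: contrapT => /forallNP H; apply: nB.
  apply: (independent_beta (x := fun i b => emb i (x (i, b))) mF) => c c0 a.
  apply/eqP; apply: contrapT => /negP ca; apply: (H c); split; first by exists a.
  by rewrite -[RHS]c0; apply: eq_bigr.
- exact: d0.
- by rewrite muln_gt0 d0.
- rewrite card_ffun !card_ord /n /ramsey_bound leq_addr.
  by [].
pose g i (b : 'I_s) : 'I_(d * s) := mxvec_index i b.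
have gI : injective (fun ib => g ib.1 ib.2).
  by move=> [i b] [i' b'] /cast_ord_inj/enum_rank_inj.
pose x i b := emb i u`_(g i b).
exists (fun i => <<[tuple x i b | b < s]>>%VS); split=> [i|y yU].
  have fx : free [tuple x i b | b < s].
    apply: (free_subfamily (f := @embed K (V i) n)) => //; first exact: embed_inj.
    by move=> b b' /(gI (i, b) (i, b'))[].
  by rewrite (eqP fx) size_tuple.
have /choice[h hE] : forall i, exists h : 'I_s -> K, y i = \sum_b h b *: x i b.
  by move=> i; apply: mem_span_tuple.
have -> : y = fun i => \sum_b h i b *: x i b by apply: functional_extensionality_dep.
rewrite multilinear_expand// big1// => a _.
rewrite (_ : F _ = 0) ?scaler0//.
by apply: (uF (fun i => g i (a i))) => i j /(gI (i, a i) (j, a j))[].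
Qed.

Lemma alternating_dichotomy (K : fieldType) (d s t : nat) (V W : vectType K)
    (F : ('I_d -> V) -> W) :
  (0 < d)%N -> (0 < s)%N -> (ramsey_bound d s t <= \dim {:V})%N ->
  alternating_multilinear F ->
  (exists U : {vspace V}, \dim U = s /\
     forall x : 'I_d -> V, (forall i, x i \in U) -> F x = 0) \/
  (exists U : {vspace V}, \dim U = t /\
     {in [predI tsubspace (fun _ : 'I_d => U) & alternating_tensor] &, injective (altlift F)}).
Proof.
move=> d0 s0 dV aF; set n := ramsey_bound d s t in dV.
pose B := exists U : {vspace V}, \dim U = t /\
  {in [predI tsubspace (fun _ : 'I_d => U) & alternating_tensor] &, injective (altlift F)}.
have [|nB] := pselect B; [by right|left].
have dimt : \dim {:'rV[K]_t} = t by rewrite dimvf /dim/= mul1n.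
(* For [t < d] no multi-index is increasing, so independence is vacuous and the image of any
   embedding serves. *)
have dt : (d <= t)%N.
  rewrite leqNgt; apply/negP => td; apply: nB.
  have tV : (t <= \dim {:V})%N by apply: leq_trans dV; rewrite /n /ramsey_bound leq_addl.
  have [c _ c0|U [dU iU]] := @independent_beta_alt K d 'rV[K]_t V W (@embed K V t) F aF _ (embed_inj tV).
    move=> /increasing_injective/leq_card; rewrite !card_ord dimt.
    by rewrite leqNgt td.
  by exists U; rewrite dU dimt.
pose F0 (y : 'I_d -> 'rV[K]_n) := F (@embed K V n \o y).
have aF0 : alternating_multilinear F0 by exact: alternating_comp.
pose I := {c : tindex (fun _ : 'I_d => 'rV[K]_t) | increasing c}.
pose r (c : I) (i : 'I_d) := val c i.
have [||||||u [fu uF]] := @isotropic_vectors K d n s W F0 _ I r aF0.1.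
- by move=> c; exact: increasing_injective (valP c).
- move=> c c' cc'; apply: val_inj.
  exact: (increasing_sub_eq (valP c) (valP c')).
- move=> x; apply: contrapT => /forallNP H; apply: nB.
  pose psi := @basis_map K 'rV[K]_t V (@embed K V n \o x).
  have ind : forall g : tindex (fun _ : 'I_d => 'rV[K]_t) -> K,
      \sum_(c | increasing c) g c *: F (psi \o tbasis c) = 0 ->
      forall c, increasing c -> g c = 0.
    move=> g g0 c ic; apply/eqP; apply: contrapT => /negP gc.
    apply: (H (g \o val)); split; first by exists (exist _ c ic).
    rewrite -[RHS]g0 (reindex_omap (val : I -> _) insub)/=; last first.
      by move=> c' ic'; rewrite insubT.
    apply: eq_big => [k|k _]; first by rewrite (valP k) valK eqxx.
    congr (_ *: F _); apply: funext => i; rewrite /= /tbasis /psi.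
    by rewrite basis_mapE.
  have [|U [dU iU]] := independent_beta_alt aF ind (independent_injective aF ind d0 _).
    by rewrite dimt.
  by exists U; rewrite dU dimt.
- exact: d0.
- exact: s0.
- have cI : (#|{: I}| <= t ^ d)%N.
    have fI : injective (fun c : I => [ffun i => val c i]).
      by move=> c c' /ffunP e; apply/val_inj/ffunP => i; have := e i; rewrite !ffunE.
    by apply: leq_trans (leq_card _ fI) _; rewrite card_ffun !card_ord dimt.
  rewrite /n /ramsey_bound -addnA; apply: leq_add.
    by rewrite leq_mul// leq_mul// leq_pow_pred.
  by rewrite (leq_trans _ (leq_addr _ _))// leq_mul2l leq_pmull.
pose x (b : 'I_s) := embed V u`_b.
exists (<<[tuple x b | b < s]>>%VS); split=> [|y yU].
  have fx : free [tuple x b | b < s].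
    apply: (free_subfamily (f := @embed K V n) (g := id)) => //.
    exact: embed_inj.
  by rewrite (eqP fx) size_tuple.
have /choice[h hE] : forall i, exists h : 'I_s -> K, y i = \sum_b h b *: x b.
  by move=> i; apply: (mem_span_tuple (V := fun=> V) (x := fun=> x) (i := i)).
have -> : y = fun i => \sum_b h i b *: x b by apply: funext.
rewrite (multilinear_expand h (fun=> x) aF.1) big1// => a _.
rewrite (_ : F _ = 0) ?scaler0//.
have [/injectiveP aI|/injectivePn[i [j ij aij]]] := boolP (injectiveb a).
  exact: uF.
by apply: (aF.2 _ i j ij); rewrite aij.
Qed.

Lemma symmetric_dichotomy (K : closedFieldType) (d s t : nat) (V W : vectType K)
    (F : ('I_d -> V) -> W) :
  (0 < d)%N -> d`!%:R != 0 :> K -> (ramsey_bound d s t <= \dim {:V})%N ->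
  symmetric_multilinear F ->
  (exists U : {vspace V}, \dim U = s /\
     forall x : 'I_d -> V, (forall i, x i \in U) -> F x = 0) \/
  (exists U : {vspace V}, \dim U = t /\
     {in [predI tsubspace (fun _ : 'I_d => U) & symmetric_tensor] &,
        injective (tlift (V := fun=> V) F)}).
Proof.
move=> d0 dn0 dV sF.
pose B := exists U : {vspace V}, \dim U = t /\
  {in [predI tsubspace (fun _ : 'I_d => U) & symmetric_tensor] &,
     injective (tlift (V := fun=> V) F)}.
have [|nB] := pselect B; [by right|left].
have [|||u [fu uF]] := @closed_isotropic K d _ t V (rVof (vbasis {:W}) \o F) _ dn0 _ s.
- split=> [x i a u v|x p]; last by rewrite /= sF.2.
  have e := congr1 (rVof (vbasis {:W})) (sF.1 x i a u v).
  by apply: (etrans e); rewrite linearP.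
- move=> x; apply: contrapT => /forallNP H; apply: nB.
  have ind (c : {ffun 'I_d -> 'I_t} -> K) :
      (forall (p : 'S_d) (a : {ffun 'I_d -> 'I_t}), c [ffun i => a (p i)] = c a) ->
      \sum_a c a *: F (x \o a) = 0 -> forall a, c a = 0.
    move=> cs c0 a; apply/eqP; apply: contrapT => /negP ca; apply: (H c).
    split => //; first by exists a.
    transitivity (rVof (vbasis {:W}) (\sum_a c a *: F (x \o a))); last by rewrite c0 linear0.
    by rewrite linear_sum; apply: eq_bigr => k _; rewrite linearZ.
  exact: (independent_beta_sym sF dn0 ind (independent_free_sym sF ind d0)).
- apply: leq_trans dV; rewrite /ramsey_bound.
  rewrite -addnA; apply: leq_add; last first.
    by rewrite (leq_trans _ (leq_addr _ _))// mulnA leq_pmull// muln_gt0 d0.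
  rewrite leq_mul2r; apply/orP; right; rewrite mulnAC.
  by apply: leq_mul; [rewrite leq_mul2r ltnW ?orbT// ltn_expl|exact: leq_pow_pred].
exists <<u>>%VS; split=> [|y yU]; first by rewrite (eqP fu) size_tuple.
have /choice[h hE] : forall i, exists h : 'I_s -> K, y i = \sum_b h b *: u`_b.
  move=> i; exists (fun b => coord u b (y i)); exact: coord_span.
have -> : y = fun i => \sum_b h i b *: u`_b by apply: funext.
rewrite (multilinear_expand h (fun _ (b : 'I_s) => u`_b) sF.1) big1// => a _.
rewrite (_ : F _ = 0) ?scaler0//.
apply: (can_inj (rVofK (vbasisP _))); rewrite linear0; exact: uF.
Qed.

(** * Ramsey numbers *)

From mathcomp Require Import all_reals all_analysis.

Import Order.TTheory Num.Theory.

Local Open Scope classical_set_scope.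
Local Open Scope card_scope.
Local Open Scope ring_scope.

Lemma is_least_exists (A : set nat) m : A m -> exists n, is_least A n.
Proof.
move=> Am; have exA : exists n, `[< A n >] by exists m; exact/asboolP.
case: (ex_minnP exA) => n /asboolP An nmin; exists n; split => // k Ak.
exact/nmin/asboolP.
Qed.

Lemma nat_sup_ge (R : realType) (A : set nat) n : A n -> (n%:R%:E <= nat_sup R A)%E.
Proof. by move=> An; apply: ereal_sup_ubound; exists n. Qed.

Lemma subspace_of_dim (K : fieldType) (V : vectType K) n : (n <= \dim {:V})%N ->
  exists U : {vspace V}, \dim U = n.
Proof.
move=> nV; exists <<take n (vbasis {:V})>>%VS.
have : free (take n (vbasis {:V}) ++ drop n (vbasis {:V})).
  by rewrite cat_take_drop (basis_free (vbasisP _)).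
by move=> /catl_free/eqP->; rewrite size_takel// size_tuple.
Qed.

Lemma factorial_neq0 (K : fieldType) d : (forall p, p \in [pchar K] -> (d < p)%N) ->
  d`!%:R != 0 :> K.
Proof.
move=> dp; apply/eqP => d0.
have [p pK] := natf0_pchar (fact_gt0 d) (introT eqP d0 : d`!%:R == 0 :> K).
have := dp p pK; apply/negP; rewrite -leqNgt.
have : (p %| d`!)%N by rewrite (dvdn_pcharf pK) d0.
have pp := pcharf_prime pK.
elim: d {dp d0} => [|d IH]; first by rewrite dvdn1 => /eqP p1; rewrite p1 in pp.
by rewrite factS Euclid_dvdM// => /orP[/dvdn_leq->//|/IH/leqW].
Qed.

Lemma ord_neq0 n (i : 'I_n) : n <> 0%N.
Proof. by move=> n0; have := ltn_ord i; rewrite {2}n0. Qed.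

Lemma eq_fun0 d (V : 'I_d -> Type) (x y : forall i, V i) : d = 0%N -> x = y.
Proof.
by move=> d0; apply: functional_extensionality_dep => i; case: (ord_neq0 i d0).
Qed.

Section Thresholds.
Variables (R : realType) (d s t : nat).

(** For [d >= 2] the target bound is 0 when [s] or [t] is 0, hence the value 0 there. For [d = 0]
    the space must be able to contain subspaces of dimensions [s] and [t]. *)
Definition threshold : nat :=
  if d is 0%N then (s + t)%N else if (s == 0)%N || (t == 0)%N then 0%N else ramsey_bound d s t.

Lemma ffun0_unique (J : finType) (f g : {ffun 'I_d -> J}) : d = 0%N -> f = g.
Proof. by move=> d0; apply/ffunP => i; case: (ord_neq0 i d0). Qed.

Lemma ramsey_threshold (K : fieldType) (V : 'I_d -> vectType K) (W : vectType K)
    (F : (forall i, V i) -> W) :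
  (forall i, threshold <= \dim {:V i})%N -> multilinear F ->
  (s%:R%:E <= alpha R F)%E \/ (t%:R%:E <= beta R F)%E.
Proof.
move=> dV mF.
(* For [d = 0], [F] is a single vector of [W]: if it is zero [alpha] is large, otherwise [beta]
   is. *)
have [d0|dn0] := posnP d.
  have [F0|/existsNP[x0 Fx0]] := pselect (forall x, F x = 0).
    by left; apply: nat_sup_ge; exists (fun i => 0%VS); split => // i; case: (ord_neq0 i d0).
  right; apply: nat_sup_ge.
  apply: (independent_beta (x := fun i _ => x0 i) mF) => c c0 a; apply/eqP.
  move: c0; rewrite (bigD1 a)//= big1 ?addr0 => [/eqP|a' /eqP[]]; last exact: ffun0_unique.
  by rewrite scaler_eq0 (introF eqP Fx0) orbF.
have [s0|s0] := posnP s.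
  left; apply: nat_sup_ge; rewrite s0; exists (fun=> 0%VS); split => [i|x x0].
    by rewrite dimv0.
  by apply: (multilinear_slot0 (i := Ordinal dn0) mF); apply/eqP; rewrite -memv0.
have [t0|t0] := posnP t.
  right; apply: nat_sup_ge; apply: (independent_beta (x := fun i _ => 0) mF) => c _ a.
  by case: (ord_neq0 (a (Ordinal dn0)) t0).
have {}dV i : (ramsey_bound d s t <= \dim {:V i})%N.
  by have := dV i; rewrite /threshold; case: (d) dn0 => // d' _; rewrite !gtn_eqF.
have [[U HU]|[U HU]] := multilinear_dichotomy dn0 s0 dV mF.
  by left; apply: nat_sup_ge; exists U.
by right; apply: nat_sup_ge; exists U.
Qed.

Lemma ramsey_alt_threshold (K : fieldType) (V W : vectType K) (F : ('I_d -> V) -> W) :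
  (threshold <= \dim {:V})%N -> alternating_multilinear F ->
  (s%:R%:E <= alpha_diag R F)%E \/ (t%:R%:E <= beta_alt R F)%E.
Proof.
move=> dV aF; have dimt : \dim {:'rV[K]_t} = t by rewrite dimvf /dim/= mul1n.
have [d0|dn0] := posnP d.
  have [sV tV] : (s <= \dim {:V} /\ t <= \dim {:V})%N.
    have : (s + t <= \dim {:V})%N by move: dV; rewrite /threshold; case: (d) d0.
    by move=> st; split; apply: leq_trans st; rewrite ?leq_addr ?leq_addl.
  have [F0|/existsNP[x0 Fx0]] := pselect (forall x, F x = 0).
    left; have [U dU] := subspace_of_dim sV.
    by apply: nat_sup_ge; exists U.
  have allF0 x : F x = F x0 by congr F; exact: (eq_fun0 (V := fun=> V)).
  right; apply: nat_sup_ge.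
  have [g g0 c ic|U [dU iU]] :=
      @independent_beta_alt K d 'rV[K]_t V W (@embed K V t) F aF _ (embed_inj tV).
    apply/eqP; move: g0; rewrite (bigD1 c)//= big1 ?addr0 => [/eqP|c' /andP[_ /eqP[]]].
      by rewrite (allF0 (_ \o _)) scaler_eq0 (introF eqP Fx0) orbF.
    by apply/ffunP => i; case: (ord_neq0 i d0).
  by exists U; rewrite dU dimt.
have [s0|s0] := posnP s.
  left; apply: nat_sup_ge; rewrite s0; exists 0%VS; split => [|x x0].
    by rewrite dimv0.
  by apply: (multilinear_slot0 (V := fun=> V) (i := Ordinal dn0) aF.1); apply/eqP; rewrite -memv0.
have [t0|t0] := posnP t.
  right; apply: nat_sup_ge.
  have [||U [dU iU]] := @independent_beta_alt K d 'rV[K]_t V W (@embed K V t) F aF.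
  - by move=> g _ c _; case: (ord_neq0 (c (Ordinal dn0)) (etrans dimt t0)).
  - by apply: embed_inj; rewrite t0.
  by exists U; rewrite dU dimt.
have {}dV : (ramsey_bound d s t <= \dim {:V})%N.
  by move: dV; rewrite /threshold; case: (d) dn0 => // d' _; rewrite !gtn_eqF.
have [[U HU]|[U HU]] := alternating_dichotomy dn0 s0 dV aF.
  by left; apply: nat_sup_ge; exists U.
by right; apply: nat_sup_ge; exists U.
Qed.

Lemma ramsey_sym_threshold (K : closedFieldType) (V W : vectType K) (F : ('I_d -> V) -> W) :
  d`!%:R != 0 :> K -> (threshold <= \dim {:V})%N -> symmetric_multilinear F ->
  (s%:R%:E <= alpha_diag R F)%E \/ (t%:R%:E <= beta_sym R F)%E.
Proof.
move=> df dV sF.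
have [d0|dn0] := posnP d.
  have [sV tV] : (s <= \dim {:V} /\ t <= \dim {:V})%N.
    have : (s + t <= \dim {:V})%N by move: dV; rewrite /threshold; case: (d) d0.
    by move=> st; split; apply: leq_trans st; rewrite ?leq_addr ?leq_addl.
  have [F0|/existsNP[x0 Fx0]] := pselect (forall x, F x = 0).
    left; have [U dU] := subspace_of_dim sV.
    by apply: nat_sup_ge; exists U.
  have allF0 x : F x = F x0 by congr F; exact: (eq_fun0 (V := fun=> V)).
  right; apply: nat_sup_ge.
  apply: (independent_beta_sym (x := fun b : 'I_t => embed V (delta_mx 0 b : 'rV[K]_t)) sF df) => [c _ c0 a|].
    apply/eqP; move: c0; rewrite (bigD1 a)//= big1 ?addr0 => [/eqP|c' /eqP[]]; last exact: ffun0_unique.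
    by rewrite (allF0 (_ \o _)) scaler_eq0 (introF eqP Fx0) orbF.
  apply/freeP => c cE b; have /rowP/(_ b) : \row_i c i = 0 :> 'rV[K]_t.
    apply: (embed_inj tV); rewrite linear0 -[RHS]cE.
    rewrite (row_sum_delta (\row_i c i)) linear_sum; apply: eq_bigr => i _.
    by rewrite linearZ mxE -tnth_nth tnth_mktuple.
  by rewrite !mxE.
have [s0|s0] := posnP s.
  left; apply: nat_sup_ge; rewrite s0; exists 0%VS; split => [|x x0].
    by rewrite dimv0.
  by apply: (multilinear_slot0 (V := fun=> V) (i := Ordinal dn0) sF.1); apply/eqP; rewrite -memv0.
have [t0|t0] := posnP t.
  right; apply: nat_sup_ge.
  apply: (independent_beta_sym (x := fun _ : 'I_t => 0) sF df) => [c _ _ a|].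
    by case: (ord_neq0 (a (Ordinal dn0)) t0).
  by apply/freeP => c _ b; case: (ord_neq0 b t0).
have {}dV : (ramsey_bound d s t <= \dim {:V})%N.
  by move: dV; rewrite /threshold; case: (d) dn0 => // d' _; rewrite !gtn_eqF.
have [[U HU]|[U HU]] := symmetric_dichotomy dn0 df dV sF.
  by left; apply: nat_sup_ge; exists U.
by right; apply: nat_sup_ge; exists U.
Qed.

End Thresholds.

Lemma threshold_le d s t : (2 <= d)%N ->
  (threshold d s t <= (2 ^ d * d * d ^ d.-1 + 2 * d + 1) * s ^ (d - 1) * t ^ d)%N.
Proof.
move=> d2; have -> : threshold d s t =
    if (s == 0)%N || (t == 0)%N then 0%N else ramsey_bound d s t by case: (d) d2.
have [->|s0] := posnP s; first by [].
have [->|t0] := posnP t; first by rewrite orbT.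
(* With [s] and [t] positive and [d >= 2], the linear terms in [s] and [t] are absorbed into the
   main one. *)
have e0 : (0 < d - 1)%N by rewrite subn_gt0.
have ss : (s <= s ^ (d - 1))%N by rewrite -{1}(expn1 s) leq_pexp2l.
have tt : (t <= t ^ d)%N by rewrite -{1}(expn1 t) leq_pexp2l// ltnW.
have st : (s <= s ^ (d - 1) * t ^ d)%N by rewrite (leq_trans ss)// leq_pmulr// expn_gt0 t0.
have ts : (t <= s ^ (d - 1) * t ^ d)%N by rewrite (leq_trans tt)// leq_pmull// expn_gt0 s0.
rewrite /= /ramsey_bound -subn1 expnMn -[leqRHS]mulnA (mulnDl _ 1%N) mul1n (mulnDl _ (2 * d)%N).
by rewrite !leq_add// -!mulnA// !leq_mul2l st !orbT.
Qed.

(** For [d = 1], rank and nullity give [s + t - 1], which no multiple of [t] bounds, hence [2 <= d].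
    At [s = t = 1] both logarithms vanish, hence the maximum with 1. The condition on the
    characteristic makes d! invertible. *)
Theorem theorem1p5 (R : realType) (d : nat) :
  (forall (K : fieldType) (s t : nat),
     (exists m, is_ramsey R K d s t m) /\
     (exists m, is_ramsey_alt R K d s t m)) /\
  (forall (K : closedFieldType) (s t : nat),
     (forall p, p \in [pchar K] -> (d < p)%N) ->
     exists m, is_ramsey_sym R K d s t m) /\
  ((2 <= d)%N -> exists2 C : R, 0 < C &
     (forall (K : fieldType) (s t m : nat), is_ramsey R K d s t m ->
        (infinite_set [set: K] ->
           m%:R <= C * s%:R ^+ (d - 1) * t%:R ^+ (d ^ 2)) /\
        (forall q : nat, [set: K] #= `I_q ->
           m%:R <= C * s%:R ^+ (d - 1) * t%:R ^+ d *
             Num.max 1 (logb R q s + logb R q t))) /\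
     (forall (K : fieldType) (s t m : nat), is_ramsey_alt R K d s t m ->
        (infinite_set [set: K] ->
           m%:R <= C * s%:R ^+ (d - 1) * t%:R ^+ (d ^ 2)) /\
        (forall q : nat, [set: K] #= `I_q ->
           m%:R <= C * s%:R ^+ (d - 1) * t%:R ^+ d *
             Num.max 1 (logb R q s + logb R q t))) /\
     (forall (K : closedFieldType) (s t m : nat),
        (forall p, p \in [pchar K] -> (d < p)%N) ->
        is_ramsey_sym R K d s t m ->
        m%:R <= C * s%:R ^+ (d - 1) * t%:R ^+ d)).
Proof.
split.
  move=> K s t; split; apply: (@is_least_exists _ (threshold d s t)).
    by move=> V W F; exact: ramsey_threshold.
  by move=> V W F; exact: ramsey_alt_threshold.
split.
  move=> K s t /factorial_neq0 df; apply: (@is_least_exists _ (threshold d s t)).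
  by move=> V W F; exact: ramsey_sym_threshold.
move=> d2; set C := (2 ^ d * d * d ^ d.-1 + 2 * d + 1)%N; exists C%:R; first by rewrite ltr0n /C addn1.
have bound (s t m : nat) : (m <= threshold d s t)%N ->
    m%:R <= C%:R * s%:R ^+ (d - 1) * t%:R ^+ d :> R.
  by move=> mT; rewrite -!natrX -!natrM ler_nat (leq_trans mT)// threshold_le.
have pos (s t e : nat) : 0 <= C%:R * s%:R ^+ (d - 1) * t%:R ^+ e :> R.
  by rewrite -!natrX -!natrM ler0n.
(* Both bounds weaken the uniform one: t^d <= t^(d^2), and the logarithmic factor is at least 1. *)
have weaken (s t m : nat) : (m <= threshold d s t)%N -> forall l : R,
    m%:R <= C%:R * s%:R ^+ (d - 1) * t%:R ^+ (d ^ 2) :> R /\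
    m%:R <= C%:R * s%:R ^+ (d - 1) * t%:R ^+ d * Num.max 1 l :> R.
  move=> /bound mb l; split; apply: (le_trans mb); last first.
    by rewrite ler_peMr// le_max lexx.
  rewrite -!natrX -!natrM ler_nat leq_mul2l; apply/orP; right.
  have [->|t0] := posnP t; first by rewrite exp0n// (leq_trans _ d2).
  by rewrite leq_pexp2l// leq_pmull// (leq_trans _ d2).
split.
  move=> K s t m [_ mleast].
  have mT : (m <= threshold d s t)%N by apply: mleast => V W F; exact: ramsey_threshold.
  by split=> [_|q _]; [have [] := weaken s t m mT 0|have [] := weaken s t m mT (logb R q s + logb R q t)].
split.
  move=> K s t m [_ mleast].
  have mT : (m <= threshold d s t)%N by apply: mleast => V W F; exact: ramsey_alt_threshold.
  by split=> [_|q _]; [have [] := weaken s t m mT 0|have [] := weaken s t m mT (logb R q s + logb R q t)].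
move=> K s t m /factorial_neq0 df [_ mleast]; apply: bound.
by apply: mleast => V W F; exact: ramsey_sym_threshold.
Qed.
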